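(* Let $X$ be a $C^1$ vector field on a closed manifold $M$ and let $\Lambda\subset M$ be an invariant compact set whose singularities $\sigma$ satisfy $W^s(\sigma)\cap\Lambda\setminus\{\sigma\}\neq\emptyset$ and $W^u(\sigma)\cap\Lambda\setminus\{\sigma\}\neq\emptyset$. If $\Lambda$ is multi-singular hyperbolic in the sense of Bonatti–da Luz, then $\Lambda$ is multi-singular hyperbolic.
   Context: $M$ is a closed manifold with a Riemannian metric $\langle\cdot,\cdot\rangle$. For a $C^1$ vector field $X$, $(\varphi_t)_{t\in\mathbb{R}}$ is the flow of $X$, $(D\varphi_t)$ the tangent flow on $TM$, and $\mathrm{Sing}(X)$ the set of zeros (singularities) of $X$. $W^s(\sigma),W^u(\sigma)$ are the stable and unstable manifolds of a hyperbolic singularity $\sigma$. Linear Poincaré flow: for $x\in M\setminus\mathrm{Sing}(X)$ let $\mathcal{N}(x)=\{v\in T_xM:\langle v,X(x)\rangle=0\}$ (identified with the quotient $T_xM/\mathbb{R}X(x)$ with the quotient metric), and for $v\in\mathcal{N}(x)$, $t\in\mathbb{R}$ let $$\Psi_t(v)=D\varphi_t(v)-\frac{\langle D\varphi_t(v),X(\varphi_t(x))\rangle}{\|X(\varphi_t(x))\|^2}X(\varphi_t(x))\in\mathcal{N}(\varphi_t(x)).$$ Extended linear Poincaré flow: let $\mathcal{G}^1$ be the projective bundle of all lines $L\subset T_xM$, $x\in M$ (with fiber $\mathcal{G}^1(x)$ over $x$), with the flow $\widehat\varphi_t(\mathbb{R}u)=\mathbb{R}D\varphi_t(u)$. For $L=\mathbb{R}u\in\mathcal{G}^1(x)$,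 let $\mathcal{N}(L)=\{v\in T_xM: v\perp L\}$ and for $v\in\mathcal{N}(L)$ let $$\widehat\Psi_t(v)=D\varphi_t(v)-\frac{\langle D\varphi_t(v),D\varphi_t(u)\rangle}{\|D\varphi_t(u)\|^2}D\varphi_t(u)\in\mathcal{N}(\widehat\varphi_t(L)).$$ This is a linear flow covering $(\widehat\varphi_t)$, and it coincides with $\Psi_t$ over $L=\mathbb{R}X(x)$, $x$ regular. Dominated splitting: for a linear flow $(A_t)$ on a vector bundle $\mathcal{B}\to\Lambda$ covering a flow $(\varphi_t)$ on $\Lambda$, an invariant splitting $\mathcal{B}=\mathcal{E}\oplus\mathcal{F}$ into subbundles of constant dimension is dominated if there are $\eta,T>0$ with $\|A_t|_{\mathcal{E}(x)}\|\cdot\|A_{-t}|_{\mathcal{F}(\varphi_t(x))}\|<e^{-\eta t}$ for all $x\in\Lambda$, $t>T$. A splitting into three or more bundles $\mathcal{E}_1\oplus\dots\oplus\mathcal{E}_\ell$ is dominated if each $(\mathcal{E}_1\oplus\dots\oplus\mathcal{E}_k)\oplus(\mathcal{E}_{k+1}\oplus\dots\oplus\mathcal{E}_\ell)$ is. $\mathcal{E}$ is uniformly contracted by $(A_t)$ if there are $\eta,T>0$ with $\|A_t|_{\mathcal{E}(x)}\|<e^{-\eta t}$ for all $x\in\Lambda$, $t>T$; $\mathcal{F}$ is uniformly expanded if there are $\eta,T>0$ with $\|A_{-t}|_{\mathcal{F}(x)}\|<e^{-\eta t}$ for all $x\in\Lambda$, $t>T$. Singular dominated splitting: let $\Lambda$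 be a compact invariant set of $X$. A $(\Psi_t)$-invariant decomposition $\mathcal{N}|_{\Lambda\setminus\mathrm{Sing}(X)}=\mathcal{N}_1\oplus\mathcal{N}_2$ is a singular dominated splitting (of index $\dim\mathcal{N}_1$) if (i) $\mathcal{N}_1\oplus\mathcal{N}_2$ is dominated for $(\Psi_t)$ (with the metric above); (ii) at each singularity $\sigma\in\Lambda\cap\mathrm{Sing}(X)$, either there is a dominated splitting $T_\sigma M=E^{ss}\oplus F$ for $(D\varphi_t)$ such that $E^{ss}$ is uniformly contracted, $\dim E^{ss}=\dim\mathcal{N}_1$ and $W^{ss}(\sigma)\cap\Lambda=\{\sigma\}$; or there is a dominated splitting $T_\sigma M=E\oplus E^{uu}$ for $(D\varphi_t)$ such that $E^{uu}$ is uniformly expanded, $\dim E^{uu}=\dim\mathcal{N}_2$ and $W^{uu}(\sigma)\cap\Lambda=\{\sigma\}$. Here $W^{ss}(\sigma)$ (resp. $W^{uu}(\sigma)$) is the strong stable (resp. strong unstable) manifold of $\sigma$ tangent to $E^{ss}$ (resp. $E^{uu}$) at $\sigma$. Multi-singular hyperbolic: an invariant compact set $\Lambda$ of $X$ is multi-singular hyperbolic if: (i) $\Lambda$ admits a singular dominated splitting $\mathcal{N}^s\oplus\mathcal{N}^u$; (ii) there exist $\eta,T>0$ and a compact isolating neighborhood $V$ of $\Lambda\cap\mathrm{Sing}(X)$ (i.e. the maximal invariant set in $V$ is $\Lambda\cap\mathrm{Sing}(X)$) such that $\|\Psi_t|_{\mathcal{N}^s(x)}\|<e^{-\eta t}$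 and $\|\Psi_{-t}|_{\mathcal{N}^u(\varphi_t(x))}\|<e^{-\eta t}$ whenever $x,\varphi_t(x)\in\Lambda\setminus V$ and $t>T$; (iii) each singularity $\sigma\in\Lambda\cap\mathrm{Sing}(X)$ admits a dominated splitting $T_\sigma M=E^{ss}\oplus E^c\oplus E^{uu}$ for $(D\varphi_t)$ with $\dim E^{ss}=\dim\mathcal{N}^s$, $\dim E^{uu}=\dim\mathcal{N}^u$ (so $\dim E^c=1$) such that, if $\rho^{ss},\rho^{uu}$ are the spectral radii of $D\varphi_1|_{E^{ss}}$ and $D\varphi_{-1}|_{E^{uu}}$ and $\rho^c$ is the eigenvalue of $D\varphi_1$ along $E^c$, then $\max(\rho^{ss},\rho^{uu})<\min(\rho^c,1/\rho^c)<1$. Extended invariant set $B(X,\Lambda)$: let $\Lambda$ be an invariant compact set whose singularities are all hyperbolic. For $\sigma\in\Lambda\cap\mathrm{Sing}(X)$ consider the finest dominated splitting $T_\sigma M=E^s_k\oplus\dots\oplus E^s_1\oplus E^u_1\oplus\dots\oplus E^u_l$ for $(D\varphi_t)$ (with $E^s_*$ in the stable space and $E^u_*$ in the unstable space, ordered by domination). Let $i$ be the smallest integer such that the strong stable manifold of $\sigma$ tangent to $E^s_k\oplus\dots\oplus E^s_i$ meets $\Lambda$ only at $\sigma$ (the escaping stable space $E^s_k\oplus\dots\oplus E^s_i$ being trivial if there is none, $i=k+1$). Analogously let $j$ be the smallest integer such that the strong unstable manifold of $\sigma$ tangent to $E^u_j\oplus\dots\oplus E^u_l$ meets $\Lambda$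 only at $\sigma$. The center space is $E^c_{\sigma,\Lambda}=E^s_{i-1}\oplus\dots\oplus E^s_1\oplus E^u_1\oplus\dots\oplus E^u_{j-1}$ and $\mathbb{P}^c_{\sigma,\Lambda}\subset\mathcal{G}^1(\sigma)$ is its projective space. Then $$B(X,\Lambda)=\overline{\{\mathbb{R}X(x):x\in\Lambda\setminus\mathrm{Sing}(X)\}}\cup\bigcup_{\sigma\in\mathrm{Sing}(X)\cap\Lambda}\mathbb{P}^c_{\sigma,\Lambda}\subset\mathcal{G}^1.$$ Renormalization cocycles: let $\widetilde M_X=\overline{\{\mathbb{R}X(x):x\in M\setminus\mathrm{Sing}(X)\}}\cup\bigcup_{\sigma\in\mathrm{Sing}(X)}\mathcal{G}^1(\sigma)$. A (real-valued) cocycle over $(\widehat\varphi_t)$ is a continuous function $H:\widetilde M_X\times\mathbb{R}\to(0,+\infty)$, $H(L,t)=h^t(L)$, with $h^{t+s}(L)=h^t(L)\,h^s(\widehat\varphi_t(L))$. A cocycle $(h^t)$ is a renormalization cocycle at a hyperbolic singularity $\sigma$ if: (1) there are a neighborhood $U_\sigma$ of $\sigma$ and $C>1$ such that for any $x\in U_\sigma$, $L\in\mathcal{G}^1(x)\cap\widetilde M_X$ and $t\in\mathbb{R}$ with $\varphi_t(x)\in U_\sigma$, $C^{-1}<h^t(L)/\|D\varphi_t|_L\|<C$; (2) for any small neighborhood $W$ of $\sigma$ there is $C_W>1$ such that for any $x\in M\setminus W$, $L\in\mathcal{G}^1(x)\cap\widetilde M_X$ and $t\in\mathbb{R}$ with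 $\varphi_t(x)\in M\setminus W$, $C_W^{-1}<h^t(L)<C_W$. (At any hyperbolic singularity a renormalization cocycle exists and is unique up to multiplication by a cocycle bounded away from $0$ and $+\infty$.) Multi-singular hyperbolic in the sense of Bonatti–da Luz: an invariant compact set $\Lambda$ of $X$ such that (i) the singularities $\sigma\in\Lambda$ are hyperbolic; fix a renormalization cocycle $(h^t_\sigma)$ at each $\sigma$; (ii) the extended linear Poincaré flow admits a dominated splitting $\mathcal{N}^s\oplus\mathcal{N}^u$ over $B(X,\Lambda)$; (iii) there is a subset $S_+\subset\mathrm{Sing}(X)\cap\Lambda$ such that the cocycle $(h_+^t\cdot\widehat\Psi_t|_{\mathcal{N}^s})$ over $B(X,\Lambda)$ is uniformly contracting, where $h_+^t=\prod_{\sigma\in S_+}h_\sigma^t$; (iv) there is a subset $S_-\subset\mathrm{Sing}(X)\cap\Lambda$ such that the cocycle $(h_-^t\cdot\widehat\Psi_t|_{\mathcal{N}^u})$ over $B(X,\Lambda)$ is uniformly expanding, where $h_-^t=\prod_{\sigma\in S_-}h_\sigma^t$. *)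

(* Defs.v *)
From HB Require Import structures.
From mathcomp Require Import all_boot all_order all_algebra.
From mathcomp Require Import all_classical all_reals all_analysis.

Set Implicit Arguments.
Unset Strict Implicit.
Unset Printing Implicit Defensive.

Import Order.TTheory GRing.Theory Num.Theory.
Import numFieldNormedType.Exports.

Local Open Scope classical_set_scope.
Local Open Scope ring_scope.

(* Meant for open U and finite-dimensional V, where it is the usual notion. *)
Fixpoint Ck (R : realType) (V W : normedModType R) (k : nat) (U : set V)
    (f : V -> W) : Prop :=
  match k with
  | 0 => forall x, U x -> {for x, continuous f}
  | k'.+1 => (forall x, U x -> differentiable f x) /\
             (forall v, Ck k' U (fun x => 'D_v f x))
  end.

(* A smooth structure on M is given by an atlas indexed by the points of M:
   chart p is a chart around p, with open domain cdom p and inverse cinv p.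
   Any atlas contains one of this form, defining the same smooth structure.
   The values of chart p and cinv p outside cdom p and its image are
   irrelevant. *)
Record smooth_atlas (R : realType) (n : nat) (M : topologicalType) := SmoothAtlas {
  chart : M -> M -> 'rV[R]_n;
  cdom : M -> set M;
  cinv : M -> 'rV[R]_n -> M;
  cdom_self : forall p, cdom p p;
  cdom_open : forall p, open (cdom p);
  cimg_open : forall p, open (chart p @` cdom p);
  chartK : forall p x, cdom p x -> cinv p (chart p x) = x;
  chart_continuous : forall p x, cdom p x -> {for x, continuous (chart p)};
  cinv_continuous :
    forall p y, (chart p @` cdom p) y -> {for y, continuous (cinv p)};
  chart_smooth : forall (k : nat) p q,
    Ck k (chart p @` (cdom p `&` cdom q)) (chart q \o cinv p) }.

(* T_x M is identified with R^n through the preferred chart (chart x) at x;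
   thus a vector field is a map M -> 'rV_n. tcoord p x : T_x M -> R^n gives the
   coordinates of tangent vectors in the chart p, and tvect p y is its inverse
   at the point of coordinates y. *)
Section TangentCoordinates.
Context {R : realType} {n : nat} {M : topologicalType}.
Variable A : smooth_atlas R n M.

Definition cimg (p : M) : set 'rV[R]_n := chart A p @` cdom A p.

Definition tcoord (p x : M) : 'rV[R]_n -> 'rV[R]_n :=
  'd (chart A p \o cinv A x) (chart A x x).

Definition tvect (p : M) (y : 'rV[R]_n) : 'rV[R]_n -> 'rV[R]_n :=
  'd (chart A (cinv A p y) \o cinv A p) y.

Definition C1_vector_field (X : M -> 'rV[R]_n) : Prop :=
  forall p, Ck 1 (cimg p) (fun y => tcoord p (cinv A p y) (X (cinv A p y))).

End TangentCoordinates.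

Record riemannian_metric (R : realType) (n : nat) (M : topologicalType)
    (A : smooth_atlas R n M) := RiemannianMetric {
  gram : M -> 'M[R]_n;
  gram_sym : forall x, (gram x)^T = gram x;
  gram_pos : forall x (v : 'rV[R]_n), v != 0 -> 0 < (v *m gram x *m v^T) 0 0;
  gram_smooth : forall (k : nat) p (u v : 'rV[R]_n), Ck k (cimg A p)
    (fun y => (tvect A p y u *m gram (cinv A p y) *m (tvect A p y v)^T) 0 0 : R^o) }.

Section Bundles.
Context {R : realType} {n : nat} {M : topologicalType}.

Definition tbundle (A : smooth_atlas R n M) : Type := (M * 'rV[R]_n)%type.

(* The projective bundle consists of the pairs (x, L) with \dim L = 1 (see G1
   below). *)
Definition pbundle (A : smooth_atlas R n M) : Type :=
  (M * {vspace 'rV[R]_n})%type.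

(* The domains of the trivializations of TM, cut by open conditions on the
   base point and on the coordinates. *)
Definition tbundle_subbase (A : smooth_atlas R n M) : set (set (tbundle A)) :=
  [set B | exists p U (V : set 'rV[R]_n), [/\ open U, open V &
     B = [set z : tbundle A |
            [/\ cdom A p z.1, U z.1 & V (tcoord A p z.1 z.2)]]]].

(* The images under (x, w) |-> (x, <[w]>), w != 0, of the previous sets: on G1
   they induce the quotient topology. *)
Definition pbundle_subbase (A : smooth_atlas R n M) : set (set (pbundle A)) :=
  [set B | exists p U (V : set 'rV[R]_n), [/\ open U, open V &
     B = [set L : pbundle A | [/\ cdom A p L.1, U L.1 &
            exists w : 'rV[R]_n,
              [/\ w \in L.2, w != 0 & V (tcoord A p L.1 w)]]]]].

HB.instance Definition _ A := Choice.on (tbundle A).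
HB.instance Definition _ A := isSubBaseTopological.Build (tbundle A)
  (@tbundle_subbase A) id.
HB.instance Definition _ A := Choice.on (pbundle A).
HB.instance Definition _ A := isSubBaseTopological.Build (pbundle A)
  (@pbundle_subbase A) id.

Definition G1 (A : smooth_atlas R n M) : set (pbundle A) :=
  [set L | \dim L.2 = 1%N].

End Bundles.

Arguments G1 {R n M} A _.

Section Metric.
Context {R : realType} {n : nat} {M : topologicalType} {A : smooth_atlas R n M}.
Variable g : riemannian_metric A.

Definition ip (x : M) (u v : 'rV[R]_n) : R := (u *m gram g x *m v^T) 0 0.

Definition tnorm (x : M) (v : 'rV[R]_n) : R := Num.sqrt (ip x v v).

Definition orth (x : M) (w : 'rV[R]_n) : {vspace 'rV[R]_n} :=
  lker (linfun (fun v => ip x v w : R^o)).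

Definition proj_orth (x : M) (w v : 'rV[R]_n) : 'rV[R]_n :=
  v - (ip x v w / ip x w w) *: w.

End Metric.

(* A flow lf_act on Z together with a family of linear maps covering it, acting
   on a bundle over Z whose fiber lf_fib z is a subspace of T_{lf_pt z} M. *)
Record linear_flow (R : realType) (n : nat) (M Z : topologicalType) := LinearFlow {
  lf_pt : Z -> M;
  lf_fib : Z -> {vspace 'rV[R]_n};
  lf_act : R -> Z -> Z;
  lf_map : R -> Z -> 'rV[R]_n -> 'rV[R]_n }.

Section Splittings.
Context {R : realType} {n : nat} {M Z : topologicalType}.
Context {A : smooth_atlas R n M}.
Variables (g : riemannian_metric A) (F : linear_flow R n M Z) (La : set Z).
Implicit Types E : Z -> {vspace 'rV[R]_n}.

Definition opnorm (t : R) (z : Z) (V : {vspace 'rV[R]_n}) : R :=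
  sup [set tnorm g (lf_pt F (lf_act F t z)) (lf_map F t z v) |
       v in [set v | v \in V /\ tnorm g (lf_pt F z) v <= 1]].

(* Local frames, continuous as maps into TM. *)
Definition subbundle (d : nat) E : Prop :=
  forall z0, La z0 -> exists (O : set Z) (e : 'I_d -> Z -> 'rV[R]_n),
    [/\ open O, O z0,
        forall i, {within La `&` O,
          continuous ((fun z => (lf_pt F z, e i z)) : Z -> tbundle A)} &
        forall z, La z -> O z -> basis_of (E z) [seq e i z | i <- enum 'I_d]].

Definition invariant_bundle E : Prop :=
  forall t z, La z -> (linfun (lf_map F t z) @: E z)%VS = E (lf_act F t z).

Definition bsum (Es : seq (Z -> {vspace 'rV[R]_n})) (z : Z) :
  {vspace 'rV[R]_n} := (\sum_(E <- Es) E z)%VS.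

Definition invariant_splitting (Es : seq (Z -> {vspace 'rV[R]_n})) : Prop :=
  (forall i, (i < size Es)%N -> let E := nth (fun=> 0%VS) Es i in
     (exists d, subbundle d E) /\ invariant_bundle E) /\
  (forall z, La z ->
     bsum Es z = lf_fib F z /\ directv (\sum_(E <- Es) E z)).

Definition dominated_pair E E' : Prop :=
  exists eta T : R, [/\ 0 < eta, 0 < T & forall z t, La z -> T < t ->
    opnorm t z (E z) * opnorm (- t) (lf_act F t z) (E' (lf_act F t z))
      < expR (- eta * t)].

Definition dominated_splitting (Es : seq (Z -> {vspace 'rV[R]_n})) : Prop :=
  invariant_splitting Es /\
  forall k, (0 < k < size Es)%N ->
    dominated_pair (bsum (take k Es)) (bsum (drop k Es)).

Definition unif_contracted E : Prop :=
  exists eta T : R, [/\ 0 < eta, 0 < T & forall z t, La z -> T < t ->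
    opnorm t z (E z) < expR (- eta * t)].

Definition unif_expanded E : Prop :=
  exists eta T : R, [/\ 0 < eta, 0 < T & forall z t, La z -> T < t ->
    opnorm (- t) z (E z) < expR (- eta * t)].

End Splittings.

(* The moduli of the complex eigenvalues a + i b of the complexification of
   f restricted to E, with eigenvectors u + i v; sup set0 = 0 when E = 0. *)
Definition spectral_radius (R : realType) (n : nat) (f : 'rV[R]_n -> 'rV[R]_n)
    (E : {vspace 'rV[R]_n}) : R :=
  sup [set rho | exists a b u v, [/\ u \in E, v \in E, (u != 0) || (v != 0),
    f u = a *: u - b *: v /\ f v = b *: u + a *: v &
    rho = Num.sqrt (a ^+ 2 + b ^+ 2)]].

Section Dynamics.
Context {R : realType} {n : nat} {M : topologicalType}.
Context {A : smooth_atlas R n M}.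
Variables (g : riemannian_metric A) (X : M -> 'rV[R]_n) (phi : R -> M -> M).

(* phi : R x M -> M is a C^1 action of R with infinitesimal generator X; on a
   compact manifold every C^1 vector field has exactly one such flow. *)
Definition is_flow : Prop :=
  [/\ forall x, phi 0 x = x,
      forall s t x, phi (s + t) x = phi s (phi t x),
      continuous (fun tx : R * M => phi tx.1 tx.2),
      forall p q, Ck 1
        [set ty : R^o * 'rV[R]_n | cimg A p ty.2 /\
                                   cdom A q (phi ty.1 (cinv A p ty.2))]
        (fun ty => chart A q (phi ty.1 (cinv A p ty.2))) &
      forall x t, is_derive (t : R^o) 1
        (fun s : R^o => chart A (phi t x) (phi s x)) (X (phi t x))].

Definition Sing : set M := [set x | X x = 0].

Definition invariant_set (La : set M) : Prop :=
  forall t x, La x -> La (phi t x).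

Definition Dphi (t : R) (x : M) : 'rV[R]_n -> 'rV[R]_n :=
  'd (chart A (phi t x) \o phi t \o cinv A x) (chart A x x).

Definition tangent_flow : linear_flow R n M M :=
  LinearFlow id (fun=> fullv) phi Dphi.

Definition Psi (t : R) (x : M) (v : 'rV[R]_n) : 'rV[R]_n :=
  proj_orth g (phi t x) (X (phi t x)) (Dphi t x v).

Definition poincare_flow : linear_flow R n M M :=
  LinearFlow id (fun x => orth g x (X x)) phi Psi.

Definition pphi (t : R) (L : pbundle A) : pbundle A :=
  (phi t L.1, (linfun (Dphi t L.1) @: L.2)%VS).

(* For L in G1, vpick L.2 is a generator of the line L.2, and EPsi does not
   depend on its choice. *)
Definition EPsi (t : R) (L : pbundle A) (v : 'rV[R]_n) : 'rV[R]_n :=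
  proj_orth g (phi t L.1) (Dphi t L.1 (vpick L.2)) (Dphi t L.1 v).

(* The cocycle h^t . EPsi_t. *)
Definition rescaled_poincare_flow (h : R -> pbundle A -> R) :
    linear_flow R n M (pbundle A) :=
  @LinearFlow R n M (pbundle A) (fun L => L.1) (fun L => orth g L.1 (vpick L.2))
    pphi (fun t L v => h t L *: EPsi t L v).

Definition extended_poincare_flow : linear_flow R n M (pbundle A) :=
  @LinearFlow R n M (pbundle A) (fun L => L.1) (fun L => orth g L.1 (vpick L.2))
    pphi EPsi.

(* The stable and unstable manifolds of sigma when sigma is hyperbolic. *)
Definition stable_set (sigma : M) : set M :=
  [set x | phi t x @[t --> +oo] --> sigma].

Definition unstable_set (sigma : M) : set M :=
  [set x | phi t x @[t --> -oo] --> sigma].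

(* D is a C^1 embedded disc through sigma, tangent to E at sigma, positively
   invariant under psi and whose points converge to sigma. *)
Definition local_strong_manifold (psi : R -> M -> M) (sigma : M)
    (E : {vspace 'rV[R]_n}) (D : set M) : Prop :=
  exists i : 'rV[R]_(\dim E) -> M,
    [/\ D = range i /\ i 0 = sigma,
        continuous i /\
          forall p, Ck 1 (i @^-1` cdom A p) (chart A p \o i),
        injective i /\ (forall y B, nbhs y B ->
          exists2 C, nbhs (i y) C & i @^-1` C `<=` B),
        (forall y, injective ('d (chart A (i y) \o i) y)) /\
          limg (linfun ('d (chart A sigma \o i) (0 : 'rV[R]_(\dim E)))) = E &
        forall x, D x -> (forall t, 0 <= t -> D (psi t x)) /\
          psi t x @[t --> +oo] --> sigma].

(* For E contracted by psi and dominated by an invariant complement, all the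
   discs above define the same set, the strong manifold tangent to E. *)
Definition strong_manifold (psi : R -> M -> M) (sigma : M)
    (E : {vspace 'rV[R]_n}) : set M :=
  [set x | exists D t, [/\ local_strong_manifold psi sigma E D, 0 <= t &
                           D (psi t x)]].

Definition Wss := strong_manifold phi.

Definition Wuu := strong_manifold (fun t => phi (- t)).

Definition contracted_at (sigma : M) (E : {vspace 'rV[R]_n}) : Prop :=
  unif_contracted g tangent_flow [set sigma] (fun=> E).

Definition expanded_at (sigma : M) (E : {vspace 'rV[R]_n}) : Prop :=
  unif_expanded g tangent_flow [set sigma] (fun=> E).

Definition dominated_at (sigma : M) (Es : seq {vspace 'rV[R]_n}) : Prop :=
  dominated_splitting g tangent_flow [set sigma] [seq (fun=> E) | E <- Es].

Definition hyperbolic (sigma : M) : Prop :=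
  Sing sigma /\ exists Es Eu : {vspace 'rV[R]_n},
    [/\ invariant_splitting (A := A) tangent_flow [set sigma]
          [:: fun=> Es; fun=> Eu],
        contracted_at sigma Es & expanded_at sigma Eu].

Definition singular_dominated_splitting (La : set M)
    (N1 N2 : M -> {vspace 'rV[R]_n}) (d1 d2 : nat) : Prop :=
  [/\ dominated_splitting g poincare_flow (La `\` Sing) [:: N1; N2],
      forall x, (La `\` Sing) x -> \dim (N1 x) = d1 /\ \dim (N2 x) = d2 &
      forall sigma, (La `&` Sing) sigma ->
        (exists E F, [/\ dominated_at sigma [:: E; F], contracted_at sigma E,
           \dim E = d1 & Wss sigma E `&` La = [set sigma]]) \/
        (exists E F, [/\ dominated_at sigma [:: E; F], expanded_at sigma F,
           \dim F = d2 & Wuu sigma F `&` La = [set sigma]])].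

Definition isolating_neighborhood (V K : set M) : Prop :=
  K `<=` V° /\ [set x | forall t, V (phi t x)] = K.

Definition multi_singular_hyperbolic (La : set M) : Prop :=
  exists (Ns Nu : M -> {vspace 'rV[R]_n}) (ds du : nat),
  [/\ singular_dominated_splitting La Ns Nu ds du,
      exists (eta T : R) (V : set M),
        [/\ 0 < eta, 0 < T, compact V, isolating_neighborhood V (La `&` Sing) &
         forall x t, (La `\` V) x -> (La `\` V) (phi t x) -> T < t ->
           opnorm g poincare_flow t x (Ns x) < expR (- eta * t) /\
           opnorm g poincare_flow (- t) (phi t x) (Nu (phi t x))
             < expR (- eta * t)] &
      forall sigma, (La `&` Sing) sigma ->
        exists Ess Ec Euu : {vspace 'rV[R]_n},
        [/\ dominated_at sigma [:: Ess; Ec; Euu],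
            [/\ \dim Ess = ds, \dim Ec = 1%N & \dim Euu = du] &
            exists rc : R,
            [/\ forall v, v \in Ec -> Dphi 1 sigma v = rc *: v,
                Num.max (spectral_radius (Dphi 1 sigma) Ess)
                        (spectral_radius (Dphi (- 1) sigma) Euu)
                  < Num.min rc rc^-1 &
                Num.min rc rc^-1 < 1]]].

(* Finest: refines every dominated splitting. The bundles are nonzero. *)
Definition finest_dominated_at (sigma : M) (Es : seq {vspace 'rV[R]_n}) : Prop :=
  [/\ dominated_at sigma Es, 0%VS \notin Es &
      forall Fs, dominated_at sigma Fs ->
        forall E, E \in Es -> exists2 F, F \in Fs & (E <= F)%VS].

Definition vsum (Es : seq {vspace 'rV[R]_n}) : {vspace 'rV[R]_n} :=
  (\sum_(E <- Es) E)%VS.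

(* In the finest dominated splitting ss ++ cs ++ cu ++ uu (from the most
   contracted to the most expanded bundle), ss ++ cs are the stable bundles and
   cu ++ uu the unstable ones; ss (resp. uu) spans the escaping stable (resp.
   unstable) space, i.e. is the longest family at that end whose strong
   manifold meets La only at sigma. *)
Definition center_space (La : set M) (sigma : M) (C : {vspace 'rV[R]_n}) : Prop :=
  exists ss cs cu uu : seq {vspace 'rV[R]_n},
  [/\ [/\ finest_dominated_at sigma (ss ++ cs ++ cu ++ uu),
          contracted_at sigma (vsum (ss ++ cs)) &
          expanded_at sigma (vsum (cu ++ uu))],
      Wss sigma (vsum ss) `&` La = [set sigma] /\
        (forall k, (size ss < k <= size (ss ++ cs))%N ->
           Wss sigma (vsum (take k (ss ++ cs))) `&` La <> [set sigma]),
      Wuu sigma (vsum uu) `&` La = [set sigma] /\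
        (forall k, (k < size cu)%N ->
           Wuu sigma (vsum (drop k (cu ++ uu))) `&` La <> [set sigma]) &
      C = vsum (cs ++ cu)].

Definition regular_lines (La : set M) : set (pbundle A) :=
  [set L | exists2 x, (La `\` Sing) x & L = (x, <[X x]>%VS)].

Definition extended_invariant_set (La : set M) : set (pbundle A) :=
  (closure (regular_lines La) `&` G1 A) `|`
  [set L | [/\ G1 A L, (La `&` Sing) L.1 &
     exists2 C, center_space La L.1 C & (L.2 <= C)%VS]].

Definition extended_total_space : set (pbundle A) :=
  (closure (regular_lines setT) `&` G1 A) `|`
  [set L | G1 A L /\ Sing L.1].

Definition cocycle (h : R -> pbundle A -> R) : Prop :=
  [/\ {within [set Lt : pbundle A * R | extended_total_space Lt.1],
        continuous (fun Lt => h Lt.2 Lt.1)},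
      forall t L, extended_total_space L -> 0 < h t L &
      forall t s L, extended_total_space L -> h (t + s) L = h t L * h s (pphi t L)].

Definition renormalization_cocycle (sigma : M) (h : R -> pbundle A -> R) : Prop :=
  [/\ cocycle h,
      exists U C, [/\ nbhs sigma U, 1 < C & forall L t,
        extended_total_space L -> U L.1 -> U (phi t L.1) ->
        C^-1 < h t L / opnorm g tangent_flow t L.1 L.2 < C] &
      forall W, nbhs sigma W -> exists2 C, 1 < C & forall L t,
        extended_total_space L -> ~ W L.1 -> ~ W (phi t L.1) ->
        C^-1 < h t L < C].

(* S is meant finite (an infinite product would be 1), which is automatic for
   a set of hyperbolic singularities of a compact set. *)
Definition prod_cocycle (h : M -> R -> pbundle A -> R) (S : set M)
    (t : R) (L : pbundle A) : R :=
  \big[*%R/1]_(sigma \in S) h sigma t L.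

Definition bonatti_da_luz (La : set M) : Prop :=
  (forall sigma, (La `&` Sing) sigma -> hyperbolic sigma) /\
  exists h : M -> R -> pbundle A -> R,
  (forall sigma, (La `&` Sing) sigma -> renormalization_cocycle sigma (h sigma)) /\
  exists Ns Nu : pbundle A -> {vspace 'rV[R]_n},
  [/\ exists ds du, forall L, extended_invariant_set La L ->
        \dim (Ns L) = ds /\ \dim (Nu L) = du,
      dominated_splitting g extended_poincare_flow (extended_invariant_set La)
        [:: Ns; Nu],
      exists2 S, S `<=` La `&` Sing &
        unif_contracted g (rescaled_poincare_flow (prod_cocycle h S))
          (extended_invariant_set La) Ns &
      exists2 S, S `<=` La `&` Sing &
        unif_expanded g (rescaled_poincare_flow (prod_cocycle h S))
          (extended_invariant_set La) Nu].

End Dynamics.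

(* Main.v *)
(* Let u span a line of the center space of a singularity sigma. Then T_sigma M
   is the direct sum of this line, N^s and N^u, and the bounds on the rescaled
   flow become rates in the quotient by the line of u. The assumption on W^s
   and W^u forces the stable and unstable parts Cs and Cu of the center space
   to be nonzero: a strong stable disc tangent to the whole stable space Es
   absorbs every orbit of La converging to sigma. Comparing the splittings
   along w in Cu and along v + w, v in Cs, yields, up to reversing time, that
   dim Es = dim N^s + 1 and that Cs is a line; the rescaled rates then bound
   the spectral radii on the escaping stable space and on the unstable space
   by the eigenvalue along Cs. At regular points, x |-> R X(x) pulls the
   dominated splitting back to the linear Poincare flow. Far from the finitely
   many singularities, the renormalization cocycles are bounded away from 0,
   hence do not affect the exponential rates. *)

Require Import Defs.
From HB Require Import structures.
From mathcomp Require Import all_boot all_order all_algebra finmap.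
From mathcomp Require Import all_classical all_reals all_analysis.
From mathcomp Require Import ring lra zify.

Set Implicit Arguments.
Unset Strict Implicit.
Unset Printing Implicit Defensive.

Import Order.TTheory GRing.Theory Num.Theory.
Import numFieldNormedType.Exports.

Local Open Scope classical_set_scope.
Local Open Scope ring_scope.

(** * Linear dynamics *)

(** At a singularity the hypotheses give, for each line of the center space, a splitting of the
    quotient by that line only, and these quotients have no common norm. Growth is therefore
    measured by the distance [q u x] from [x] to the line of [u], compared up to [o] and [O]
    ([negl], [bigo]), and vectors shared by two splittings are found by counting dimensions. The
    dichotomy rests on [dim N^s <= dim Es] and [dim N^u <= dim Eu], valid whether or not the
    singularity enters the rescaling, while the whole space has dimension [dim N^s + dim N^u + 1].
    The rate comes from a vector of [Es] congruent modulo [w] to a vector of [N^u]: backward in time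
    it grows at least like the eigenvector [z] of [Cs], so the rescaled bound on [N^u] yields
    [|A_(-t) w| |A_(-t) z| = O(e^(- eta t))]. The lines of the center space enter through
    [center_space], an existential statement, so the finest dominated splitting and its escaping
    ends have to be exhibited. *)

Section LinearMaps.
Context {K : fieldType} {V W : vectType K} (f : 'Hom(V, W)).
Implicit Types (x y : V) (c : K).

Lemma homD x y : f (x + y) = f x + f y. Proof. exact: linearD. Qed.
Lemma homB x y : f (x - y) = f x - f y. Proof. exact: linearB. Qed.
Lemma homZ c x : f (c *: x) = c *: f x. Proof. exact: linearZ. Qed.

End LinearMaps.

(** * Comparison of growth rates at infinity *)

Section Asymptotics.
Context {R : realType}.
Implicit Types a b c : R -> R.

(* a = o(b) and a = O(b) at +oo, for nonnegative a and b. *)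
Definition negl a b : Prop :=
  forall e, 0 < e -> exists T, forall t, T < t -> a t <= e * b t.

Definition bigo a b : Prop :=
  exists K T, 0 < K /\ forall t, T < t -> a t <= K * b t.

Lemma negl_bigo a b c : (forall t, 0 <= b t) -> negl a b -> bigo b c -> negl a c.
Proof.
move=> b0 ab [K [T [K0 bc]]] e e0.
have [T' h] := ab (e / K) (divr_gt0 e0 K0).
exists (Num.max T T') => t; rewrite gt_max => /andP[tT tT'].
apply: (le_trans (h t tT')).
have -> : e * c t = e / K * (K * c t) by field; rewrite gt_eqF.
by rewrite ler_pM2l ?divr_gt0//; apply: bc.
Qed.

Lemma bigo_negl a b c : bigo a b -> negl b c -> negl a c.
Proof.
move=> [K [T [K0 ab]]] bc e e0.
have [T' h] := bc (e / K) (divr_gt0 e0 K0).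
exists (Num.max T T') => t; rewrite gt_max => /andP[tT tT'].
apply: (le_trans (ab t tT)).
have -> : e * c t = K * (e / K * c t) by field; rewrite gt_eqF.
by rewrite ler_pM2l//; apply: h.
Qed.

Lemma bigo_trans a b c : bigo a b -> bigo b c -> bigo a c.
Proof.
move=> [K [T [K0 ab]]] [K' [T' [K'0 bc]]].
exists (K * K'), (Num.max T T'); split; first exact: mulr_gt0.
move=> t; rewrite gt_max => /andP[tT tT'].
by apply: (le_trans (ab t tT)); rewrite -mulrA ler_pM2l//; apply: bc.
Qed.

Lemma negl_sub a b : negl a b -> bigo a b.
Proof. by move=> ab; have [T h] := ab 1 ltr01; exists 1, T; split. Qed.

Lemma bigo_le a b K : 0 < K -> (forall t, a t <= K * b t) -> bigo a b.
Proof. by move=> K0 h; exists K, 0; split. Qed.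

Lemma bigoD a b c d : (forall t, a t <= b t + c t) -> bigo b d -> bigo c d ->
  bigo a d.
Proof.
move=> h [K [T [K0 ab]]] [K' [T' [K'0 bc]]].
exists (K + K'), (Num.max T T'); split; first exact: addr_gt0.
move=> t; rewrite gt_max => /andP[tT tT'].
by apply: (le_trans (h t)); rewrite mulrDl lerD ?ab ?bc.
Qed.

Lemma neglD a b c d : (forall t, a t <= b t + c t) -> negl b d -> negl c d ->
  negl a d.
Proof.
move=> h ab bc e e0; have e2 : 0 < e / 2 by rewrite divr_gt0.
have [T h1] := ab _ e2; have [T' h2] := bc _ e2.
exists (Num.max T T'); move=> t; rewrite gt_max => /andP[tT tT'].
apply: (le_trans (h t)).
have -> : e * d t = e / 2 * d t + e / 2 * d t by field.
by rewrite lerD ?h1 ?h2.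
Qed.

Lemma negl_absurd a b : (forall t, 0 < b t) -> negl a b -> bigo b a -> False.
Proof.
move=> b0 ab ba.
have /(_ (1/2)) := bigo_negl ba ab.
have -> // : (0 : R) < 1/2 by lra.
case=> // T /(_ (T + 1)); rewrite ltrDl ltr01 => /(_ isT).
by have := b0 (T + 1); lra.
Qed.

(** The choice [1/2] in [negl a c] lets half of [c] be absorbed on the left. This is how the
    dominated component of a vector is discarded. *)
Lemma negl_dominates a b c : (forall t, c t <= a t + b t) -> negl a c ->
  bigo c b.
Proof.
move=> h ac; have [|T h1] := ac (1/2); first by lra.
exists 2, T; split=> // t tT; have := h t; have := h1 t tT; lra.
Qed.

Lemma expR_negl (eta : R) : 0 < eta -> negl (fun t => expR (- eta * t)) (fun=> 1).
Proof.
move=> eta0 e e0; exists (e^-1 / eta) => t tT; rewrite mulr1 mulNr expRN.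
have t0 : 0 < t by apply: lt_trans tT; rewrite divr_gt0 ?invr_gt0.
rewrite -[leRHS]invrK lef_pV2 ?posrE ?expR_gt0 ?invr_gt0//.
apply: (@le_trans _ _ (1 + eta * t)); last exact: expR_ge1Dx.
rewrite ltr_pdivrMr// mulrC in tT.
by apply: ltW; apply: (lt_le_trans tT); lra.
Qed.

End Asymptotics.

(** * Norms, distances to a line and dominated cuts for linear flows *)

Definition complementary (K : fieldType) (V : vectType K) (E F : {vspace V}) : Prop :=
  (E + F)%VS = fullv /\ (E :&: F)%VS = 0%VS.

Section LinearDynamics.
Context {R : realType} {V : vectType R}.
Implicit Types (N : V -> R) (q : V -> V -> R) (A : R -> 'End(V))
  (E F P Q : {vspace V}) (x y u v w : V).

(** Boundedness of endomorphisms, automatic in finite dimension, is carried as a field;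
    [tnorm_bounded] supplies it for Riemannian norms. *)
Record is_norm N : Prop := IsNorm {
  N_eq0 : forall x, N x = 0 -> x = 0;
  ND : forall x y, N (x + y) <= N x + N y;
  NZ : forall c x, N (c *: x) = `|c| * N x;
  N_bounded : forall f : 'End(V), exists2 K, 0 < K & forall x, N (f x) <= K * N x }.

(** This is the quotient norm modulo the line of [u], with its minimum attained. The instance used
    is the norm of the orthogonal projection, see [line_distP]. *)
Definition is_line_dist N q : Prop := forall u x,
  (forall c, q u x <= N (x - c *: u)) /\ exists c, q u x = N (x - c *: u).

Definition is_group A : Prop :=
  (forall x, A 0 x = x) /\ (forall s t x, A (s + t) x = A s (A t x)).

Definition reversed A : R -> 'End(V) := fun t => A (- t).

Definition stable_by A E : Prop := forall t x, x \in E -> A t x \in E.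

(** For invariant [F], substituting [A (- t) b] for [b] recovers the bound on the product of the
    norms of [A t] on [E] and of [A (- t)] on [F]. *)
Definition dominates N A E F : Prop :=
  exists eta T, [/\ 0 < eta, 0 < T & forall t a b, T < t -> a \in E -> b \in F ->
    N (A t a) * N b <= expR (- eta * t) * (N a * N (A t b))].

Definition dominated_cut N A E F : Prop :=
  [/\ stable_by A E, stable_by A F, complementary E F & dominates N A E F].

Definition contracts N A E : Prop :=
  exists eta T, [/\ 0 < eta, 0 < T & forall t x, T < t -> x \in E ->
    N (A t x) <= expR (- eta * t) * N x].

End LinearDynamics.

Section NormTheory.
Context {R : realType} {V : vectType R} (N : V -> R) (hN : is_norm N).
Implicit Types (x y u v w : V).

Lemma N_0 : N 0 = 0.
Proof. by rewrite -(scale0r 0) (NZ hN) normr0 mul0r. Qed.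

Lemma N_opp x : N (- x) = N x.
Proof. by rewrite -scaleN1r (NZ hN) normrN normr1 mul1r. Qed.

Lemma N_ge0 x : 0 <= N x.
Proof. by have := ND hN x (- x); rewrite subrr N_0 N_opp; lra. Qed.

Lemma N_gt0 x : x != 0 -> 0 < N x.
Proof.
move=> x0; rewrite lt_neqAle N_ge0 andbT eq_sym.
by apply: contra x0 => /eqP/(N_eq0 hN)->.
Qed.

Lemma NB x y : N (x - y) <= N x + N y.
Proof. by rewrite -(N_opp y); apply: ND. Qed.

Lemma N_dist x y : N x <= N y + N (x - y).
Proof. by rewrite -[in leLHS](subrKC y x); apply: ND. Qed.

Section LineDistance.
Variables (q : V -> V -> R) (hq : is_line_dist N q).

Lemma q_le u x c : q u x <= N (x - c *: u).
Proof. by have [] := hq u x. Qed.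

Lemma q_ex u x : exists c, q u x = N (x - c *: u).
Proof. by have [] := hq u x. Qed.

Lemma q_leN u x : q u x <= N x.
Proof. by have := q_le u x 0; rewrite scale0r subr0. Qed.

Lemma q_ge0 u x : 0 <= q u x.
Proof. by have [c ->] := q_ex u x; exact: N_ge0. Qed.

Lemma q_linear_le (f : V -> V) K u u' x : {morph f : x y / x - y} ->
  (forall c x, f (c *: x) = c *: f x) -> f u = u' ->
  (forall x, N (f x) <= K * N x) -> q u' (f x) <= K * q u x.
Proof.
move=> fB fZ fu fN; have [c ->] := q_ex u x.
by apply: (le_trans (q_le _ _ c)); rewrite -fu -fZ -fB.
Qed.

Lemma q_addline u x c : q u (x + c *: u) = q u x.
Proof.
apply/eqP; rewrite eq_le; apply/andP; split.
  by have [d ->] := q_ex u x; have := q_le u (x + c *: u) (d + c);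
    rewrite scalerDl opprD addrACA subrr addr0.
have [d ->] := q_ex u (x + c *: u); have := q_le u x (d - c).
by rewrite scalerBl opprB addrA.
Qed.

Lemma qD u x y : q u (x + y) <= q u x + q u y.
Proof.
have [c ->] := q_ex u x; have [d ->] := q_ex u y.
apply: (le_trans (q_le _ _ (c + d))).
by rewrite scalerDl opprD addrACA; apply: ND.
Qed.

Lemma qZ_le u x c : q u (c *: x) <= `|c| * q u x.
Proof.
have [d ->] := q_ex u x; apply: (le_trans (q_le _ _ (c * d))).
by rewrite -scalerA -scalerBr (NZ hN).
Qed.

Lemma qB u x y : q u (x - y) <= q u x + q u y.
Proof.
apply: (le_trans (qD _ _ _)); rewrite lerD2l -scaleN1r.
by apply: (le_trans (qZ_le _ _ _)); rewrite normrN normr1 mul1r.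
Qed.

Lemma q_eq0 u x : q u x = 0 -> x \in <[u]>%VS.
Proof.
have [c ->] := q_ex u x => /(N_eq0 hN)/eqP; rewrite subr_eq0 => /eqP->.
by rewrite memvZ// memv_line.
Qed.

End LineDistance.
End NormTheory.

Section GroupTheory.
Context {R : realType} {V : vectType R} (A : R -> 'End(V)) (hA : is_group A).
Implicit Types (x y u v w : V) (E F P Q : {vspace V}).

Lemma A0 x : A 0 x = x. Proof. by case: hA. Qed.
Lemma AD s t x : A (s + t) x = A s (A t x). Proof. by case: hA. Qed.
Lemma AK t x : A (- t) (A t x) = x. Proof. by rewrite -AD addNr A0. Qed.
Lemma AKV t x : A t (A (- t) x) = x. Proof. by rewrite -AD subrr A0. Qed.

Lemma A_eq0 t x : A t x = 0 -> x = 0.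
Proof. by move=> h; rewrite -(AK t x) h linear0. Qed.

Lemma A_neq0 t x : x != 0 -> A t x != 0.
Proof. by apply: contra => /eqP/A_eq0->. Qed.

Lemma A_line t u x : A t x \in <[A t u]>%VS -> x \in <[u]>%VS.
Proof.
move=> /vlineP[c h]; apply/vlineP; exists c.
by rewrite -(AK t x) h linearZ /= AK.
Qed.

Lemma reversed_group : is_group (reversed A).
Proof.
split=> [x|s t x]; first by rewrite /reversed oppr0 A0.
by rewrite /reversed opprD AD.
Qed.

Lemma reversed_invariant E : stable_by A E -> stable_by (reversed A) E.
Proof. by move=> h t x; apply: h. Qed.

Lemma reversedK : reversed (reversed A) = A.
Proof. by apply/funext => t; rewrite /reversed opprK. Qed.

Lemma reversed_dominates N E F : is_norm N -> stable_by A E -> stable_by A F ->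
  dominates N A E F -> dominates N (reversed A) F E.
Proof.
move=> hN iE iF [eta [T [eta0 T0 h]]]; exists eta, T; split=> // t a b tT aF bE.
have := h t (A (- t) b) (A (- t) a) tT (iE _ _ bE) (iF _ _ aF).
by rewrite !AKV /reversed mulrC (mulrC (N a)).
Qed.

Lemma reversed_cut N E F : is_norm N ->
  dominated_cut N A E F -> dominated_cut N (reversed A) F E.
Proof.
move=> hN [iE iF [EF EF0] d]; split; [exact: reversed_invariant..| |].
  by split; [rewrite addvC|rewrite capvC].
exact: reversed_dominates.
Qed.

End GroupTheory.

Section Subspaces.
Context {K : fieldType} {V : vectType K}.
Implicit Types (E F P Q : {vspace V}) (x y u v w : V).

Lemma dim_cap_notin P Q E : (\dim {:V} + \dim E < \dim P + \dim Q)%N ->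
  exists x, [/\ x \in P, x \in Q & x \notin E].
Proof.
move=> h; have := dimv_sum_cap P Q; have := dimvS (subvf (P + Q)%VS) => h1 h2.
have : ~~ (P :&: Q <= E)%VS by apply/negP => /dimvS; lia.
move/subvPn => [x]; rewrite memv_cap => /andP[xP xQ] xE.
by exists x.
Qed.

Lemma dim_cap_neq0 P Q : (\dim {:V} < \dim P + \dim Q)%N ->
  exists x, [/\ x \in P, x \in Q & x != 0].
Proof.
move=> h; have [|x [xP xQ x0]] := @dim_cap_notin P Q 0; first by rewrite dimv0 addn0.
by exists x; split=> //; apply: contra x0 => /eqP->; rewrite mem0v.
Qed.

Lemma dim_addv_line P x : x \notin P -> \dim (P + <[x]>)%VS = (\dim P).+1.
Proof.
move=> xP; rewrite dimv_disjoint_sum ?dim_vline; last first.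
  apply/eqP; rewrite -subv0; apply/subvP => y; rewrite memv_cap memv0.
  move=> /andP[yP /vlineP[c yE]]; move: yP; rewrite {y}yE.
  have [->|c0] := eqVneq c 0; first by rewrite scale0r.
  by rewrite rpredZeq (negPf c0) /= (negPf xP).
by case: eqP xP => [->|_ _]; rewrite ?mem0v //= addn1.
Qed.

Lemma dim_complementary E F : complementary E F ->
  (\dim E + \dim F = \dim {:V})%N.
Proof. by move=> [EF EF0]; rewrite -dimv_sum_cap EF EF0 dimv0 addn0. Qed.

Lemma complementaryP E F x : complementary E F ->
  exists y z, [/\ y \in E, z \in F & x = y + z].
Proof.
move=> [EF _]; have : x \in (E + F)%VS by rewrite EF memvf.
by move=> /memv_addP[y yE [z zF ->]]; exists y, z.
Qed.

Lemma complementaryC E F : complementary E F -> complementary F E.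
Proof. by move=> [EF EF0]; split; rewrite ?(addvC F) ?(capvC F). Qed.

Lemma complementary_eq0 E F x : complementary E F -> x \in E -> x \in F -> x = 0.
Proof.
move=> [_ EF0] xE xF; apply/eqP; rewrite -memv0 -EF0 memv_cap xE xF //.
Qed.

Lemma complementary_proj E F : complementary E F ->
  exists f : 'End(V), {in E, forall x, f x = x} /\ {in F, forall x, f x = 0}.
Proof.
move=> [EF EF0]; exists (daddv_pi E F); split=> x xE; first exact: daddv_pi_id.
have := daddv_pi_add (V := F) EF0; rewrite EF => /(_ x (memvf _)).
rewrite [daddv_pi F E x]daddv_pi_id ?(capvC F)// => /eqP.
by rewrite -subr_eq0 addrK => /eqP.
Qed.

End Subspaces.

Section Domination.
Context {R : realType} {V : vectType R} (N : V -> R) (hN : is_norm N).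
Implicit Types (A : R -> 'End(V)) (E F P Q : {vspace V}) (x y u v w : V).

Lemma dominates_negl A E F a b : dominates N A E F -> a \in E -> b \in F ->
  b != 0 -> negl (fun t => N (A t a)) (fun t => N (A t b)).
Proof.
move=> [eta [T [eta0 T0 h]]] aE bF b0 e e0.
have Nb := N_gt0 hN b0; have Na := N_ge0 hN a.
have Na1 : 0 < N a + 1 by lra.
have [T' h'] := expR_negl eta0 (divr_gt0 (mulr_gt0 e0 Nb) Na1).
exists (Num.max T T') => t; rewrite gt_max => /andP[tT tT'].
have := h _ _ _ tT aE bF; have := h' _ tT'; rewrite mulr1.
rewrite ler_pdivlMr// => h1 h2; rewrite -(ler_pM2r Nb); apply: (le_trans h2).
rewrite mulrA [leRHS]mulrAC ler_wpM2r ?N_ge0//; apply: le_trans h1.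
by rewrite ler_wpM2l ?expR_ge0//; lra.
Qed.

Lemma contracts_negl A E x : contracts N A E -> x \in E ->
  negl (fun t => N (A t x)) (fun=> 1).
Proof.
move=> [eta [T [eta0 T0 h]]] xE.
apply: bigo_negl (expR_negl eta0); exists (N x + 1), T; split.
  by have := N_ge0 hN x; lra.
move=> t tT; apply: (le_trans (h _ _ tT xE)); rewrite mulrC.
by rewrite ler_wpM2r ?expR_ge0//; lra.
Qed.

Lemma expands_bigo A E x : is_group A -> stable_by A E ->
  contracts N (reversed A) E -> x \in E -> x != 0 ->
  bigo (fun=> 1) (fun t => N (A t x)).
Proof.
move=> hA iE [eta [T [eta0 T0 h]]] xE x0; exists (N x)^-1, T.
rewrite invr_gt0 N_gt0//; split=> // t tT.
have := h _ _ tT (iE t _ xE); rewrite /reversed (AK hA) => h1.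
rewrite mulrC ler_pdivlMr ?N_gt0// mul1r; apply: (le_trans h1).
rewrite ler_piMl ?N_ge0//; rewrite -[leRHS]expR0 ler_expR mulNr oppr_le0.
by rewrite mulr_ge0// ltW// (lt_trans T0).
Qed.

Section Nested.
Variables (A : R -> 'End(V)) (hA : is_group A).

(** Suppose [a] lies in [E] but not in [P]. By dimension [P + <[a]>] contains a nonzero [x] of [F].
    The [Q] component of [a] is nonzero and dominates [P], so every vector of [P + <[a]>] is [O] of
    [a]; but [a = o(x)], since [F] dominates [E]. *)
Lemma cut_nested1 E F P Q : dominated_cut N A E F -> dominated_cut N A P Q ->
  (\dim E <= \dim P)%N -> (E <= P)%VS.
Proof.
move=> [iE iF EF dEF] [iP iQ PQ dPQ] dim; apply/subvP => a aE.
apply/negPn/negP => aP.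
have [x [xPa xF x0]] : exists x, [/\ x \in (P + <[a]>)%VS, x \in F & x != 0].
  apply: dim_cap_neq0; rewrite dim_addv_line// -(dim_complementary EF); lia.
have [y [z [yP zQ aE']]] := complementaryP a PQ.
have z0 : z != 0 by apply: contra aP => /eqP z0; rewrite aE' z0 addr0.
have [p pP [_ /vlineP[c ->] xE]] := memv_addP xPa.
apply: (@negl_absurd _ (fun t => N (A t a)) (fun t => N (A t x))).
- by move=> t /=; apply: (N_gt0 hN); apply: A_neq0.
- exact: dominates_negl dEF aE xF x0.
have za : bigo (fun t => N (A t z)) (fun t => N (A t a)).
  apply: (@negl_dominates _ (fun t => N (A t y)) _ (fun t => N (A t z))).
    move=> t; have -> : z = a - y by rewrite aE' addrAC subrr add0r.
    by rewrite linearB [leRHS]addrC; exact: NB.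
  exact: dominates_negl dPQ yP zQ z0.
apply: (@bigoD _ _ (fun t => N (A t p)) (fun t => N (A t (c *: a)))).
- by move=> t; rewrite xE linearD; apply: (ND hN).
- apply: bigo_trans za; apply: negl_sub.
  exact: dominates_negl dPQ pP zQ z0.
- apply: (@bigo_le _ _ _ (`|c| + 1)); first by have := normr_ge0 c; lra.
  move=> t; rewrite linearZ /= (NZ hN) ler_wpM2r ?(N_ge0 hN)//; lra.
Qed.

End Nested.

Lemma cut_nested A E F P Q : is_group A ->
  dominated_cut N A E F -> dominated_cut N A P Q ->
  (\dim E <= \dim P)%N -> (E <= P)%VS /\ (Q <= F)%VS.
Proof.
move=> hA c1 c2 d; split; first exact: cut_nested1 c1 c2 d.
(* The second inclusion is the first one for the reversed flow, which exchanges the two sides of a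
   cut. *)
apply: (cut_nested1 (reversed_group hA) (reversed_cut hA hN c2)
  (reversed_cut hA hN c1)).
case: c1 c2 => [_ _ /dim_complementary h1 _] [_ _ /dim_complementary h2 _]; lia.
Qed.

End Domination.

(** * Splittings of the quotient by a moving line *)

Section LineSplittings.
Context {R : realType} {V : vectType R} (N : V -> R) (hN : is_norm N).
Variables (q : V -> V -> R) (hq : is_line_dist N q).
Implicit Types (A : R -> 'End(V)) (E F P Q S U W : {vspace V}) (x y u v w : V).

(* S + U models a dominated splitting of the quotient by the line of u, along
   the orbit of this line. *)
Record line_splitting A u S U : Prop := LineSplitting {
  ls_full : (<[u]> + S + U)%VS = fullv;
  ls_dim : (1 + \dim S + \dim U = \dim {:V})%N;
  ls_fwd : forall a b, a \in S -> b \in U -> b != 0 ->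
    negl (fun t => q (A t u) (A t a)) (fun t => q (A t u) (A t b));
  ls_bwd : forall a b, a \in S -> b \in U -> a != 0 ->
    negl (fun t => q (A (- t) u) (A (- t) b)) (fun t => q (A (- t) u) (A (- t) a)) }.

Lemma reversed_line_splitting A u S U :
  line_splitting A u S U -> line_splitting (reversed A) u U S.
Proof.
move=> [full dim fwd bwd]; split.
- by rewrite -addvA (addvC U) addvA.
- lia.
- by move=> a b aU bS b0; apply: bwd.
- move=> a b aU bS b0 e e0; have [T h] := fwd _ _ bS aU b0 e e0.
  by exists T => t; rewrite /reversed opprK; apply: h.
Qed.

Section SplittingTheory.
Variables (A : R -> 'End(V)) (u : V) (S U : {vspace V}).
Hypotheses (u0 : u != 0) (ls : line_splitting A u S U).

Let dimline : \dim <[u]>%VS = 1%N.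
Proof. by rewrite dim_vline u0. Qed.

Lemma ls_dims : \dim (S + <[u]>)%VS = (\dim S).+1 /\
  \dim (U + <[u]>)%VS = (\dim U).+1.
Proof.
have := ls_full ls; have := ls_dim ls => d f.
have h1 : \dim (<[u]> + S + U)%VS = \dim {:V} by rewrite f.
have h2 := dimv_add_leqif (<[u]> + S)%VS U.
have h3 := dimv_add_leqif <[u]>%VS S.
have h4 := dimv_add_leqif (<[u]> + U)%VS S.
have h5 := dimv_add_leqif <[u]>%VS U.
have h6 : (<[u]> + U + S = <[u]> + S + U)%VS by rewrite -addvA (addvC U) addvA.
case: h2 => h2 _; case: h3 => h3 _; case: h4 => h4 _; case: h5 => h5 _.
move: h4; rewrite h6 (addvC S) (addvC U) => h4.
by split; lia.
Qed.

Lemma ls_cap_line x : x \in U -> x \in <[u]>%VS -> x = 0.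
Proof.
move=> xS xu; have [_ h] := ls_dims.
have := dimv_sum_cap U <[u]>%VS; rewrite h dimline => e.
have /eqP : \dim (U :&: <[u]>)%VS = 0%N by lia.
rewrite dimv_eq0 => /eqP c0; apply/eqP; rewrite -memv0 -c0 memv_cap xS xu //.
Qed.

Lemma ls_cap x : x \in S -> x \in (U + <[u]>)%VS -> x = 0.
Proof.
move=> xS xU; have [_ h] := ls_dims.
have := dimv_sum_cap S (U + <[u]>)%VS.
have -> : (S + (U + <[u]>) = fullv)%VS.
  by rewrite -(ls_full ls) addvA addvC addvA.
rewrite h -(ls_dim ls) => e.
have /eqP : \dim (S :&: (U + <[u]>))%VS = 0%N by lia.
rewrite dimv_eq0 => /eqP c0; apply/eqP; rewrite -memv0 -c0 memv_cap xS xU //.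
Qed.

Lemma ls_decomp x : exists a b c, [/\ a \in S, b \in U & x = a + b + c *: u].
Proof.
have : x \in (<[u]> + S + U)%VS by rewrite (ls_full ls) memvf.
move=> /memv_addP[y /memv_addP[_ /vlineP[c ->] [a aS ->]] [b bU ->]].
by exists a, b, c; split=> //; rewrite -addrA addrC.
Qed.

End SplittingTheory.

(** [A (- t)] contracts [E], so pulling back the point of the line of [A t w] closest to [A t e]
    gives a point of the line of [w] even closer to [e]. The distance from [e] to that line is thus
    arbitrarily small. *)
Lemma expanding_line A E e w : is_group A -> stable_by A E ->
  contracts N (reversed A) E -> e \in E -> w \in E ->
  negl (fun t => q (A t w) (A t e)) (fun=> 1) -> e \in <[w]>%VS.
Proof.
move=> hA iE [eta [T [eta0 T0 h]]] eE wE qt.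
apply: (q_eq0 hN hq); apply/eqP; rewrite eq_le (q_ge0 hN hq) andbT.
apply/ler_addgt0Pl => d d0; rewrite addr0.
have [T' h'] := qt _ d0; pose t := Num.max T T' + 1.
have /andP[tT tT'] : (T < t) && (T' < t) by rewrite -gt_max ltrDl ltr01.
have := h' t tT'; rewrite mulr1; have [c ->] := q_ex hq (A t w) (A t e) => hc.
apply: le_trans hc; apply: (le_trans (q_le hq w e c)).
have -> : A t e - c *: A t w = A t (e - c *: w) by rewrite -linearZ -linearB.
rewrite -[X in N X <= _](AK hA t); apply: (le_trans (h _ _ tT _)).
  by apply: iE; rewrite rpredB// rpredZ.
rewrite ler_piMl ?(N_ge0 hN)// -[leRHS]expR0 ler_expR mulNr oppr_le0.
by rewrite mulr_ge0// ltW// (lt_trans T0).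
Qed.

Section Hyperbolic.
Variables (A : R -> 'End(V)) (hA : is_group A) (Es Eu : {vspace V}).
Hypotheses (iEs : stable_by A Es) (iEu : stable_by A Eu).
Hypotheses (EE : complementary Es Eu).

Lemma proj_line_dist : exists2 K, 0 < K & forall w x xs xu t, w \in Eu ->
  xs \in Es -> xu \in Eu -> x = xs + xu ->
  forall vs, vs \in Es -> q (A t w) (A t xu) <= K * q (A t (vs + w)) (A t x).
Proof.
have [f [f1 f0]] := complementary_proj (complementaryC EE).
have [K K0 h] := N_bounded hN f; exists K => // w x xs xu t wE xsE xuE -> vs vsE.
have -> : A t xu = f (A t (xs + xu)).
  by rewrite !linearD /= f0 ?iEs// f1 ?iEu// add0r.
apply: (q_linear_le hq) => //.
- by move=> y z; rewrite linearB.
- by move=> c y; rewrite linearZ.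
- by rewrite !linearD /= f0 ?iEs// f1 ?iEu// add0r.
Qed.

(** The projection onto [Es] along [Eu] kills the line of [w], so a stable vector cannot be
    shortened much by subtracting multiples of [w]. *)
Lemma proj_norm_s : exists2 K, 0 < K & forall w x t, w \in Eu ->
  x \in Es -> N (A t x) <= K * q (A t w) (A t x).
Proof.
have [f [f1 f0]] := complementary_proj EE.
have [K K0 h] := N_bounded hN f; exists K => // w x t wE xE.
have [c ->] := q_ex hq (A t w) (A t x); have := h (A t x - c *: A t w).
by rewrite linearB linearZ /= f1 ?iEs// f0 ?iEu// scaler0 subr0.
Qed.

(** The unstable component of a vector of [W] decays modulo [w] too, and the expansion on [Eu] then
    forces it onto the line of [w]. *)
Lemma contracted_mod_line w W : contracts N (reversed A) Eu -> w \in Eu ->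
  (forall a, a \in W -> negl (fun t => q (A t w) (A t a)) (fun=> 1)) ->
  (W <= Es + <[w]>)%VS.
Proof.
move=> cEu wE hW; apply/subvP => a aW.
have [K K0 h] := proj_line_dist.
have [s [u [sE uE aE]]] := complementaryP a EE.
have uw : u \in <[w]>%VS.
  apply: (expanding_line hA iEu cEu uE wE).
  apply: bigo_negl (hW _ aW); apply: (bigo_le K0) => t.
  by have := h w a s u t wE sE uE aE 0 (mem0v _); rewrite add0r.
by rewrite aE memv_add.
Qed.

End Hyperbolic.
End LineSplittings.

(** * The stable part of the center space is at most a line *)

Section CenterDimension.
Context {R : realType} {V : vectType R} (N : V -> R) (hN : is_norm N).
Variables (q : V -> V -> R) (hq : is_line_dist N q).
Implicit Types (E F P Q S U W : {vspace V}) (x y u v w : V).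
Variables (A : R -> 'End(V)) (hA : is_group A) (Es Eu : {vspace V}).
Hypotheses (iEs : stable_by A Es) (iEu : stable_by A Eu).
Hypotheses (EE : complementary Es Eu).
Hypotheses (cEs : contracts N A Es) (cEu : contracts N (reversed A) Eu).

(* Otherwise N(A t v) bounds the distance from A t x to the line of A t u on
   Su + <v> + <u>, which meets Uw + <w> outside <w>: this contradicts the
   domination along w, where v has a component in Sw. *)
Lemma slow_component w v Sw Uw Su Uu : w \in Eu -> w != 0 ->
  v \in Es -> v != 0 -> line_splitting q A w Sw Uw ->
  line_splitting q A (v + w) Su Uu -> \dim Su = \dim Sw ->
  v \in (Sw + <[w]>)%VS -> v \in (Su + <[v + w]>)%VS.
Proof.
move=> wE w0 vE v0 lsw; move uE: (v + w) => u lsu dimS vSw.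
have u0 : u != 0.
  apply: contra v0 => /eqP u0; apply/eqP/(complementary_eq0 EE vE).
  by rewrite -[v](addrK w) uE u0 sub0r rpredN.
apply/negPn/negP => vSu.
have [a0 [b0 [d0 [a0S b0U vabd]]]] := ls_decomp lsu v.
have b00 : b0 != 0.
  apply: contra vSu => /eqP b00; rewrite vabd b00 addr0.
  by rewrite memv_add// memvZ// memv_line.
(* The component [b0] of [v] in [Uu] is nonzero and dominates [Su], so modulo [u] nothing in [Su +
   <[v]>] outgrows [v]. *)
have b0v : bigo (fun t => q (A t u) (A t b0)) (fun t => q (A t u) (A t v)).
  apply: (@negl_dominates _ (fun t => q (A t u) (A t a0)) _
    (fun t => q (A t u) (A t b0))); last exact: (ls_fwd lsu).
  move=> t; have -> : A t b0 = A t v - A t a0 - d0 *: A t u.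
    by rewrite {1}vabd !homD homZ addrAC addrK addrAC subrr add0r.
  rewrite -scaleNr (q_addline hq) [leRHS]addrC; exact: (qB hN hq).
have Qv x : x \in (Su + <[v]> + <[u]>)%VS ->
    bigo (fun t => q (A t u) (A t x)) (fun t => N (A t v)).
  move=> /memv_addP[_ /memv_addP[a aS [_ /vlineP[c ->] ->]] [_ /vlineP[d ->] ->]].
  apply: (@bigo_trans _ _ (fun t => q (A t u) (A t v))); last first.
    by apply: (@bigo_le _ _ _ 1) => // t; rewrite mul1r; exact: q_leN.
  apply: (@bigoD _ _ (fun t => q (A t u) (A t a))
    (fun t => q (A t u) (A t (c *: v)))).
  - move=> t; rewrite !homD [A t (d *: u)]homZ (q_addline hq).
    exact: (qD hN hq).
  - by apply: bigo_trans b0v; apply: negl_sub; apply: (ls_fwd lsu).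
  - apply: (@bigo_le _ _ _ (`|c| + 1)); first by have := normr_ge0 c; lra.
    move=> t; rewrite homZ; apply: (le_trans (qZ_le hN hq _ _ _)).
    by rewrite ler_wpM2r ?(q_ge0 hN hq)//; lra.
(* The two dimensions add up to [dim V + 2], so the intersection is not contained in a line. *)
have [x [xQ xU xw]] : exists x, [/\ x \in (Su + <[v]> + <[u]>)%VS,
    x \in (Uw + <[w]>)%VS & x \notin <[w]>%VS].
  apply: dim_cap_notin.
  rewrite -addvA (addvC <[v]>%VS) addvA dim_addv_line// (ls_dims u0 lsu).1 (ls_dims w0 lsw).2 dimS.
  by rewrite dim_vline w0 -(ls_dim lsw); clear; lia.
have [Ku Ku0 hKu] := proj_line_dist hN hq iEs iEu EE.
have [Ks Ks0 hKs] := proj_norm_s hN hq iEs iEu EE.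
have [s [z [sE zE xE]]] := complementaryP x EE.
have /vlineP[c0 zw] : z \in <[w]>%VS.
  apply: (expanding_line hN hq hA iEu cEu zE wE).
  apply: (bigo_negl _ (contracts_negl hN cEs vE)).
  apply: bigo_trans (Qv _ xQ); apply: (bigo_le Ku0) => t.
  by rewrite -uE; apply: hKu zE xE _ vE.
have [K [T [K0 hT]]] := Qv _ xQ.
have [f [f1 f0]] := complementary_proj (complementaryC EE).
have [Kf Kf0 hf] := N_bounded hN f.
(* [c t *: A t u] is a point of the line closest to [A t x]. Its coefficient has to be bounded
   before [A t u] can be replaced by [A t w]. *)
have [c hc] : exists c : R -> R, forall t,
    q (A t u) (A t x) = N (A t x - c t *: A t u).
  by have [c hc] := choice (fun t => q_ex hq (A t u) (A t x)); exists c.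
have hcb : exists T', forall t, T' < t -> `|c t| <= `|c0| + 1.
  have [K' [T2 [K'0 h2]]] := expands_bigo hN hA iEu cEu wE w0.
  (* The projection onto [Eu] sends [A t x - c t *: A t u] to [(c0 - c t) *: A t w]. As [A t w]
     stays bounded below, this threshold on [N (A t v)] makes [|c0 - c t| <= 1] eventually. *)
  have [|T1 h1] := contracts_negl hN cEs vE (e := (Kf * K * K')^-1).
    by rewrite invr_gt0 !mulr_gt0.
  exists (Num.max T (Num.max T1 T2)) => t; rewrite !gt_max => /and3P[tT tT1 tT2].
  have : `|c0 - c t| * N (A t w) <= Kf * (K * N (A t v)).
    have e : f (A t x - c t *: A t u) = (c0 - c t) *: A t w.
      rewrite homB {1}xE -uE zw !homZ !homD !homZ.
      by rewrite (f0 _ (iEs _ sE)) (f0 _ (iEs _ vE)) (f1 _ (iEu _ wE)) !add0r -scalerBl.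
    have := hf (A t x - c t *: A t u); rewrite e (NZ hN) => /le_trans; apply.
    by rewrite ler_pM2l// -hc; apply: hT.
  have := h1 t tT1; rewrite mulr1 -div1r ler_pdivlMr ?mulr_gt0// => hv hcw.
  have h3 : Kf * (K * N (A t v)) * K' <= 1.
    by apply: le_trans hv; rewrite le_eqVlt; apply/orP; left; apply/eqP; ring.
  have h4 : `|c0 - c t| <= 1.
    apply: le_trans h3; rewrite -[leLHS]mulr1.
    apply: (@le_trans _ _ (`|c0 - c t| * (K' * N (A t w)))).
      by rewrite ler_wpM2l// h2.
    by rewrite mulrCA mulrC ler_pM2r.
  have := ler_normD (c t - c0) c0; rewrite subrK; rewrite distrC in h4; lra.
have [T' hT'] := hcb.
(* Passing from the line of [A t u] to that of [A t w] costs only the bounded multiple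
   [c t *: A t v]. *)
have xv : bigo (fun t => q (A t w) (A t x)) (fun t => N (A t v)).
  exists (K + (`|c0| + 1)), (Num.max T T'); split.
    by have := normr_ge0 c0; lra.
  move=> t; rewrite gt_max => /andP[tT tT'].
  apply: (le_trans (q_le hq _ _ (c t))).
  have -> : A t x - c t *: A t w = (A t x - c t *: A t u) + c t *: A t v.
    by rewrite -uE homD scalerDr opprD addrA [RHS]addrAC subrK.
  apply: (le_trans (ND hN _ _)); rewrite -hc (NZ hN) mulrDl lerD ?hT//.
  by rewrite ler_wpM2r ?(N_ge0 hN)// hT'.
have [a2 a2S [_ /vlineP[c2 ->] va2]] := memv_addP vSw.
have [b bU [_ /vlineP[cb ->] xb]] := memv_addP xU.
have b0' : b != 0.
  by apply: contra xw => /eqP b0'; rewrite xb b0' add0r memvZ// memv_line.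
(* Modulo [w], [x] is [b] and [v] is [a2]. Since [N (A t v)] is controlled by the distance from
   [A t v] to the line of [A t w], [b = O(a2)], whereas [Uw] dominates [Sw]. *)
apply: (@negl_absurd _ (fun t => q (A t w) (A t a2)) (fun t => q (A t w) (A t b))).
- move=> t; rewrite lt_neqAle (q_ge0 hN hq) andbT eq_sym.
  apply: contra b0' => /eqP/(q_eq0 hN hq)/(A_line hA) bw; apply/eqP.
  exact: ls_cap_line w0 lsw _ bU bw.
- exact: (ls_fwd lsw).
have -> : (fun t => q (A t w) (A t b)) = (fun t => q (A t w) (A t x)).
  by apply/funext => t; rewrite xb homD homZ (q_addline hq).
apply: (bigo_trans xv); apply: (bigo_le Ks0) => t.
apply: (le_trans (hKs w v t wE vE)).
by rewrite {1}va2 homD homZ (q_addline hq).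
Qed.

(* If dim Cs > 1, some v in Cs lies in Sw + <w>. Along u = v + w, slow_component
   shows that w is in Su + <u>; so the domination makes Uu + <w> + <u>
   decay in backward time modulo u. But it meets Es outside <v>, while Es
   expands in backward time. *)
Lemma dim_center_le1 w Sw Uw Cs : w \in Eu -> w != 0 ->
  line_splitting q A w Sw Uw -> \dim Es = (\dim Sw).+1 ->
  (forall a, a \in Sw -> negl (fun t => q (A t w) (A t a)) (fun=> 1)) ->
  (Cs <= Es)%VS ->
  (forall v, v \in Cs -> exists Su Uu, line_splitting q A (v + w) Su Uu /\
     \dim Su = \dim Sw) ->
  (\dim Cs <= 1)%N.
Proof.
move=> wE w0 lsw dimEs cSw CsEs hls; rewrite leqNgt; apply/negP => dimCs.
have SwE := contracted_mod_line hN hq hA iEs iEu EE cEu wE cSw.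
have wEs : w \notin Es.
  by apply: contra w0 => wEs; rewrite (complementary_eq0 EE wEs wE).
(* [E] has codimension at most one in [Es], hence meets any subspace [Cs] of dimension at least
   two. *)
pose E := ((Sw + <[w]>) :&: Es)%VS.
have dimE : (\dim Sw <= \dim E)%N.
  have := dimv_sum_cap (Sw + <[w]>)%VS Es.
  have : (\dim (Sw + <[w]> + Es)%VS <= \dim (Es + <[w]>)%VS)%N.
    by apply: dimvS; rewrite !subv_add SwE addvSr addvSl.
  rewrite (ls_dims w0 lsw).1 (dim_addv_line wEs) /E; lia.
have [v [vE vCs v0]] : exists v, [/\ v \in E, v \in Cs & v != 0].
  have : (0 < \dim (E :&: Cs)%VS)%N.
    have := dimv_sum_cap E Cs.
    have : (\dim (E + Cs)%VS <= \dim Es)%N.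
      by apply: dimvS; rewrite subv_add CsEs capvSr.
    lia.
  rewrite lt0n dimv_eq0 => nz; exists (vpick (E :&: Cs)%VS).
  by have := memv_pick (E :&: Cs)%VS; rewrite memv_cap vpick0 nz => /andP[-> ->].
have vEs : v \in Es by apply: (subvP CsEs).
have vSw : v \in (Sw + <[w]>)%VS by move: vE; rewrite /E memv_cap => /andP[].
have [Su [Uu [lsu dimSu]]] := hls v vCs.
have := slow_component wE w0 vEs v0 lsw lsu dimSu vSw => vSu.
move: lsu vSu; move uE: (v + w) => u lsu vSu.
have u0 : u != 0.
  apply: contra v0 => /eqP u0; apply/eqP/(complementary_eq0 EE vEs).
  by rewrite -[v](addrK w) uE u0 sub0r rpredN.
have /memv_addP[a aS [_ /vlineP[c ->] wac]] : w \in (Su + <[u]>)%VS.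
  have -> : w = - v + u by rewrite -uE addKr.
  by rewrite rpredD ?rpredN// memvE addvSr.
(* Otherwise [w] would be a multiple of [v + w], impossible for nonzero [v] and [w] in complementary
   spaces. *)
have a0 : a != 0.
  apply/eqP => a0; move: wac; rewrite a0 add0r -uE scalerDr => wac.
  have e : (1 - c) *: w = c *: v by rewrite scalerBl scale1r {1}wac addrK.
  have cv0 : c *: v = 0.
    by apply: (complementary_eq0 EE (memvZ c vEs)); rewrite -e memvZ.
  move: (cv0) => /eqP; rewrite scaler_eq0 (negPf v0) orbF => /eqP c0.
  by move: e => /eqP; rewrite cv0 c0 subr0 scale1r (negPf w0).
(* Backward in time [w] tends to [0], and it agrees with [a] modulo [u]; since [a] is nonzero in
   [Su], it dominates [Uu] in backward time. *)
have Qdec x : x \in (Uu + <[u]> + <[w]>)%VS ->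
    negl (fun t => q (A (- t) u) (A (- t) x)) (fun=> 1).
  have wdec : negl (fun t => q (A (- t) u) (A (- t) w)) (fun=> 1).
    apply: bigo_negl (contracts_negl hN cEu wE).
    by apply: (@bigo_le _ _ _ 1) => // t; rewrite mul1r; apply: q_leN.
  move=> /memv_addP[_ /memv_addP[b bU [_ /vlineP[d ->] ->]] [_ /vlineP[e ->] ->]].
  apply: (@neglD _ _ (fun t => q (A (- t) u) (A (- t) b))
    (fun t => q (A (- t) u) (A (- t) (e *: w)))).
  - move=> t; rewrite addrAC homD [A (- t) (d *: u)]homZ (q_addline hq).
    rewrite homD; exact: (qD hN hq).
  - apply: (negl_bigo (fun t => q_ge0 hN hq _ _) (ls_bwd lsu aS bU a0)).
    apply: negl_sub; congr (negl _ _): wdec; apply/funext => t.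
    by rewrite wac homD homZ (q_addline hq).
  - apply: bigo_negl wdec; apply: (@bigo_le _ _ _ (`|e| + 1)).
      by have := normr_ge0 e; lra.
    move=> t; rewrite homZ; apply: (le_trans (qZ_le hN hq _ _ _)).
    by rewrite ler_wpM2r ?(q_ge0 hN hq)//; lra.
(* As [dim Es = dim Su + 1], the dimensions again add up to [dim V + 2]. *)
have [x [xQ xEs xv]] : exists x, [/\ x \in (Uu + <[u]> + <[w]>)%VS,
    x \in Es & x \notin <[v]>%VS].
  apply: dim_cap_notin; rewrite dim_addv_line ?(ls_dims u0 lsu).2; last first.
    apply: contra a0 => wU; apply/eqP; apply: (ls_cap u0 lsu aS).
    have -> : a = w - c *: u by rewrite {1}wac addrK.
    by rewrite rpredB// memvZ// memvE addvSr.
  by rewrite dim_vline v0 dimEs -(ls_dim lsu) dimSu; clear; lia.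
move/negP: xv; apply.
apply: (expanding_line hN hq (reversed_group hA) (reversed_invariant iEs) _ xEs vEs).
  by rewrite reversedK.
have [K K0 hK] := proj_line_dist hN hq iEu iEs (complementaryC EE).
apply: bigo_negl (Qdec x xQ); apply: (bigo_le K0) => t.
by rewrite -uE (addrC v); apply: (hK v x 0 x (- t)) => //; rewrite ?mem0v ?add0r.
Qed.

End CenterDimension.

(** * Growth rates compared with the center eigenvalue *)

Section Rates.
Context {R : realType} {V : vectType R} (N : V -> R) (hN : is_norm N).
Variables (q : V -> V -> R) (hq : is_line_dist N q).
Implicit Types (E F P Q S U W SS UU Cu : {vspace V}) (x y u v w : V).
Variables (A : R -> 'End(V)) (hA : is_group A) (Es Eu : {vspace V}).
Hypotheses (iEs : stable_by A Es) (iEu : stable_by A Eu).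
Hypotheses (EE : complementary Es Eu).
Hypotheses (cEs : contracts N A Es) (cEu : contracts N (reversed A) Eu).

Lemma dim_contracted_le w Sw Uw : w \in Eu -> w != 0 ->
  line_splitting q A w Sw Uw ->
  (forall a, a \in Sw -> negl (fun t => q (A t w) (A t a)) (fun=> 1)) ->
  (\dim Sw <= \dim Es)%N.
Proof.
move=> wE w0 ls cSw.
have := contracted_mod_line hN hq hA iEs iEu EE cEu wE cSw => SwE.
have wEs : w \notin Es.
  by apply: contra w0 => wEs; rewrite (complementary_eq0 EE wEs wE).
have : (\dim (Sw + <[w]>)%VS <= \dim (Es + <[w]>)%VS)%N.
  by apply: dimvS; rewrite subv_add SwE addvSr.
by rewrite (ls_dims w0 ls).1 (dim_addv_line wEs) ltnS.
Qed.

(** In backward time [SS] dominates the line of [z], so [z] is the slowest direction of [Es]: a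
    nonzero [SS] component only speeds up the growth. *)
Lemma bigo_slowest SS z v : (forall x, x \in Es -> exists s c, s \in SS /\ x = s + c *: z) ->
  dominates N (reversed A) <[z]>%VS SS -> v \in Es -> v != 0 ->
  bigo (fun t => N (A (- t) z)) (fun t => N (A (- t) v)).
Proof.
move=> dec dom vE v0; have [s [c [sS vE']]] := dec v vE.
have [s0|s0] := eqVneq s 0.
  have c0 : c != 0.
    by apply: contra v0 => /eqP c0; rewrite vE' s0 c0 scale0r addr0.
  apply: (@bigo_le _ _ _ `|c|^-1); first by rewrite invr_gt0 normr_gt0.
  move=> t; rewrite vE' s0 add0r homZ (NZ hN) mulrA mulVf ?mul1r//.
  by rewrite normr_eq0.
have zs := dominates_negl hN dom (memv_line z) sS s0.
apply: (bigo_trans (negl_sub zs)).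
apply: (@negl_dominates _ (fun t => `|c| * N (A (- t) z)) _
  (fun t => N (reversed A t s))).
  move=> t; rewrite -(NZ hN) -homZ.
  have -> : reversed A t s = A (- t) v - A (- t) (c *: z).
    by rewrite -homB vE' addrK.
  by rewrite [leRHS]addrC; apply: (NB hN).
apply: bigo_negl zs; apply: (@bigo_le _ _ _ (`|c| + 1)).
  by have := normr_ge0 c; lra.
by move=> t; rewrite ler_wpM2r ?(N_ge0 hN)//; lra.
Qed.

Section CenterLine.
Variables (w : V) (Sw Uw : {vspace V}).
Hypotheses (wE : w \in Eu) (w0 : w != 0) (ls : line_splitting q A w Sw Uw).
Hypothesis dimEs : \dim Es = (\dim Sw).+1.

(** [Uw + <[w]>] and [Es] have dimensions adding up to [dim V + 1], which gives a nonzero stable [v]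
    congruent modulo [w] to some [b] of [Uw]. *)
Let common : exists v b, [/\ v \in Es, v != 0, b \in Uw &
  bigo (fun t => N (A (- t) v)) (fun t => q (A (- t) w) (A (- t) b))].
Proof.
have [v [vU vE v0]] : exists v, [/\ v \in (Uw + <[w]>)%VS, v \in Es & v != 0].
  by apply: dim_cap_neq0; rewrite (ls_dims w0 ls).2 dimEs; have := ls_dim ls; lia.
have [b bU [_ /vlineP[c ->] vb]] := memv_addP vU.
exists v, b; split=> //; have [K K0 h] := proj_norm_s hN hq iEs iEu EE.
apply: (bigo_le K0) => t; apply: le_trans (h w v (- t) wE vE) _.
by rewrite vb homD homZ (q_addline hq).
Qed.

(** Otherwise the vector [v] of [common] would tend to [0] in backward time, although it lies in
    [Es]. So when [dim Es = dim Sw + 1] the bound on [Uw] has to be a truly rescaled one. *)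
Lemma unrescaled_not_expanded :
  ~ (forall b, b \in Uw -> negl (fun t => q (A (- t) w) (A (- t) b)) (fun=> 1)).
Proof.
have [v [b [vE v0 bU vb]]] := common => /(_ b bU) /(bigo_negl vb) v1.
have := expands_bigo hN (reversed_group hA) (reversed_invariant iEs) _ vE v0.
rewrite reversedK => /(_ cEs); apply: negl_absurd v1 => t.
exact: ltr01.
Qed.

(** By [common] and [bigo_slowest], [A (- t) z] is [O] of the distance from [A (- t) b] to the line
    of [A (- t) w]; multiplying by [N (A (- t) w)] brings in the rescaled quantity. *)
Lemma rescaled_rate SS z (r : R -> R) : z != 0 ->
  (forall x, x \in Es -> exists s c, s \in SS /\ x = s + c *: z) ->
  dominates N (reversed A) <[z]>%VS SS ->
  (forall b, b \in Uw ->
     bigo (fun t => N (A (- t) w) * q (A (- t) w) (A (- t) b)) r) ->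
  bigo (fun t => N (A (- t) w)) (fun t => r t / N (A (- t) z)).
Proof.
move=> z0 dec dom hr; have [v [b [vE v0 bU [K1 [T1 [K10 h1]]]]]] := common.
have [K2 [T2 [K20 h2]]] := bigo_slowest dec dom vE v0.
have [K3 [T3 [K30 h3]]] := hr b bU.
exists (K2 * (K1 * K3)), (Num.max T1 (Num.max T2 T3)).
split; first by rewrite !mulr_gt0.
move=> t; rewrite !gt_max => /and3P[t1 t2 t3].
rewrite [leRHS]mulrA ler_pdivlMr ?(N_gt0 hN) ?A_neq0//.
apply: (@le_trans _ _ (N (A (- t) w) * (K2 * (K1 * q (A (- t) w) (A (- t) b))))).
  rewrite ler_wpM2l ?(N_ge0 hN)//; apply: (le_trans (h2 t t2)).
  by rewrite ler_pM2l//; apply: h1.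
have -> : N (A (- t) w) * (K2 * (K1 * q (A (- t) w) (A (- t) b))) =
  K2 * K1 * (N (A (- t) w) * q (A (- t) w) (A (- t) b)) by ring.
have -> : K2 * (K1 * K3) * r t = K2 * K1 * (K3 * r t) by ring.
by rewrite ler_pM2l ?mulr_gt0//; apply: h3.
Qed.

End CenterLine.

Lemma bigo_dominated_sum Cu UU w e (f : R -> R) : Eu = (Cu + UU)%VS ->
  dominates N (reversed A) UU Cu -> w \in Cu -> w != 0 ->
  (forall c, c \in Cu -> c != 0 -> bigo (fun t => N (A (- t) c)) f) ->
  e \in Eu -> bigo (fun t => N (A (- t) e)) f.
Proof.
move=> -> dom wC w0 h /memv_addP[c cC [d dU ->]].
have wf := h w wC w0.
have df : bigo (fun t => N (A (- t) d)) f.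
  by apply: bigo_trans wf; apply: negl_sub; exact: (dominates_negl hN dom).
have [->|c0] := eqVneq c 0; first by rewrite add0r.
apply: (bigoD _ (h c cC c0) df) => t.
by rewrite homD; apply: (ND hN).
Qed.

End Rates.

(** * Spectral radius from growth along orbits *)

Section SpectralRadius.
Context {R : realType} {n : nat}.
Variables (N : 'rV[R]_n -> R) (hN : is_norm N).

Lemma expr_bounded_le1 (r C : R) (k0 : nat) : 0 <= r ->
  (forall k, (k0 <= k)%N -> r ^+ k <= C) -> r <= 1.
Proof.
move=> r0 h; rewrite leNgt; apply/negP => r1.
have C1 : 0 <= C by apply: le_trans (h k0 (leqnn _)); apply: exprn_ge0.
have d0 : 0 < r - 1 by rewrite subr_gt0.
have [m hm] : exists m : nat, C / (r - 1) < m%:R.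
  by exists (Num.bound (C / (r - 1))); apply: archi_boundP;
    rewrite divr_ge0// ltW.
have Bern k : 1 + (r - 1) * k%:R <= r ^+ k.
  elim: k => [|k IH]; first by rewrite mulr0 addr0 expr0.
  rewrite exprS -natr1; have := ler_wpM2l r0 IH; move=> h1.
  have := mulr_ge0 (mulr_ge0 (ltW d0) (ltW d0)) (ler0n R k); nra.
have := Bern (k0 + m)%N; have := h (k0 + m)%N (leq_addr _ _).
rewrite ltr_pdivrMr// in hm; rewrite natrD.
have : 0 <= (r - 1) * k0%:R by rewrite mulr_ge0// ltW.
nra.
Qed.

(** Multiplying the [k]-th power of the eigenvalue [a + i b] by its conjugate writes [rho^(2k) u]
    and [rho^(2k) v] as combinations of [f^k u] and [f^k v] with coefficients at most [rho^k]. Hence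
    [(rho / kap)^k] is bounded and [rho <= kap]. The constants may depend on the vector. *)
Lemma spectral_radius_le (f : 'End('rV[R]_n)) (g : 'rV[R]_n -> 'rV[R]_n)
    (E : {vspace 'rV[R]_n}) (kap : R) :
  (forall x, g x = f x) -> 0 < kap ->
  (forall x, x \in E -> exists C k0, forall k, (k0 <= k)%N ->
     N (iter k f x) <= C * kap ^+ k) ->
  spectral_radius g E <= kap.
Proof.
move=> gf kap0 h; rewrite /spectral_radius.
have [[rho0 hrho0]|no] := pselect (exists rho, [set rho | exists a b u v,
    [/\ u \in E, v \in E, (u != 0) || (v != 0),
    g u = a *: u - b *: v /\ g v = b *: u + a *: v &
    rho = Num.sqrt (a ^+ 2 + b ^+ 2)]] rho); last first.
  (* Without eigenvectors the radius is the supremum of the empty set, that is [0]. *)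
  rewrite (_ : mkset _ = set0) ?sup0 ?(ltW kap0)//.
  by apply/seteqP; split=> // rho hr; apply: no; exists rho.
apply: ge_sup; first by exists rho0.
move=> _ [a [b [u [v [uE vE uv [gu gv] ->]]]]].
rewrite !gf in gu gv; set rho := Num.sqrt _.
have rho2 : rho ^+ 2 = a ^+ 2 + b ^+ 2 by rewrite sqr_sqrtr ?addr_ge0 ?sqr_ge0.
have rho_ge0 : 0 <= rho := sqrtr_ge0 _.
(* Real and imaginary parts of [(a + i b)^k]. *)
pose it := fix it k : R * R := if k is k'.+1 then
  let: (c, d) := it k' in (a * c - b * d, a * d + b * c) else (1, 0).
have itn k : (it k).1 ^+ 2 + (it k).2 ^+ 2 = (rho ^+ k) ^+ 2.
  elim: k => [|k IH]; first by rewrite /= expr0 expr1n expr0n addr0.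
  rewrite (exprS rho) exprMn -IH rho2 /=; case: (it k) => c d /=; ring.
have itu k : iter k f u = (it k).1 *: u - (it k).2 *: v /\
             iter k f v = (it k).2 *: u + (it k).1 *: v.
  elim: k => [|k [IHu IHv]]; first by rewrite /= !scale1r !scale0r subr0 add0r.
  rewrite !iterS IHu IHv /=; case: (it k) => c d /=.
  rewrite homB homD !homZ gu gv; split; apply/rowP => i; rewrite !mxE; ring.
have leit k : `|(it k).1| <= rho ^+ k /\ `|(it k).2| <= rho ^+ k.
  have rk : 0 <= rho ^+ k by apply: exprn_ge0.
  have := itn k; set c := (it k).1; set d := (it k).2 => e.
  have := sqr_ge0 c; have := sqr_ge0 d => h1 h2.
  by split; rewrite -(@ler_pXn2r _ 2)// ?nnegrE// real_normK ?num_real// -e; lra.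
have [Cu [ku hu]] := h u uE; have [Cv [kv hv]] := h v vE.
have bound x : x != 0 -> (forall k, exists c d, [/\ `|c| <= rho ^+ k,
     `|d| <= rho ^+ k & (rho ^+ k) ^+ 2 *: x = c *: iter k f u + d *: iter k f v]) ->
   rho <= kap.
  move=> x0 hx; rewrite -[leRHS]mul1r -ler_pdivrMr//.
  have Nx := N_gt0 hN x0.
  have [->|rhon0] := eqVneq rho 0; first by rewrite mul0r.
  have rhogt0 : 0 < rho by rewrite lt_neqAle eq_sym rhon0.
  apply: (@expr_bounded_le1 _ ((Cu + Cv) / N x) (maxn ku kv)).
    by rewrite divr_ge0// ltW.
  move=> k; rewrite geq_max => /andP[k1 k2].
  have [c [d [hc hd e]]] := hx k.
  have rk : 0 < rho ^+ k by apply: exprn_gt0.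
  have : (rho ^+ k) ^+ 2 * N x <= rho ^+ k * ((Cu + Cv) * kap ^+ k).
    rewrite -[X in X * N x <= _]ger0_norm ?exprn_ge0 ?(ltW rk)// -(NZ hN) e.
    apply: (le_trans (ND hN _ _)); rewrite !(NZ hN) mulrDl mulrDr lerD//.
      by rewrite ler_pM// ?(N_ge0 hN)//; apply: hu.
    by rewrite ler_pM// ?(N_ge0 hN)//; apply: hv.
  rewrite expr2 -mulrA ler_pM2l// => h1.
  by rewrite expr_div_n ler_pdivrMr ?exprn_gt0// mulrAC ler_pdivlMr.
case/orP: uv => nz; apply: (bound _ nz) => k; have [iu iv] := itu k;
  have [l1 l2] := leit k; have := itn k.
  exists (it k).1, (it k).2; split=> //; rewrite iu iv -itn.
  by apply/rowP => i; rewrite !mxE; ring.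
exists (- (it k).2), (it k).1; split; rewrite ?normrN// iu iv -itn.
by apply/rowP => i; rewrite !mxE; ring.
Qed.

End SpectralRadius.

Section SumsOfSubspaces.
Context {R : realType} {n : nat}.
Implicit Types (Es : seq {vspace 'rV[R]_n}).

Lemma vsum_nil : vsum [::] = 0%VS :> {vspace 'rV[R]_n}.
Proof. by rewrite /vsum big_nil. Qed.

Lemma vsum_cons E Es : vsum (E :: Es) = (E + vsum Es)%VS.
Proof. by rewrite /vsum big_cons. Qed.

Lemma vsum_cat Es Es' : vsum (Es ++ Es') = (vsum Es + vsum Es')%VS.
Proof. by rewrite /vsum big_cat. Qed.

Lemma vsum_sup E Es : E \in Es -> (E <= vsum Es)%VS.
Proof.
elim: Es => //= F Es IH; rewrite inE vsum_cons => /orP[/eqP->|/IH h].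
  exact: addvSl.
exact: subv_trans h (addvSr _ _).
Qed.

Lemma dim_vsum_le Es : (\dim (vsum Es) <= \sum_(E <- Es) \dim E)%N.
Proof.
elim: Es => [|E Es IH]; first by rewrite vsum_nil dimv0.
rewrite vsum_cons big_cons; have [h _] := dimv_add_leqif E (vsum Es).
by apply: (leq_trans h); rewrite leq_add2l.
Qed.

End SumsOfSubspaces.

(** * Dominated cuts and the finest dominated splitting *)

Section Finest.
Context {R : realType} {n : nat}.
Local Notation V := 'rV[R]_n.
Variables (N : V -> R) (hN : is_norm N) (A : R -> 'End(V)) (hA : is_group A).
Implicit Types (E F P Q : {vspace V}) (Es Fs : seq {vspace V}).

(** The vector form of [dominated_at], see [dominated_atP]; directness is encoded by the dimensions
    adding up to [n]. *)
Definition dominated_list Es : Prop :=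
  [/\ forall E, E \in Es -> stable_by A E,
      vsum Es = fullv, (\sum_(E <- Es) \dim E = n)%N &
      forall k, (0 < k < size Es)%N ->
        dominates N A (vsum (take k Es)) (vsum (drop k Es))].

Lemma invariant_vsum Es : (forall E, E \in Es -> stable_by A E) ->
  stable_by A (vsum Es).
Proof.
elim: Es => [_ t x|E Es IH h t x].
  by rewrite vsum_nil !memv0 => /eqP->; rewrite linear0.
rewrite vsum_cons => /memv_addP[y yE [z zE ->]]; rewrite homD memv_add//.
  by apply: h => //; rewrite inE eqxx.
by apply: IH => // F FE; apply: h; rewrite inE FE orbT.
Qed.

Lemma dimV : \dim {:V} = n. Proof. by rewrite dimvf /dim /= mul1n. Qed.

Lemma dominates_0l F : dominates N A 0%VS F.
Proof.
exists 1, 1; split=> // t a b _; rewrite memv0 => /eqP-> _.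
by rewrite linear0 (N_0 hN) !mul0r mulr0.
Qed.

Lemma dominates_0r E : dominates N A E 0%VS.
Proof.
exists 1, 1; split=> // t a b _ _; rewrite memv0 => /eqP->.
by rewrite linear0 (N_0 hN) !mulr0.
Qed.

Lemma dominated_list_cut Es k : dominated_list Es ->
  dominated_cut N A (vsum (take k Es)) (vsum (drop k Es)).
Proof.
move=> [inv sumE dimE dom]; split.
- by apply: invariant_vsum => E /mem_take; apply: inv.
- by apply: invariant_vsum => E /mem_drop; apply: inv.
- have full : (vsum (take k Es) + vsum (drop k Es) = fullv)%VS.
    by rewrite -vsum_cat cat_take_drop.
  split=> //; apply/eqP; rewrite -dimv_eq0.
  have := dimv_sum_cap (vsum (take k Es)) (vsum (drop k Es)).
  rewrite full dimV; have := dim_vsum_le (take k Es); have := dim_vsum_le (drop k Es).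
  have : (\sum_(E <- take k Es) \dim E + \sum_(E <- drop k Es) \dim E = n)%N.
    by rewrite -big_cat cat_take_drop.
  move=> h1 h2 h3 h4; have := leq_add h3 h2.
  by rewrite -h4 h1 -[leqRHS]addn0 leq_add2l leqn0.
- have [k0|k0] := posnP k; first by rewrite k0 take0 vsum_nil; exact: dominates_0l.
  have [kS|kS] := ltnP k (size Es); first by apply: dom; rewrite k0.
  by rewrite drop_oversize// vsum_nil; exact: dominates_0r.
Qed.

Lemma cut_unique E F P Q : dominated_cut N A E F -> dominated_cut N A P Q ->
  \dim E = \dim P -> E = P /\ F = Q.
Proof.
move=> c1 c2 d.
have [h1 h2] := cut_nested hN hA c1 c2 (eq_leq d).
have [h3 h4] := cut_nested hN hA c2 c1 (eq_leq (esym d)).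
by split; apply/eqP; rewrite eqEsubv ?h1 ?h2 ?h3 ?h4.
Qed.

Lemma trivial_cut_l : dominated_cut N A 0%VS fullv.
Proof.
split; [|by move=> t x _; rewrite memvf| |exact: dominates_0l].
  by move=> t x; rewrite !memv0 => /eqP->; rewrite linear0.
by split; rewrite ?add0v ?cap0v.
Qed.

Lemma trivial_cut_r : dominated_cut N A fullv 0%VS.
Proof.
split; [by move=> t x _; rewrite memvf| | |exact: dominates_0r].
  by move=> t x; rewrite !memv0 => /eqP->; rewrite linear0.
by split; rewrite ?addv0 ?capv0.
Qed.

Section Chain.
Variables (m : nat) (p q : nat -> {vspace V}).
Hypotheses (p0 : p 0 = 0%VS) (q0 : q 0 = fullv) (pm : p m = fullv) (qm : q m = 0%VS).
Hypothesis cuts : forall j, (j <= m)%N -> dominated_cut N A (p j) (q j).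
Hypothesis pS : forall j, (j < m)%N -> (p j <= p j.+1)%VS.
Hypothesis qS : forall j, (j < m)%N -> (q j.+1 <= q j)%VS.

Let E j := (p j.+1 :&: q j)%VS.

(** Modular law, [p j + q j] being the whole space. *)
Lemma chain_p j : (j < m)%N -> p j.+1 = (p j + E j)%VS.
Proof.
move=> jm; rewrite /E capvC vspace_modl ?pS//.
by have [_ _ [-> _] _] := cuts (ltnW jm); rewrite capfv.
Qed.

Lemma chain_q j : (j < m)%N -> q j = (E j + q j.+1)%VS.
Proof.
move=> jm; rewrite /E addvC vspace_modl ?qS//.
by have [_ _ [h _] _] := cuts jm; rewrite addvC h capfv.
Qed.

Lemma chain_dim j : (j < m)%N -> (\dim (p j.+1) = \dim (p j) + \dim (E j))%N.
Proof.
move=> jm; rewrite {1}chain_p// dimv_disjoint_sum//.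
apply/eqP; rewrite -subv0; have [_ _ [_ <-] _] := cuts (ltnW jm).
by rewrite capvS// /E capvSr.
Qed.

Lemma vsum_chain_take k : (k <= m)%N -> vsum (take k (mkseq E m)) = p k.
Proof.
move=> km; rewrite /mkseq -map_take take_iota (minn_idPl km).
elim: k km => [_|k IH km]; first by rewrite p0 vsum_nil.
by rewrite -[k.+1]addn1 iotaD map_cat vsum_cat IH ?(ltnW km)// vsum_cons
  vsum_nil addv0 add0n addn1 -chain_p.
Qed.

Lemma vsum_chain_drop k : (k <= m)%N -> vsum (drop k (mkseq E m)) = q k.
Proof.
move=> km; rewrite /mkseq -map_drop drop_iota add0n.
rewrite -[k in q k](subKn km) -{1}(subKn km).
elim: (m - k)%N (leq_subr k m) => [_|d IH dm]; first by rewrite subn0 qm vsum_nil.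
rewrite /= vsum_cons -subSn ?subSS ?IH ?(ltnW dm)//.
have -> : (m - d = (m - d.+1).+1)%N by lia.
by rewrite -chain_q//; lia.
Qed.

Lemma dominated_chain : dominated_list (mkseq E m).
Proof.
split.
- move=> F /mapP[j]; rewrite mem_iota add0n => /andP[_ jm] -> t x.
  rewrite !memv_cap => /andP[xp xq].
  have [ip _ _ _] := cuts jm; have [_ iq _ _] := cuts (ltnW jm).
  by rewrite ip ?iq.
- rewrite -pm -(vsum_chain_take (leqnn m)) take_oversize// size_mkseq//.
- transitivity (\dim (p m)); last by rewrite pm dimV.
  rewrite /mkseq; elim: {-2}m (leqnn m) => [_|k IH km]; first by rewrite big_nil p0 dimv0.
  rewrite -[k.+1]addn1 iotaD map_cat big_cat/= IH ?(ltnW km)//.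
  by rewrite big_seq1 add0n addn1 chain_dim.
- move=> k; rewrite size_mkseq => /andP[_ km].
  rewrite vsum_chain_take ?(ltnW km)// vsum_chain_drop ?(ltnW km)//.
  by have [] := cuts (ltnW km).
Qed.

End Chain.

(* By cut_nested, the dominated cuts form a chain, with at most one cut of each
   dimension; the finest splitting consists of the successive quotients
   p (j + 1) :&: q j of this chain. *)
Lemma exists_finest P0 Q0 : dominated_cut N A P0 Q0 ->
  exists Ls Lu, [/\ dominated_list (Ls ++ Lu), vsum Ls = P0, vsum Lu = Q0,
    0%VS \notin Ls ++ Lu & forall Fs, dominated_list Fs ->
      forall E, E \in Ls ++ Lu -> exists2 F, F \in Fs & (E <= F)%VS].
Proof.
move=> cut0; pose isdim i := exists E F, dominated_cut N A E F /\ \dim E = i.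
have /choice[PQ hPQ] : forall i, exists PQ : {vspace V} * {vspace V},
    isdim i -> dominated_cut N A PQ.1 PQ.2 /\ \dim PQ.1 = i.
  move=> i; have [[E [F h]]|no] := pselect (isdim i); first by exists (E, F).
  by exists (0%VS, 0%VS) => /no.
(* The increasing list of the dimensions of dominated cuts. It starts at [0] and ends at [n] because
   of the two trivial cuts, and [ix] enumerates it. *)
pose I := [seq i <- iota 0 n.+1 | `[<isdim i>]].
have dimle E : (\dim E <= n)%N by rewrite -[leqRHS]dimV; exact/dimvS/subvf.
have inI i : (i \in I) = `[<isdim i>].
  rewrite mem_filter mem_iota add0n ltnS /=; case: asboolP => //= -[E [F [_ <-]]].
  exact: dimle.
have sI : sorted ltn I by apply: sorted_filter; [exact: ltn_trans|exact: iota_ltn_sorted].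
have I0 : 0%N \in I.
  by rewrite inI; apply/asboolP; exists 0%VS, fullv; split; [exact: trivial_cut_l|rewrite dimv0].
have In : n \in I.
  by rewrite inI; apply/asboolP; exists fullv, 0%VS; split; [exact: trivial_cut_r|rewrite dimV].
have sz : (0 < size I)%N by case: (I) I0.
pose m := (size I).-1; pose ix j := nth 0%N I j.
have szE : size I = m.+1 by rewrite prednK.
have ixI j : (j <= m)%N -> ix j \in I by move=> jm; rewrite mem_nth// szE ltnS.
have ixlt i j : (i < j)%N -> (j <= m)%N -> (ix i < ix j)%N.
  move=> ij jm; apply: (sorted_ltn_nth ltn_trans 0%N sI) => //.
    by rewrite inE szE ltnS; apply: leq_trans jm; apply: ltnW.
  by rewrite inE szE ltnS.
have ixex i : i \in I -> exists2 j, (j <= m)%N & i = ix j.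
  move=> iI; exists (index i I); last by rewrite /ix nth_index.
  by move: iI; rewrite -index_mem szE ltnS.
have ix0 : ix 0 = 0%N.
  have [[|j] jm e] := ixex _ I0; first by rewrite -e.
  by have := ixlt 0%N j.+1 isT jm; rewrite -e.
have ixle i j : (i <= j)%N -> (j <= m)%N -> (ix i <= ix j)%N.
  by rewrite leq_eqVlt => /orP[/eqP->//|ij jm]; apply/ltnW/ixlt.
have dimI j : (j <= m)%N -> dominated_cut N A (PQ (ix j)).1 (PQ (ix j)).2 /\
    \dim (PQ (ix j)).1 = ix j.
  by move=> jm; apply: hPQ; apply/asboolP; rewrite -inI; apply: ixI.
have ixm : ix m = n.
  have [j jm e] := ixex _ In; have := ixle _ _ jm (leqnn m); rewrite -e.
  have [_ <-] := dimI m (leqnn m); have := dimle (PQ (ix m)).1; lia.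
pose p j := (PQ (ix j)).1; pose q j := (PQ (ix j)).2.
have cuts j : (j <= m)%N -> dominated_cut N A (p j) (q j) by move=> /dimI[].
have dp j : (j <= m)%N -> \dim (p j) = ix j by move=> /dimI[].
have [p0 q0] : p 0%N = 0%VS /\ q 0%N = fullv.
  apply: cut_unique trivial_cut_l _; first exact: cuts.
  by rewrite dp// ix0 dimv0.
have [pm qm] : p m = fullv /\ q m = 0%VS.
  apply: cut_unique trivial_cut_r _; first exact: cuts.
  by rewrite dp// ixm dimV.
have pq j k : (j <= k)%N -> (k <= m)%N -> (p j <= p k)%VS /\ (q k <= q j)%VS.
  move=> jk km; have jm := leq_trans jk km.
  by apply: (cut_nested hN hA (cuts j jm) (cuts k km)); rewrite !dp ?ixle.
have pS j : (j < m)%N -> (p j <= p j.+1)%VS by move=> jm; have [] := pq j j.+1 (leqnSn j) jm.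
have qS j : (j < m)%N -> (q j.+1 <= q j)%VS by move=> jm; have [] := pq j j.+1 (leqnSn j) jm.
have dom := dominated_chain p0 pm qm cuts pS qS.
set L := mkseq _ m in dom.
have [k km kE] : exists2 k, (k <= m)%N & \dim P0 = ix k.
  by apply: ixex; rewrite inI; apply/asboolP; exists P0, Q0.
have [P0E Q0E] : P0 = p k /\ Q0 = q k.
  by apply: cut_unique cut0 (cuts k km) _; rewrite kE dp.
exists (take k L), (drop k L); rewrite cat_take_drop; split=> //.
- by rewrite P0E (vsum_chain_take p0 cuts pS).
- by rewrite Q0E (vsum_chain_drop qm cuts qS).
- apply/negP => /mapP[j]; rewrite mem_iota add0n => /andP[_ jm] e.
  have := chain_dim cuts pS jm; rewrite -e dimv0 addn0 dp// dp ?(ltnW jm)//.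
  by have := ixlt j j.+1 (ltnSn j) jm; lia.
move=> Fs domF E /mapP[j]; rewrite mem_iota add0n => /andP[_ jm] ->.
have cutF l := dominated_list_cut l domF.
(* [l] is the block of [Fs] across which the cumulated dimension passes [ix j]. *)
have [l lF /andP[l1 l2]] : exists2 l, (l < size Fs)%N &
    (\dim (vsum (take l Fs)) <= ix j < \dim (vsum (take l.+1 Fs)))%N.
  have : (ix j < \dim (vsum (take (size Fs) Fs)))%N.
    case: domF => [_ sF _ _]; rewrite take_size sF dimV -ixm.
    exact: ixlt.
  elim: (size Fs) => [|s IH]; first by rewrite take0 vsum_nil dimv0.
  have [h _|h hs] := ltnP (ix j) (\dim (vsum (take s Fs))).
    by have [l ls hl] := IH h; exists l => //; apply: ltnW.
  by exists s; rewrite ?h.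
have h1 : (p j.+1 <= vsum (take l.+1 Fs))%VS.
  suff d : (\dim (p j.+1) <= \dim (vsum (take l.+1 Fs)))%N.
    by have [] := cut_nested hN hA (cuts _ jm) (cutF l.+1) d.
  rewrite dp//.
  (* The dimension of this cut of [Fs] belongs to [I] and exceeds [ix j], so it is at least
     [ix j.+1]. *)
  have [i im iE] : exists2 i, (i <= m)%N & \dim (vsum (take l.+1 Fs)) = ix i.
    by apply: ixex; rewrite inI; apply/asboolP; do 2 eexists; split; first exact: (cutF l.+1).
  rewrite iE; apply: (ixle _ _ _ im); rewrite ltnNge; apply/negP => ij.
  by have := ixle _ _ ij (ltnW jm); rewrite -iE leqNgt l2.
have h2 : (q j <= vsum (drop l Fs))%VS.
  suff d : (\dim (vsum (take l Fs)) <= \dim (p j))%N.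
    by have [] := cut_nested hN hA (cutF l) (cuts _ (ltnW jm)) d.
  by rewrite dp ?(ltnW jm).
exists (nth 0%VS Fs l); first exact: mem_nth.
(* The blocks up to [l] and the blocks from [l] on have only block [l] in common. *)
apply/subvP => x; rewrite memv_cap => /andP[/(subvP h1) x1 /(subvP h2) x2].
move: x1; rewrite (take_nth 0%VS)// -cats1 vsum_cat vsum_cons vsum_nil addv0.
move=> /memv_addP[y yT [z zF xyz]]; rewrite xyz.
have yD : y \in vsum (drop l Fs).
  have -> : y = x - z by rewrite xyz addrK.
  rewrite rpredB//; apply: (subvP (vsum_sup _) _ zF).
  by rewrite (drop_nth 0%VS)// inE eqxx.
have [_ _ cpl _] := cutF l.
by rewrite (complementary_eq0 cpl yT yD) add0r.
Qed.

End Finest.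

(** * Riemannian norms, charts and flows *)

Section MetricTheory.
Context {R : realType} {n : nat} {M : topologicalType} {A : smooth_atlas R n M}.
Variable g : riemannian_metric A.
Implicit Types (x y : M) (u v w : 'rV[R]_n).

Lemma ipDl x u v w : ip g x (u + v) w = ip g x u w + ip g x v w.
Proof. by rewrite /ip !mulmxDl mxE. Qed.

Lemma ipZl x c u w : ip g x (c *: u) w = c * ip g x u w.
Proof. by rewrite /ip -!scalemxAl mxE. Qed.

Lemma ipC x u v : ip g x u v = ip g x v u.
Proof.
rewrite /ip; have -> : (v *m gram g x *m u^T) 0 0 = ((v *m gram g x *m u^T)^T) 0 0.
  by rewrite [RHS]mxE.
by rewrite !trmx_mul trmxK gram_sym mulmxA.
Qed.

Lemma ipDr x u v w : ip g x w (u + v) = ip g x w u + ip g x w v.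
Proof. by rewrite !(ipC _ w) ipDl. Qed.

Lemma ipZr x c u w : ip g x w (c *: u) = c * ip g x w u.
Proof. by rewrite !(ipC _ w) ipZl. Qed.

Lemma ip_gt0 x v : v != 0 -> 0 < ip g x v v.
Proof. exact: gram_pos. Qed.

Lemma ip0 x v : ip g x 0 v = 0.
Proof. by rewrite -(scale0r 0) ipZl mul0r. Qed.

Lemma ip_ge0 x v : 0 <= ip g x v v.
Proof. by have [->|/ip_gt0/ltW//] := eqVneq v 0; rewrite ip0. Qed.

Lemma tnormE x v : tnorm g x v ^+ 2 = ip g x v v.
Proof. by rewrite sqr_sqrtr ?ip_ge0. Qed.

Lemma tnorm_ge0 x v : 0 <= tnorm g x v.
Proof. exact: sqrtr_ge0. Qed.

Lemma cauchy_schwarz x u v : `|ip g x u v| <= tnorm g x u * tnorm g x v.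
Proof.
have h : ip g x u v ^+ 2 <= ip g x u u * ip g x v v.
  have [->|v0] := eqVneq v 0; first by rewrite ipC !ip0 mulr0 expr0n.
  have := ip_ge0 x (ip g x v v *: u + (- ip g x u v) *: v).
  rewrite !(ipDl, ipDr, ipZl, ipZr) (ipC _ v u) => h.
  rewrite -(ler_pM2l (ip_gt0 x v0)); nra.
rewrite -(@ler_pXn2r _ 2) ?nnegrE ?mulr_ge0 ?tnorm_ge0//.
by rewrite exprMn !tnormE real_normK ?num_real.
Qed.

Lemma tnormD x u v : tnorm g x (u + v) <= tnorm g x u + tnorm g x v.
Proof.
rewrite -(@ler_pXn2r _ 2) ?nnegrE ?addr_ge0 ?tnorm_ge0//.
rewrite tnormE !(ipDl, ipDr) sqrrD !tnormE (ipC _ v u).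
have := le_trans (ler_norm _) (cauchy_schwarz x u v); lra.
Qed.

Lemma tnormZ x c v : tnorm g x (c *: v) = `|c| * tnorm g x v.
Proof. by rewrite /tnorm ipZl ipZr mulrA -expr2 sqrtrM ?sqr_ge0// sqrtr_sqr. Qed.

Lemma tnorm_eq0 x v : tnorm g x v = 0 -> v = 0.
Proof.
move=> h; apply/eqP/negPn/negP => /(ip_gt0 x).
by rewrite -tnormE h expr0n /= ltxx.
Qed.

(** The coordinate [v 0 i] is the scalar product of [v] with row [i] of the inverse Gram matrix, so
    Cauchy-Schwarz bounds it. *)
Lemma tnorm_coord x i : exists2 C, 0 <= C & forall v, `|v 0 i| <= C * tnorm g x v.
Proof.
have Gu : gram g x \in unitmx.
  rewrite -row_free_unit -kermx_eq0; apply/rowV0P => v /sub_kermxP vG.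
  apply/eqP/negPn/negP => /(gram_pos g x).
  by rewrite vG mul0mx mxE ltxx.
pose w := delta_mx 0 i *m invmx (gram g x) : 'rV_n.
exists (tnorm g x w); first exact: tnorm_ge0.
move=> v; rewrite mulrC; apply: le_trans (cauchy_schwarz x v w).
rewrite /ip /w trmx_mul trmx_inv gram_sym mulmxA mulmxK// trmx_delta.
by rewrite -colE mxE.
Qed.

Lemma tnorm_bounded x y (f : 'End('rV[R]_n)) :
  exists2 K, 0 < K & forall v, tnorm g y (f v) <= K * tnorm g x v.
Proof.
have /choice[C hC] : forall i, exists C, 0 <= C /\
    forall v, `|v 0 i| <= C * tnorm g x v.
  by move=> i; have [C C0 h] := tnorm_coord x i; exists C.
exists (\sum_i C i * tnorm g y (f (delta_mx 0 i)) + 1).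
  rewrite ltr_wpDl// sumr_ge0// => i _; rewrite mulr_ge0 ?tnorm_ge0//.
  by have [] := hC i.
move=> v; rewrite mulrDl mul1r -[leLHS]addr0 lerD ?tnorm_ge0//.
rewrite {1}(row_sum_delta v) linear_sum /=.
have : forall s : seq 'I_n, tnorm g y (\sum_(i <- s) f (v 0 i *: delta_mx 0 i)) <=
    (\sum_(i <- s) C i * tnorm g y (f (delta_mx 0 i))) * tnorm g x v.
  elim=> [|i s IH]; first by rewrite !big_nil mul0r -(scale0r 0) tnormZ normr0 mul0r.
  rewrite !big_cons; apply: (le_trans (tnormD _ _ _)).
  rewrite mulrDl lerD// homZ tnormZ mulrAC ler_wpM2r ?tnorm_ge0//.
  by have [_] := hC i.
by move=> /(_ (index_enum _)).
Qed.

Lemma tnorm_is_norm x : is_norm (tnorm g x).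
Proof.
by split; [exact: tnorm_eq0|exact: tnormD|exact: tnormZ|exact: tnorm_bounded].
Qed.

Definition line_dist x u v := tnorm g x (proj_orth g x u v).

(** If [<v,u> = d <u,u>], the squared norm of [v - c u] exceeds its value at [c = d] by
    [(c - d)^2 <u,u>]. *)
Lemma line_distP x : is_line_dist (tnorm g x) (line_dist x).
Proof.
move=> u v; split; last by exists (ip g x v u / ip g x u u).
move=> c; rewrite /line_dist /proj_orth; set d := _ / _.
have [->|u0] := eqVneq u 0; first by rewrite !scaler0.
have uu0 := ip_gt0 x u0.
have dE : ip g x v u = d * ip g x u u by rewrite /d divfK ?gt_eqF.
clearbody d; rewrite -(@ler_pXn2r _ 2) ?nnegrE ?tnorm_ge0// !tnormE.
rewrite -!scaleNr !(ipDl, ipDr, ipZl, ipZr) (ipC _ u v) dE.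
by have := mulr_ge0 (sqr_ge0 (c - d)) (ltW uu0); nra.
Qed.

Lemma proj_orthD x u v w : proj_orth g x u (v + w) = proj_orth g x u v + proj_orth g x u w.
Proof. by rewrite /proj_orth ipDl mulrDl scalerDl opprD addrACA. Qed.

Lemma proj_orthZ x u c v : proj_orth g x u (c *: v) = c *: proj_orth g x u v.
Proof. by rewrite /proj_orth ipZl -mulrA -scalerA scalerBr. Qed.

Lemma proj_orth_line x u c v : c != 0 -> proj_orth g x (c *: u) v = proj_orth g x u v.
Proof.
move=> c0; rewrite /proj_orth !(ipZl, ipZr) scalerA.
have [->|u0] := eqVneq u 0; first by rewrite !scaler0.
congr (_ - _ *: _); field; rewrite c0 gt_eqF ?ip_gt0//.
Qed.

Lemma mem_orth x u v : (v \in orth g x u) = (ip g x v u == 0).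
Proof.
have lin : linear (fun v => ip g x v u : R^o).
  by move=> c a b; rewrite ipDl ipZl.
pose f : {linear 'rV[R]_n -> R^o} := HB.pack (fun v => ip g x v u : R^o)
  (GRing.isLinear.Build _ _ _ _ _ lin).
by rewrite /orth memv_ker (lfunE f).
Qed.

Lemma proj_orth_mem x u v : proj_orth g x u v \in orth g x u.
Proof.
have [->|u0] := eqVneq u 0; first by rewrite mem_orth ipC ip0.
by rewrite mem_orth /proj_orth -scaleNr ipDl ipZl mulNr divfK ?subrr// gt_eqF ?ip_gt0.
Qed.

Lemma proj_orth_id x u v : v \in orth g x u -> proj_orth g x u v = v.
Proof. by rewrite mem_orth /proj_orth => /eqP->; rewrite mul0r scale0r subr0. Qed.

Lemma proj_orth_self x u : proj_orth g x u u = 0.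
Proof.
rewrite /proj_orth; have [->|u0] := eqVneq u 0; first by rewrite !scaler0 subrr.
by rewrite divff ?scale1r ?subrr// gt_eqF ?ip_gt0.
Qed.

Lemma orth_complementary x u : u != 0 -> complementary <[u]>%VS (orth g x u).
Proof.
move=> u0; split.
  apply/eqP; rewrite eqEsubv subvf /=; apply/subvP => v _.
  rewrite -[v](subrK (proj_orth g x u v)) memv_add ?proj_orth_mem//.
  by rewrite /proj_orth opprB addrC subrK memvZ ?memv_line.
apply/eqP; rewrite -subv0; apply/subvP => v; rewrite memv_cap memv0.
move=> /andP[/vlineP[c ->]]; rewrite mem_orth ipZl mulf_eq0.
by rewrite (gt_eqF (ip_gt0 x u0)) orbF => /eqP->; rewrite scale0r.
Qed.

Section OperatorNorm.
Context {Z : topologicalType} (F : linear_flow R n M Z) (t : R) (z : Z).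
Implicit Types (E : {vspace 'rV[R]_n}).
Let N := tnorm g (lf_pt F z).
Let N' := tnorm g (lf_pt F (lf_act F t z)).

Lemma opnorm_le E c : 0 <= c ->
  (forall v, v \in E -> N' (lf_map F t z v) <= c * N v) -> opnorm g F t z E <= c.
Proof.
move=> c0 h; apply: ge_sup.
  by exists (N' (lf_map F t z 0)), 0 => //=; rewrite mem0v (N_0 (tnorm_is_norm _)).
move=> _ [v [vE v1] <-]; apply: (le_trans (h v vE)).
by rewrite -[leRHS]mulr1 ler_wpM2l.
Qed.

Hypothesis lfZ : forall c v, lf_map F t z (c *: v) = c *: lf_map F t z v.
Hypothesis lfb : exists K, forall v, N' (lf_map F t z v) <= K * N v.

(** [opnorm] is a supremum, which bounds its set only when that set is bounded above: this is the
    purpose of [lfb]. *)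
Lemma le_opnorm E v : v \in E -> N' (lf_map F t z v) <= opnorm g F t z E * N v.
Proof.
move=> vE; have [v0|v0] := eqVneq v 0.
  have -> : v = 0 *: v by rewrite v0 scaler0.
  by rewrite lfZ /N' /N !tnormZ normr0 !mul0r mulr0.
have Nv : 0 < N v := N_gt0 (tnorm_is_norm _) v0.
rewrite -ler_pdivrMr//; apply: ub_le_sup.
  have [K hK] := lfb; exists `|K| => _ [w [_ w1] <-]; apply: (le_trans (hK w)).
  apply: (le_trans (ler_wpM2r (tnorm_ge0 _ _) (ler_norm K))).
  by rewrite -[leRHS]mulr1 ler_wpM2l.
exists ((N v)^-1 *: v); first split=> /=; first exact: memvZ.
  by rewrite tnormZ ger0_norm ?invr_ge0 ?(ltW Nv)// mulVf ?gt_eqF.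
by rewrite lfZ tnormZ ger0_norm ?invr_ge0 ?(ltW Nv)// mulrC.
Qed.

Lemma opnorm_ge0 E : 0 <= opnorm g F t z E.
Proof.
apply: ub_le_sup.
  have [K hK] := lfb; exists `|K| => _ [w [_ w1] <-]; apply: (le_trans (hK w)).
  apply: (le_trans (ler_wpM2r (tnorm_ge0 _ _) (ler_norm K))).
  by rewrite -[leRHS]mulr1 ler_wpM2l.
exists 0 => /=; first by rewrite mem0v (N_0 (tnorm_is_norm _)).
by rewrite -(scale0r 0) lfZ tnormZ normr0 mul0r.
Qed.

End OperatorNorm.

End MetricTheory.

Section RowNorm.
Context {R : realType} {n : nat}.
Implicit Types v : 'rV[R]_n.

Lemma coord_le_norm v i : `|v 0 i| <= `|v|.
Proof. by rewrite [leRHS]mx_normrE; apply: (le_bigmax _ _ (0, i)). Qed.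

Lemma norm_le_coord v c : 0 <= c -> (forall i, `|v 0 i| <= c) -> `|v| <= c.
Proof.
move=> c0 h; rewrite [leLHS]mx_normrE; apply: bigmax_le => //= -[i j] _ /=.
by rewrite ord1; apply: h.
Qed.

End RowNorm.

(** * Differentials and strict differentiability *)

Section Differentials.
Context {R : realType}.

Lemma near_diff {V W : normedModType R} (f h : V -> W) (a : V) :
  (\forall x \near a, f x = h x) -> differentiable f a ->
  differentiable h a /\ 'd h a = 'd f a :> (V -> W).
Proof.
move=> fh df.
have e : h \o shift a = cst (h a) + 'd f a +o_ 0 id.
  apply/eqaddoP => e e0.
  have fa : f a = h a := nbhs_singleton fh.
  have /eqaddoP/(_ e e0) H := diff_locally df.
  have fh0 : \forall x \near (0 : V), f (x + a) = h (x + a).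
    have : (fun x : V => x + a) x @[x --> (0 : V)] --> a.
      by rewrite -[X in _ --> X]add0r; apply: cvgD; [exact: cvg_id|exact: cvg_cst].
    by move=> /(_ _ fh).
  by apply: filterS2 H fh0 => x; rewrite !fctE /= fa => H1 H2; rewrite -H2.
have dE : 'd h a = 'd f a :> (V -> W) by apply: diff_unique e; exact: diff_continuous.
by split=> //; apply/diff_locallyP; rewrite dE; split=> //; exact: diff_continuous.
Qed.

Lemma is_diff_coord {m n : nat} (M : 'M[R]_(m, n)) i j :
  is_diff M (fun N : 'M[R]_(m, n) => N i j : R) (fun N => N i j).
Proof.
have @f : {linear 'M[R]_(m, n) -> R}.
  by exists (fun N : 'M[R]_(_, _) => N i j); do 2![eexists]; do ?[constructor];
     rewrite ?mxE// => ? *; rewrite ?mxE//; move=> ?; rewrite !mxE.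
apply: DiffDef; first exact: differentiable_coord.
by apply: (@diff_lin _ _ _ f); exact: coord_continuous.
Qed.

Lemma is_derive_coord {k : nat} (c : R -> 'rV[R]_k) (s : R) v i :
  is_derive s (1 : R) c v -> is_derive s (1 : R) (fun s => c s 0 i) (v 0 i).
Proof.
move=> [dc dcE].
have fc : differentiable c s by apply/derivable1_diffP.
have H : is_diff s ((fun N : 'rV[R]_k => N 0 i : R) \o c) _ :=
  is_diff_comp (differentiableP fc) (is_diff_coord _ _ _).
have fH : differentiable (fun s => c s 0 i) s by case: H.
apply: DeriveDef; first exact/derivable1_diffP.
have <- : 'd c s 1 = v by rewrite -deriveE.
by rewrite deriveE//; case: H => _ ->.
Qed.

Lemma diff_curve {V W : normedModType R} (c : R -> V) (f : V -> W) (s : R) v :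
  is_derive s (1 : R) c v -> differentiable f (c s) ->
  is_derive s (1 : R) (f \o c) ('d f (c s) v).
Proof.
move=> [dc dcE] df.
have fc : differentiable c s by apply/derivable1_diffP.
have fH : differentiable (f \o c) s by exact: differentiable_comp.
apply: DeriveDef; first exact/derivable1_diffP.
have <- : 'd c s 1 = v by rewrite -deriveE.
by rewrite deriveE// diff_comp.
Qed.

Lemma is_derive_line {m : nat} (y v : 'rV[R]_m) (s : R) :
  is_derive s (1 : R) (fun s : R => y + s *: v) v.
Proof.
have ds : is_diff s ( *:%R ^~ v : R -> 'rV[R]_m) ( *:%R ^~ v) by exact: is_diff_scalel.
have dl : is_derive s (1 : R) ( *:%R ^~ v : R -> 'rV[R]_m) v.
  apply: DeriveDef; first by apply/derivable1_diffP; case: ds.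
  by rewrite deriveE; case: ds => // _ ->; rewrite scale1r.
have dy : is_derive s (1 : R) (cst y : R -> 'rV[R]_m) 0 := is_derive_cst _ _ _.
by have := is_deriveD dy dl; rewrite add0r.
Qed.

Lemma is_derive_mulr (c s : R) : is_derive s (1 : R) (fun s : R => s * c) c.
Proof.
have di : is_derive s (1 : R) (id : R -> R) 1 := is_derive_id _ _.
have dc : is_derive s (1 : R) (cst c : R -> R) 0 := is_derive_cst _ _ _.
have := is_deriveM di dc; rewrite scaler0 add0r /= /GRing.scale /= mulr1.
exact.
Qed.

(** The mean value theorem, applied to each coordinate along the segment from [y] to [x], reduces
    the estimate to continuity at [a] of the partial derivatives. The strict form is what allows two
    moving points to be compared with each other. *)
Lemma Ck1_strict {m k : nat} (U : set 'rV[R]_m) (f : 'rV[R]_m -> 'rV[R]_k)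
    (a : 'rV[R]_m) :
  nbhs a U -> Ck 1 U f -> forall e : R, 0 < e -> exists2 d : R, 0 < d &
    forall x y : 'rV[R]_m, `|x - a| < d -> `|y - a| < d ->
      `|f x - f y - 'd f a (x - y)| <= e * `|x - y|.
Proof.
move=> Ua [df cf] e e0.
have Uaa : U a := nbhs_singleton Ua.
(* Each of the [m] partial derivatives gets an equal share; [m.+1] keeps the divisor nonzero for
   [m = 0]. *)
have e1 : 0 < e / m.+1%:R by rewrite divr_gt0.
have H : \forall z \near a, U z /\ forall i : 'I_m,
    `|'D_(delta_mx 0 i) f a - 'D_(delta_mx 0 i) f z| < e / m.+1%:R.
  apply: filterI => //.
  apply: (@filter_forall _ 'I_m (fun i z =>
    `|'D_(delta_mx 0 i) f a - 'D_(delta_mx 0 i) f z| < e / m.+1%:R) (nbhs a)) => i.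
  by have /cvgrPdist_lt := cf (delta_mx 0 i) a Uaa; apply.
have [d d0 hd] : exists2 d, 0 < d & forall z, `|z - a| < d -> U z /\ forall i : 'I_m,
    `|'D_(delta_mx 0 i) f a - 'D_(delta_mx 0 i) f z| < e / m.+1%:R.
  have /nbhs_normP[d d0 hd] := H; exists d => // z za; apply: hd.
  by rewrite /ball_ /= distrC.
have bound z v : `|z - a| < d -> `|'d f z v - 'd f a v| <= e * `|v|.
  move=> /hd[Uz hz].
  have sumE w : U w -> 'd f w v = \sum_i v 0 i *: 'D_(delta_mx 0 i) f w.
    move=> Uw; rewrite {1}(row_sum_delta v) linear_sum; apply: eq_bigr => i _.
    by rewrite linearZ /= deriveE//; apply: df.
  have E : 'd f z v - 'd f a v =
      \sum_i v 0 i *: ('D_(delta_mx 0 i) f z - 'D_(delta_mx 0 i) f a).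
    transitivity (\sum_i v 0 i *: 'D_(delta_mx 0 i) f z -
                  \sum_i v 0 i *: 'D_(delta_mx 0 i) f a).
      exact (f_equal2 (fun b c : 'rV[R]_k => b - c) (sumE z Uz) (sumE a Uaa)).
    by rewrite -sumrB; apply: eq_bigr => i _; rewrite scalerBr.
  apply: (@le_trans _ _ `|\sum_i v 0 i *: ('D_(delta_mx 0 i) f z - 'D_(delta_mx 0 i) f a)|).
    by rewrite le_eqVlt; apply/orP; left; apply/eqP; exact: congr1 E.
  apply: (le_trans (ler_norm_sum _ _ _)).
  apply: (@le_trans _ _ (\sum_(i < m) `|v| * (e / m.+1%:R))).
    apply: ler_sum => i _; rewrite normrZ ler_pM// ?coord_le_norm//.
    by rewrite distrC ltW.
  rewrite sumr_const card_ord -mulrnAr mulrC ler_wpM2r//.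
  by rewrite -mulr_natr mulrAC ler_pdivrMr// ler_pM2l// ler_nat.
exists d => // x y xa ya; apply: norm_le_coord; first by rewrite mulr_ge0// ltW.
move=> i; set v := x - y.
pose L (s : R) : 'rV[R]_m := y + s *: v.
have La (s : R) : 0 <= s <= 1 -> `|L s - a| < d.
  move=> /andP[s0 s1].
  have -> : L s - a = (1 - s) *: (y - a) + s *: (x - a).
    by rewrite /L /v; apply/rowP => l; rewrite !mxE; ring.
  apply: (le_lt_trans (ler_normD _ _)); rewrite !normrZ !ger0_norm ?subr_ge0//.
  have [->|sn0] := eqVneq s 0; first by rewrite subr0 mul1r mul0r addr0.
  have sgt0 : 0 < s by rewrite lt_neqAle eq_sym sn0.
  have : s * `|x - a| < s * d by rewrite ltr_pM2l.
  have : (1 - s) * `|y - a| <= (1 - s) * d by rewrite ler_wpM2l ?subr_ge0// ltW.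
  lra.
pose h (s : R) : R := (f (L s)) 0 i - s * ('d f a v) 0 i.
have dL (s : R) : is_derive s (1 : R) L v by exact: is_derive_line.
have dh (s : R) : 0 <= s <= 1 -> is_derive s (1 : R) h (('d f (L s) v - 'd f a v) 0 i).
  move=> s01; have [Us _] := hd _ (La s s01).
  have H1 := is_derive_coord i (diff_curve (dL s) (df _ Us)).
  have H2 : is_derive s (1 : R) (fun s : R => s * ('d f a v) 0 i) (('d f a v) 0 i).
    exact: is_derive_mulr.
  have H3 := is_deriveB H1 H2; rewrite mxE [X in _ + X]mxE; exact: H3.
have [||c c01] := @MVT R h (fun s => ('d f (L s) v - 'd f a v) 0 i) 0 1 ltr01.
- by move=> s; rewrite in_itv /= => /andP[/ltW s0 /ltW s1]; apply: dh; rewrite s0.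
- apply: derivable_within_continuous => s; rewrite in_itv /= => s01.
  by have [] := dh s s01.
rewrite subr0 mulr1 /h /L scale1r scale0r addr0 mul1r mul0r subr0.
have -> : y + v = x by rewrite /v addrC subrK.
move=> E; have -> : (f x - f y - 'd f a v) 0 i = ('d f (L c) v - 'd f a v) 0 i.
  by rewrite -E !mxE addrAC.
apply: (le_trans (coord_le_norm _ _)); apply: bound; apply: La.
by move: c01; rewrite in_itv /= => /andP[/ltW-> /ltW->].
Qed.

End Differentials.

Section Charts.
Context {R : realType} {n : nat} {M : topologicalType} (A : smooth_atlas R n M).
Implicit Types (p x : M) (y : 'rV[R]_n).

Lemma cimg_chart p x : cdom A p x -> cimg A p (chart A p x).
Proof. by move=> px; exists x. Qed.

Lemma cdom_cinv p y : cimg A p y -> cdom A p (cinv A p y).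
Proof. by move=> [x px <-]; rewrite chartK. Qed.

Lemma cinvK p y : cimg A p y -> chart A p (cinv A p y) = y.
Proof. by move=> [x px <-]; rewrite chartK. Qed.

Lemma chart_inj p x x' : cdom A p x -> cdom A p x' ->
  chart A p x = chart A p x' -> x = x'.
Proof. by move=> px px' e; rewrite -(chartK px) e chartK. Qed.

Lemma cdom_nbhs p x : cdom A p x -> nbhs x (cdom A p).
Proof. by move=> px; apply: open_nbhs_nbhs; split=> //; exact: cdom_open. Qed.

Lemma cimg_nbhs p y : cimg A p y -> nbhs y (cimg A p).
Proof. by move=> py; apply: open_nbhs_nbhs; split=> //; exact: cimg_open. Qed.

Lemma chart_nbhs p x (U : set 'rV[R]_n) : cdom A p x -> nbhs (chart A p x) U ->
  \forall z \near x, U (chart A p z).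
Proof. by move=> px; apply: chart_continuous. Qed.

Lemma cinv_nbhs p x (U : set M) : cdom A p x -> nbhs x U ->
  \forall y \near chart A p x, U (cinv A p y).
Proof.
by move=> px xU; have := @cinv_continuous _ _ _ A p _ (cimg_chart px) U; rewrite chartK//; apply.
Qed.

End Charts.

Lemma continuous_pairr (S T : topologicalType) (s : S) (x : T) :
  {for x, continuous (fun x => (s, x))}.
Proof.
by apply: (@cvg_pair _ _ _ _ (nbhs s) (nbhs x) _ _ _ (fun=> s) id);
  [exact: cvg_cst|exact: cvg_id].
Qed.

Lemma continuous_pairl (S T : topologicalType) (s : S) (x : T) :
  {for s, continuous (fun s => (s, x))}.
Proof.
by apply: (@cvg_pair _ _ _ _ (nbhs s) (nbhs x) _ _ _ id (fun=> x));
  [exact: cvg_id|exact: cvg_cst].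
Qed.

(** * The flow and its velocity in charts *)

Section Flow.
Context {R : realType} {n : nat} {M : topologicalType} {A : smooth_atlas R n M}.
Variables (X : M -> 'rV[R]_n) (phi : R -> M -> M).
Hypothesis hphi : is_flow (A := A) X phi.
Implicit Types (p x : M) (t s : R).

Lemma flow0 x : phi 0 x = x. Proof. by case: hphi. Qed.
Lemma flowD s t x : phi (s + t) x = phi s (phi t x). Proof. by case: hphi. Qed.
Lemma flowK t x : phi (- t) (phi t x) = x. Proof. by rewrite -flowD addNr flow0. Qed.
Lemma flowKV t x : phi t (phi (- t) x) = x. Proof. by rewrite -flowD subrr flow0. Qed.

Lemma flow_continuous t : continuous (phi t).
Proof.
case: hphi => _ _ h _ _ x; apply: (@continuous_comp _ _ _ (fun x => (t, x)) (fun tx => phi tx.1 tx.2)).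
  exact: continuous_pairr.
exact: h.
Qed.

Lemma flow_orbit_continuous x : continuous (fun t => phi t x).
Proof.
case: hphi => _ _ h _ _ t; apply: (@continuous_comp _ _ _ (fun t => (t, x)) (fun tx => phi tx.1 tx.2)).
  exact: continuous_pairl.
exact: h.
Qed.

Definition flow_chart t p q : 'rV[R]_n -> 'rV[R]_n :=
  chart A q \o phi t \o cinv A p.

Definition flow_chart_dom t p q : set 'rV[R]_n :=
  [set y | cimg A p y /\ cdom A q (phi t (cinv A p y))].

Lemma flow_chart_dom_nbhs t p q x : cdom A p x -> cdom A q (phi t x) ->
  nbhs (chart A p x) (flow_chart_dom t p q).
Proof.
move=> px qx; apply: filterI; first exact/cimg_nbhs/cimg_chart.
apply: (cinv_nbhs (U := phi t @^-1` cdom A q) px).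
exact/(flow_continuous (t:=t) (x:=x))/cdom_nbhs.
Qed.

(** The jointly C^1 chart expression of the flow is composed with the affine map [y |-> (t, y)]. *)
Lemma flow_chart_Ck1 t p q : Ck 1 (flow_chart_dom t p q) (flow_chart t p q).
Proof.
case: hphi => _ _ _ /(_ p q) [dG cG] _.
pose G (ty : R^o * 'rV[R]_n) := chart A q (phi ty.1 (cinv A p ty.2)).
pose i y : R^o * 'rV[R]_n := (t, y).
have di y : is_diff y i (fun v => (0, v)).
  exact: (is_diff_pair (is_diff_cst (t : R^o) y) (is_diff_id y)).
have dF y : flow_chart_dom t p q y -> is_diff y (flow_chart t p q) ('d G (t, y) \o (fun v => (0, v))).
  move=> Uy; have dGy : is_diff (i y) G ('d G (i y)) by apply/differentiableP/(dG (t, y)).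
  exact: (is_diff_comp (di y) dGy).
split=> [y Uy|v y Uy]; first by case: (dF y Uy).
have e : \forall z \near y, 'D_(0, v) G (t, z) = 'D_v (flow_chart t p q) z.
  have Un : nbhs y (flow_chart_dom t p q).
    have [yp yq] := Uy; rewrite -(cinvK yp); apply: flow_chart_dom_nbhs => //.
    exact: cdom_cinv.
  apply: filterS Un => z Uz; rewrite !deriveE; last 2 first.
  - by case: (dF z Uz).
  - exact: (dG (t, z)).
  by have [_ ->] := dF z Uz.
suff : 'D_v (flow_chart t p q) z @[z --> y] --> 'D_v (flow_chart t p q) y by [].
have ey : 'D_(0, v) G (t, y) = 'D_v (flow_chart t p q) y := nbhs_singleton e.
have ci : {for y, continuous i} by exact: continuous_pairr.
rewrite -ey; apply: cvg_trans (near_eq_cvg e) _.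
exact: (continuous_comp ci (cG (0, v) (t, y) Uy)).
Qed.

Lemma flow_chart_differentiable t p q x : cdom A p x -> cdom A q (phi t x) ->
  differentiable (flow_chart t p q) (chart A p x).
Proof.
move=> px qx; have [+ _] := flow_chart_Ck1 t p q; apply.
by split; [exact: cimg_chart|rewrite chartK].
Qed.

Lemma flow_velocity x : is_derive (0 : R) (1 : R) (fun s => chart A x (phi s x)) (X x).
Proof. by case: hphi => _ _ _ _ /(_ x 0); rewrite !flow0. Qed.

Lemma DphiE t x : Dphi phi (A := A) t x = 'd (flow_chart t x (phi t x)) (chart A x x).
Proof. by []. Qed.

Lemma near_flow_dom t x p : cdom A p (phi t x) -> \forall s \near t, cdom A p (phi s x).
Proof. by move=> h; exact: (flow_orbit_continuous (cdom_nbhs h)). Qed.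

Lemma is_derive_near (V : normedModType R) (f h : R -> V) (a : R) v :
  (\forall x \near a, f x = h x) -> is_derive a (1 : R) f v -> is_derive a (1 : R) h v.
Proof.
move=> fh [df dE]; have dfa : differentiable f a by apply/derivable1_diffP.
have [dh e] := near_diff fh dfa; apply: DeriveDef; first exact/derivable1_diffP.
by rewrite deriveE// e -deriveE.
Qed.

(** By the group law the orbit near time [t] is the image under [phi t] of the orbit near time [0],
    whose velocity is [X x]. *)
Lemma flow_transport t x q : cdom A q (phi t x) ->
  is_derive t (1 : R) (fun s => chart A q (phi s x))
    ('d (flow_chart t x q) (chart A x x) (X x)).
Proof.
move=> qx; have c0 : chart A x (phi 0 x) = chart A x x by rewrite flow0.
have dF : differentiable (flow_chart t x q) (chart A x (phi 0 x)).
  by rewrite c0; apply: flow_chart_differentiable => //; exact: cdom_self.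
have := diff_curve (flow_velocity x) dF; rewrite c0 => H.
have e : \forall s \near (0 : R), (flow_chart t x q \o (fun s => chart A x (phi s x))) s =
    ((fun s => chart A q (phi s x)) \o shift t) s.
  have : \forall s \near (0 : R), cdom A x (phi s x).
    by apply: near_flow_dom; rewrite flow0; exact: cdom_self.
  apply: filterS => s sx; rewrite /flow_chart /= chartK// -flowD.
  by rewrite /shift /= addrC.
have {e} H0 := is_derive_near e H.
have e2 : (fun s => chart A q (phi s x)) =
    ((fun s => chart A q (phi s x)) \o shift t) \o shift (- t).
  by apply/funext => s; rewrite /shift /= subrK.
rewrite e2; have st := is_derive_shift t (1 : R) (- t).
have := @diff_curve _ _ _ (shift (- t)) _ t 1 st.
have [dH0 dE] := H0; rewrite /shift /= subrr => /(_ _ ((fun s => chart A q (phi s x)) \o shift t)).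
have dd : differentiable ((fun s => chart A q (phi s x)) \o shift t) (0 : R).
  by apply/derivable1_diffP.
by move=> /(_ dd); rewrite -(deriveE _ dd) dE.
Qed.

Lemma Dphi_velocity t x : Dphi phi (A := A) t x (X x) = X (phi t x).
Proof.
have [dX dXE] := flow_transport (cdom_self A (phi t x)).
rewrite DphiE -dXE; have := hphi => -[_ _ _ _ /(_ x t)] [_ <-].
by [].
Qed.

Hypothesis hM : hausdorff_space M.

(** The velocity along the orbit is the image of [X x = 0] under the differential of the flow, so
    the coordinates are constant for short positive times. Every positive time is a multiple of a
    short one, and negative times follow by inversion. *)
Lemma sing_fixed x : X x = 0 -> forall t, phi t x = x.
Proof.
move=> x0.
have fx := cdom_self A x.
have [d d0 hd] : exists2 d : R, 0 < d & forall t : R, `|t| < d -> cdom A x (phi t x).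
  have : \forall s \near (0 : R), cdom A x (phi s x).
    by apply: near_flow_dom; rewrite flow0.
  move=> /nbhs_normP[d d0 h]; exists d => // t td; apply: h.
  by rewrite /ball_ /= sub0r normrN.
have small t : 0 <= t < d -> phi t x = x.
  move=> /andP[t0 td]; have dom s : 0 <= s <= t -> cdom A x (phi s x).
    by move=> /andP[s0 st]; apply: hd; rewrite ger0_norm// (le_lt_trans st).
  apply: (chart_inj (dom t _) fx); first by rewrite t0 lexx.
  apply/rowP => i; apply/eqP; rewrite -subr_eq0; apply/eqP.
  have H s : 0 <= s <= t -> is_derive s (1 : R) (fun s => chart A x (phi s x) 0 i) 0.
    move=> /dom /flow_transport/(is_derive_coord i).
    by rewrite x0 linear0 mxE.
  have [||c _] := @MVT_segment R (fun s => chart A x (phi s x) 0 i) (fun=> 0) 0 t t0.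
  - by move=> s; rewrite in_itv /= => /andP[/ltW s0 /ltW st]; apply: H; rewrite s0.
  - apply: derivable_within_continuous => s; rewrite in_itv /= => st.
    by have [] := H s st.
  by rewrite flow0 mul0r.
have mul t k : phi t x = x -> phi (t *+ k) x = x.
  by move=> h; elim: k => [|k IH]; rewrite ?mulr0n ?flow0// mulrS flowD IH.
have pos t : 0 <= t -> phi t x = x.
  move=> t0; pose k := (Num.bound (t / d)).+1.
  have kpos : 0 < k%:R :> R by rewrite ltr0n.
  have -> : t = (t / k%:R) *+ k by rewrite -mulr_natr divfK// gt_eqF.
  apply: mul; apply: small; rewrite divr_ge0 ?(ltW kpos)//=.
  rewrite ltr_pdivrMr// mulrC -ltr_pdivrMr//.
  apply: (lt_le_trans (archi_boundP _)); first by rewrite divr_ge0// ltW.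
  by rewrite ler_nat leqnSn.
move=> t; have [t0|t0] := leP 0 t; first exact: pos.
by rewrite -{1}(pos (- t)) ?flowKV// oppr_ge0 ltW.
Qed.

Lemma fixed_sing x : (forall t, phi t x = x) -> X x = 0.
Proof.
move=> fx; have := flow_velocity x.
have -> : (fun s => chart A x (phi s x)) = cst (chart A x x).
  by apply/funext => s; rewrite fx.
by move=> [_ <-]; rewrite derive_cst.
Qed.

(** Singularities are the common fixed points of all the maps [phi t], and fixed point sets are
    closed in a Hausdorff space. *)
Lemma closed_sing : closed (Sing X).
Proof.
have -> : Sing X = \bigcap_(t in [set: R]) [set x | phi t x = x].
  apply/seteqP; split=> x; first by move=> /sing_fixed h t _; apply: h.
  by move=> h; apply: fixed_sing => t; apply: h.
apply: closed_bigI => t _ x clx; apply: hM => B C xB xC.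
have H : nbhs x (C `&` phi t @^-1` B).
  by apply: filterI => //; exact: (flow_continuous xB).
have [z [/= fz [zC zB]]] := clx _ H.
by exists z; split=> //; rewrite -fz.
Qed.

End Flow.

(** * Local dynamics at a hyperbolic singularity *)

Section NormEquivalence.
Context {R : realType} {n : nat} {M : topologicalType} {A : smooth_atlas R n M}.
Variable g : riemannian_metric A.

Lemma tnorm_le_norm x : exists2 C, 0 < C & forall v, tnorm g x v <= C * `|v|.
Proof.
exists (\sum_(i < n) tnorm g x (delta_mx 0 i) + 1).
  by rewrite ltr_wpDl// sumr_ge0// => i _; exact: tnorm_ge0.
move=> v; rewrite mulrDl mul1r -[leLHS]addr0 lerD// {1}(row_sum_delta v).
have : forall s : seq 'I_n, tnorm g x (\sum_(i <- s) (v 0 i *: delta_mx 0 i)) <=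
    (\sum_(i <- s) tnorm g x (delta_mx 0 i)) * `|v|.
  elim=> [|i s IH]; first by rewrite !big_nil mul0r (N_0 (tnorm_is_norm g x)).
  rewrite !big_cons; apply: (le_trans (tnormD _ _ _ _)).
  rewrite mulrDl lerD// tnormZ mulrC ler_wpM2l ?tnorm_ge0//.
  exact: coord_le_norm.
by move=> /(_ (index_enum _)).
Qed.

Lemma norm_le_tnorm x : exists2 C, 0 < C & forall v : 'rV[R]_n, `|v| <= C * tnorm g x v.
Proof.
have /choice[C hC] : forall i : 'I_n, exists C : R, 0 <= C /\
    forall v : 'rV[R]_n, `|v 0 i| <= C * tnorm g x v.
  by move=> i; have [C C0 h] := tnorm_coord g x i; exists C.
have S0 : 0 <= \sum_i C i by apply: sumr_ge0 => i _; have [] := hC i.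
exists (\sum_i C i + 1); first by rewrite ltr_wpDl.
move=> v; apply: norm_le_coord; first by rewrite mulr_ge0 ?tnorm_ge0 ?addr_ge0.
move=> i; have [_ h] := hC i; apply: (le_trans (h v)).
rewrite ler_wpM2r ?tnorm_ge0// (bigD1 i)//= -addrA lerDl addr_ge0//.
by apply: sumr_ge0 => j _; have [] := hC j.
Qed.

Lemma tnorm_nbhs x (y0 : 'rV[R]_n) (d : R) : 0 < d ->
  \forall y \near y0, tnorm g x (y - y0) < d.
Proof.
move=> d0; have [C C0 h] := tnorm_le_norm x.
apply/nbhs_normP; exists (d / C); first by rewrite /= divr_gt0.
move=> y; rewrite /ball_ /= distrC => yd; apply: (le_lt_trans (h _)).
by rewrite mulrC -ltr_pdivlMr.
Qed.

Lemma nbhs_tnorm x (y0 : 'rV[R]_n) (U : set 'rV[R]_n) : nbhs y0 U ->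
  exists2 d : R, 0 < d & forall y, tnorm g x (y - y0) < d -> U y.
Proof.
move=> /nbhs_normP[d d0 h]; have [C C0 hC] := norm_le_tnorm x.
exists (d / C); first by rewrite divr_gt0.
move=> y yd; apply: h; rewrite /ball_ /= distrC.
by apply: (le_lt_trans (hC _)); rewrite mulrC -ltr_pdivlMr.
Qed.

End NormEquivalence.

(** * Cone estimates *)

Section ConeGrowth.
Context {R : realType}.
Implicit Types a b : nat -> R.

(* a and b are the unstable and stable norms of a difference, a' and b' those
   of its image. *)
Definition cone_step (a b a' b' : R) : Prop :=
  4 * a - (a + b) / 4 <= a' /\ b' <= b / 4 + (a + b) / 4.

Lemma cone_step_in (a b a' b' : R) : 0 <= b -> b <= a -> cone_step a b a' b' ->
  b' <= a' /\ 3 * a <= a'.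
Proof. by move=> b0 ba [h1 h2]; split; lra. Qed.

(** The cone [b <= a] is invariant and [a] at least triples in it at each step, so a bounded [a]
    must vanish. *)
Lemma cone_growth a b (d : R) : (forall k, 0 <= b k) -> b 0%N <= a 0%N ->
  (forall k, cone_step (a k) (b k) (a k.+1) (b k.+1)) ->
  (forall k, a k <= d) -> a 0%N = 0.
Proof.
move=> b0 ba step ad.
have H k : b k <= a k /\ 3 ^+ k * a 0%N <= a k.
  elim: k => [|k [IH1 IH2]]; first by rewrite expr0 mul1r.
  have [h1 h2] := cone_step_in (b0 k) IH1 (step k); split=> //.
  by rewrite exprS -mulrA; lra.
have a00 : 0 <= a 0%N by apply: le_trans ba.
apply/eqP/negPn/negP => an0.
have ap : 0 < a 0%N by rewrite lt_neqAle eq_sym an0.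
have := @expr_bounded_le1 R 3 (d / a 0%N) 0 => h.
have : (3 : R) <= 1; last by lra.
apply: h; first by lra.
by move=> k _; rewrite ler_pdivlMr//; have [_ h] := H k; apply: (le_trans h).
Qed.

(** If [b <= a] at time [0], forward growth applies. Otherwise the backward sequence never meets the
    cone, which forward steps preserve, and [b'] grows by a factor [4/3] at each backward step. *)
Lemma cone_isolating a b a' b' (d : R) :
  (forall k, 0 <= a k) -> (forall k, 0 <= b k) ->
  (forall k, 0 <= a' k) -> (forall k, 0 <= b' k) ->
  a 0%N = a' 0%N -> b 0%N = b' 0%N ->
  (forall k, cone_step (a k) (b k) (a k.+1) (b k.+1)) ->
  (forall k, cone_step (a' k.+1) (b' k.+1) (a' k) (b' k)) ->
  (forall k, a k <= d) -> (forall k, b' k <= d) ->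
  a 0%N = 0 /\ b 0%N = 0.
Proof.
move=> a0 b0 a'0 b'0 ea eb step step' ad b'd.
have [ba|ab] := leP (b 0%N) (a 0%N).
  have a00 := cone_growth b0 ba step ad; split=> //.
  by apply/eqP; rewrite eq_le b0 -a00 ba.
rewrite ea eb in ab.
have H k : a' k < b' k.
  elim: k => // k IH; rewrite ltNge; apply/negP => h.
  by have [] := cone_step_in (b'0 k.+1) h (step' k); lra.
have G k : (4/3) ^+ k * b' 0%N <= b' k.
  elim: k => [|k IH]; first by rewrite expr0 mul1r.
  by rewrite exprS -mulrA; have [_ h] := step' k; have := H k.+1; lra.
have bp : 0 < b' 0%N by apply: le_lt_trans (H 0%N).
have := @expr_bounded_le1 R (4/3) (d / b' 0%N) 0 => h.
have : (4/3 : R) <= 1; last by lra.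
apply: h; first by lra.
by move=> k _; rewrite ler_pdivlMr//; apply: (le_trans (G k)).
Qed.

End ConeGrowth.

Section LocalMap.
Context {R : realType} {n : nat} {M : topologicalType} {A : smooth_atlas R n M}.
Variables (g : riemannian_metric A) (X : M -> 'rV[R]_n) (phi : R -> M -> M).
Hypothesis hphi : is_flow (A := A) X phi.
Variables (sigma : M) (tau : R).
Hypothesis fixed : phi tau sigma = sigma.
Local Notation N := (tnorm g sigma).
Local Notation B := (linfun (Dphi phi (A := A) tau sigma)).
Local Notation c := (chart A sigma).
Variables (Es Eu : {vspace 'rV[R]_n}) (ps pu : 'End('rV[R]_n)).
Hypotheses (psE : forall v, ps v \in Es) (puE : forall v, pu v \in Eu).
Hypotheses (psu : forall v, v = ps v + pu v).
Hypotheses (psEs : {in Es, forall v, ps v = v}) (puEu : {in Eu, forall v, pu v = v}).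
Hypotheses (psEu : {in Eu, forall v, ps v = 0}) (puEs : {in Es, forall v, pu v = 0}).
Hypotheses (iEs : forall v, v \in Es -> B v \in Es) (iEu : forall v, v \in Eu -> B v \in Eu).
Hypotheses (BEs : forall v, v \in Es -> N (B v) <= 8^-1 * N v).
Hypotheses (BEu : forall v, v \in Eu -> N v <= 8^-1 * N (B v)).

Lemma flow_strict (e : R) : 0 < e -> exists2 d : R, 0 < d & forall z z',
  cdom A sigma z -> cdom A sigma z' -> N (c z - c sigma) < d -> N (c z' - c sigma) < d ->
  [/\ cdom A sigma (phi tau z), cdom A sigma (phi tau z') &
   N (c (phi tau z) - c (phi tau z') - B (c z - c z')) <= e * N (c z - c z')].
Proof.
move=> e0; have sdom := cdom_self A sigma.
have Un : nbhs (c sigma) (flow_chart_dom (A := A) phi tau sigma sigma).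
  by apply: (flow_chart_dom_nbhs hphi) => //; rewrite fixed.
have [C1 C10 h1] := tnorm_le_norm g sigma.
have [C2 C20 h2] := norm_le_tnorm g sigma.
have e1 : 0 < e / (C1 * C2) by rewrite divr_gt0 ?mulr_gt0.
have [d d0 hd] := Ck1_strict Un (flow_chart_Ck1 hphi tau sigma sigma) e1.
have Bn : \forall y \near c sigma, `|y - c sigma| < d.
  apply/nbhs_normP; exists d => // y.
  by rewrite /ball_ /= distrC.
have Vn : \forall y \near c sigma,
    flow_chart_dom (A := A) phi tau sigma sigma y /\ `|y - c sigma| < d.
  exact: filterI Un Bn.
have [d' d'0 hd'] := nbhs_tnorm g sigma Vn.
exists d' => // z z' zc zc' /hd'[[_ zd] zn] /hd'[[_ z'd] z'n].
rewrite !chartK// in zd z'd; split=> //.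
apply: (le_trans (h1 _)); have := hd _ _ zn z'n.
rewrite lfunE /flow_chart /= !chartK// /Dphi fixed => h.
apply: (@le_trans _ _ (C1 * (e / (C1 * C2) * (C2 * N (c z - c z'))))).
  rewrite ler_pM2l//; apply: (le_trans h).
  by rewrite ler_pM2l.
rewrite le_eqVlt; apply/orP; left; apply/eqP; field.
by rewrite !gt_eqF.
Qed.

(** After projection the nonlinear error is at most [(a + b) / 8]. Together with the linear rates
    [8] and [1/8] this leaves room for the weaker constants of [cone_step]. *)
Lemma local_map : exists2 d : R, 0 < d & forall z z',
  cdom A sigma z -> cdom A sigma z' -> N (c z - c sigma) < d -> N (c z' - c sigma) < d ->
  [/\ cdom A sigma (phi tau z), cdom A sigma (phi tau z') &
   let v := c z - c z' in let v' := c (phi tau z) - c (phi tau z') in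
   cone_step (N (pu v)) (N (ps v)) (N (pu v')) (N (ps v'))].
Proof.
have hN := tnorm_is_norm g sigma.
have [Ks Ks0 hKs] := N_bounded hN ps; have [Ku Ku0 hKu] := N_bounded hN pu.
have e0 : 0 < 8^-1 / (Ks + Ku) by rewrite divr_gt0 ?addr_gt0 ?invr_gt0.
have psB w : ps (B w) = B (ps w).
  have -> : B w = B (ps w) + B (pu w) by rewrite -homD -psu.
  by rewrite homD (psEs (iEs (psE w))) (psEu (iEu (puE w))) addr0.
have puB w : pu (B w) = B (pu w).
  have -> : B w = B (ps w) + B (pu w) by rewrite -homD -psu.
  by rewrite homD (puEs (iEs (psE w))) add0r (puEu (iEu (puE w))).
have [d d0 hd] := flow_strict e0; exists d => // z z' zc zc' zd zd'.
have [h1 h2 h3] := hd _ _ zc zc' zd zd'; split=> //=.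
set v := c z - c z' in h3 *; set v' := c (phi tau z) - c (phi tau z') in h3 *.
have NvE : N v <= N (ps v) + N (pu v) by rewrite {1}(psu v); apply: (ND hN).
have dif (p : 'End('rV[R]_n)) K : 0 < K -> K <= Ks + Ku ->
    (forall v, N (p v) <= K * N v) -> N (p (v' - B v)) <= 8^-1 * (N (ps v) + N (pu v)).
  move=> K0 KK hK; apply: (le_trans (hK _)).
  apply: (@le_trans _ _ ((Ks + Ku) * (8^-1 / (Ks + Ku) * N v))).
    by rewrite ler_pM ?(N_ge0 hN) ?(ltW K0).
  have -> : (Ks + Ku) * (8^-1 / (Ks + Ku) * N v) = 8^-1 * N v.
    by field; rewrite gt_eqF ?addr_gt0.
  by rewrite ler_wpM2l ?invr_ge0.
have ds := dif ps Ks Ks0 (ltac:(lra)) hKs; have du := dif pu Ku Ku0 (ltac:(lra)) hKu.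
rewrite homB psB in ds; rewrite homB puB in du.
have k1 := BEs (psE v); have k2 := BEu (puE v).
have l1 := N_dist hN (ps v') (B (ps v)).
have l2 := N_dist hN (B (pu v)) (pu v').
have l3 : N (B (pu v) - pu v') = N (pu v' - B (pu v)) by rewrite -(N_opp hN) opprB.
have := N_ge0 hN (ps v); have := N_ge0 hN (pu v).
split; lra.
Qed.

End LocalMap.

Section HyperbolicSplitting.
Context {R : realType} {V : vectType R} (N : V -> R) (hN : is_norm N).
Variables (F : R -> 'End(V)) (hA : is_group F) (Es Eu : {vspace V}).
Hypotheses (iEu : stable_by F Eu) (EE : complementary Es Eu).
Hypotheses (cEs : contracts N F Es) (cEu : contracts N (reversed F) Eu).

Lemma hyperbolic_time : exists tau : R, [/\ 0 < tau,
  forall v, v \in Es -> N (F tau v) <= 8^-1 * N v &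
  forall v, v \in Eu -> N v <= 8^-1 * N (F tau v)].
Proof.
have e8 : 0 < 8^-1 :> R by rewrite invr_gt0.
case: cEs => eta [T [eta0 T0 h]]; case: cEu => eta' [T' [eta'0 T'0 h']].
have [T1 h1] := expR_negl eta0 e8; have [T2 h2] := expR_negl eta'0 e8.
pose tau := Num.max (Num.max T T') (Num.max T1 T2) + 1.
have /and4P[tT tT' t1 t2] : [&& T < tau, T' < tau, T1 < tau & T2 < tau].
  have : Num.max (Num.max T T') (Num.max T1 T2) < tau by rewrite ltrDl ltr01.
  by rewrite !gt_max => /andP[/andP[-> ->] /andP[-> ->]].
exists tau; split; first exact: lt_trans tT.
  move=> v vE; apply: (le_trans (h _ _ tT vE)); rewrite ler_wpM2r ?(N_ge0 hN)//.
  by have := h1 _ t1; rewrite mulr1.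
move=> v vE; have := h' _ _ tT' (iEu tau vE).
rewrite /reversed (AK hA) => /le_trans; apply.
rewrite ler_wpM2r ?(N_ge0 hN)//.
by have := h2 _ t2; rewrite mulr1.
Qed.

Lemma splitting_projections : exists ps pu : 'End(V),
  [/\ (forall v, ps v \in Es), (forall v, pu v \in Eu), (forall v, v = ps v + pu v),
     {in Es, forall v, ps v = v} /\ {in Eu, forall v, ps v = 0} &
     {in Eu, forall v, pu v = v} /\ {in Es, forall v, pu v = 0}].
Proof.
have [ps [ps1 ps0]] := complementary_proj EE.
have [pu [pu1 pu0]] := complementary_proj (complementaryC EE).
have dec v : exists a b, [/\ a \in Es, b \in Eu, v = a + b, ps v = a & pu v = b].
  have [a [b [aE bE ->]]] := complementaryP v EE.
  exists a, b; split=> //; rewrite homD.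
    by rewrite (ps1 _ aE) (ps0 _ bE) addr0.
  by rewrite (pu0 _ aE) (pu1 _ bE) add0r.
exists ps, pu; split=> // v; have [a [b [aE bE e ea eb]]] := dec v.
- by rewrite ea.
- by rewrite eb.
- by rewrite ea eb.
Qed.

End HyperbolicSplitting.

Section Singularity.
Context {R : realType} {n : nat} {M : topologicalType} {A : smooth_atlas R n M}.
Variables (g : riemannian_metric A) (X : M -> 'rV[R]_n) (phi : R -> M -> M).
Hypothesis hphi : is_flow (A := A) X phi.
Variable sigma : M.
Hypothesis sing : X sigma = 0.

Definition sing_flow (t : R) : 'End('rV[R]_n) := linfun (Dphi phi (A := A) t sigma).

Lemma sing_flowE t v : sing_flow t v = Dphi phi (A := A) t sigma v.
Proof. by rewrite lfunE. Qed.

Let fixed t : phi t sigma = sigma := sing_fixed hphi sing t.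

Lemma sing_flow_group : is_group sing_flow.
Proof.
have sdom := cdom_self A sigma.
have dF t : differentiable (flow_chart (A := A) phi t sigma sigma) (chart A sigma sigma).
  by apply: (flow_chart_differentiable hphi); rewrite // fixed.
have E t v : sing_flow t v = 'd (flow_chart (A := A) phi t sigma sigma) (chart A sigma sigma) v.
  by rewrite sing_flowE /Dphi fixed.
have F0 t : flow_chart (A := A) phi t sigma sigma (chart A sigma sigma) = chart A sigma sigma.
  by rewrite /flow_chart /= chartK// fixed.
split=> [v|s t v].
  rewrite E; have [_ ->] : differentiable (flow_chart (A := A) phi 0 sigma sigma) (chart A sigma sigma) /\
     'd (flow_chart (A := A) phi 0 sigma sigma) (chart A sigma sigma) =
     'd (id : 'rV[R]_n -> 'rV[R]_n) (chart A sigma sigma) :> ('rV[R]_n -> 'rV[R]_n).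
    apply: near_diff => //; apply: filterS (cimg_nbhs (cimg_chart sdom)) => y yc.
    by rewrite /flow_chart /= (flow0 hphi) cinvK.
  by have [_ ->] := is_diff_id (chart A sigma sigma).
have dc : differentiable (flow_chart (A := A) phi s sigma sigma \o
    flow_chart (A := A) phi t sigma sigma) (chart A sigma sigma).
  by apply: differentiable_comp => //; rewrite F0.
have [_ e] : differentiable (flow_chart (A := A) phi (s + t) sigma sigma) (chart A sigma sigma) /\
     'd (flow_chart (A := A) phi (s + t) sigma sigma) (chart A sigma sigma) =
     'd (flow_chart (A := A) phi s sigma sigma \o
    flow_chart (A := A) phi t sigma sigma) (chart A sigma sigma) :> ('rV[R]_n -> 'rV[R]_n).
  apply: near_diff => //.
  have Un := flow_chart_dom_nbhs hphi (A := A) (t := t) (q := sigma) sdom.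
  rewrite fixed in Un; apply: filterS (Un sdom) => y [yc yd].
  by rewrite /flow_chart /= chartK// (flowD hphi).
have dFs : differentiable (flow_chart (A := A) phi s sigma sigma)
    (flow_chart (A := A) phi t sigma sigma (chart A sigma sigma)) by rewrite F0.
have e2 := diff_comp (dF t) dFs.
transitivity ('d (flow_chart (A := A) phi s sigma sigma) (chart A sigma sigma)
  ('d (flow_chart (A := A) phi t sigma sigma) (chart A sigma sigma) v)); last first.
  by symmetry; apply: (etrans (E s _)); congr ('d _ _ _); exact: E.
apply: (etrans (E _ v)); apply: (etrans (congr1 (fun f => f v) e)).
by apply: (etrans (congr1 (fun f => f v) e2)); rewrite /= F0.
Qed.

Local Notation N := (tnorm g sigma).
Local Notation c := (chart A sigma).
Variables (Es Eu : {vspace 'rV[R]_n}).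
Hypotheses (iEs : stable_by sing_flow Es) (iEu : stable_by sing_flow Eu).
Hypothesis EE : complementary Es Eu.
Hypotheses (cEs : contracts N sing_flow Es) (cEu : contracts N (reversed sing_flow) Eu).

Lemma local_cone : exists (tau : R) (ps pu : 'End('rV[R]_n)),
  [/\ 0 < tau,
     [/\ (forall v, ps v \in Es), (forall v, pu v \in Eu), (forall v, v = ps v + pu v),
        {in Es, forall v, ps v = v} /\ {in Eu, forall v, ps v = 0} &
        {in Eu, forall v, pu v = v} /\ {in Es, forall v, pu v = 0}] &
     exists2 d : R, 0 < d & forall z z', cdom A sigma z -> cdom A sigma z' ->
        N (c z - c sigma) < d -> N (c z' - c sigma) < d ->
        [/\ cdom A sigma (phi tau z), cdom A sigma (phi tau z') &
         let v := c z - c z' in let v' := c (phi tau z) - c (phi tau z') in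
         cone_step (N (pu v)) (N (ps v)) (N (pu v')) (N (ps v'))]].
Proof.
have [tau [tau0 h1 h2]] := hyperbolic_time (tnorm_is_norm g sigma) sing_flow_group iEu cEs cEu.
have [ps [pu [p1 p2 p3 [p4 p5] [p6 p7]]]] := splitting_projections EE.
exists tau, ps, pu; split=> //.
by apply: (local_map hphi (fixed tau) p1 p2 p3 p4 p6 p5 p7 (iEs tau) (iEu tau) h1 h2).
Qed.

(** [sigma] is itself an orbit, so the cone estimates apply to the differences with [sigma]; staying
    close to it in both time directions makes both components vanish. *)
Lemma sing_isolating : exists2 U, nbhs sigma U & exists2 tau : R, 0 < tau &
  forall x, (forall k : nat, U (phi (tau *+ k) x) /\ U (phi (- (tau *+ k)) x)) ->
    x = sigma.
Proof.
have hN := tnorm_is_norm g sigma; have sdom := cdom_self A sigma.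
have [tau [ps [pu [tau0 [p1 p2 p3 _ _] [d d0 hd]]]]] := local_cone.
pose U := cdom A sigma `&` [set z | N (c z - c sigma) < d].
exists U.
  apply: filterI; first exact: cdom_nbhs.
  exact: (chart_nbhs (U := [set y | N (y - c sigma) < d]) sdom (tnorm_nbhs _ _ _ d0)).
exists tau => // x hU.
have Us : U sigma by split=> //=; rewrite subrr (N_0 hN).
pose a k := N (pu (c (phi (tau *+ k) x) - c sigma)).
pose b k := N (ps (c (phi (tau *+ k) x) - c sigma)).
pose a' k := N (pu (c (phi (- (tau *+ k)) x) - c sigma)).
pose b' k := N (ps (c (phi (- (tau *+ k)) x) - c sigma)).
have step z : U z -> cone_step (N (pu (c z - c sigma))) (N (ps (c z - c sigma)))
    (N (pu (c (phi tau z) - c sigma))) (N (ps (c (phi tau z) - c sigma))).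
  by move=> [z1 z2]; have [_ _] := hd z sigma z1 sdom z2 Us.2; rewrite fixed.
have [Ks Ks0 hKs] := N_bounded hN ps; have [Ku Ku0 hKu] := N_bounded hN pu.
have bnd (p : 'End('rV[R]_n)) K z : 0 < K -> K <= Ks + Ku ->
    (forall v, N (p v) <= K * N v) -> U z -> N (p (c z - c sigma)) <= (Ks + Ku) * d.
  move=> K0 KK hK [_ zd]; apply: (le_trans (hK _)).
  by rewrite ler_pM ?(N_ge0 hN) ?(ltW K0)//; exact: ltW.
have KsK : Ks <= Ks + Ku by lra.
have KuK : Ku <= Ks + Ku by lra.
have [||||||||||a0 b0] := @cone_isolating R a b a' b' ((Ks + Ku) * d).
- by move=> k; exact: tnorm_ge0.
- by move=> k; exact: tnorm_ge0.
- by move=> k; exact: tnorm_ge0.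
- by move=> k; exact: tnorm_ge0.
- by rewrite /a /a' mulr0n oppr0.
- by rewrite /b /b' mulr0n oppr0.
- by move=> k; have := step _ (hU k).1; rewrite -(flowD hphi) -mulrS.
- move=> k; have := step _ (hU k.+1).2; rewrite -(flowD hphi).
  have -> : tau - tau *+ k.+1 = - (tau *+ k) by rewrite mulrS opprD addrA subrr add0r.
  exact.
- by move=> k; apply: (bnd pu Ku) => //; exact: (hU k).1.
- by move=> k; apply: (bnd ps Ks) => //; exact: (hU k).2.
have [[xd _] _] := hU 0%N; rewrite mulr0n (flow0 hphi) in xd.
apply: (chart_inj xd sdom); apply/eqP; rewrite -subr_eq0; apply/eqP.
rewrite [LHS]p3; move: a0 b0; rewrite /a /b mulr0n (flow0 hphi).
by move=> /(N_eq0 hN)-> /(N_eq0 hN)->; rewrite addr0.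
Qed.

End Singularity.

(** Let [v] minimize [|w - G v|] on the ball. The corrected point [v + (w - G v)] is still in the
    ball and has at most half the error of [v], so this error is [0]. *)
Lemma near_identity_surj (R : realType) (d : nat) (G : 'rV[R]_d -> 'rV[R]_d) (r : R) :
  0 < r -> G 0 = 0 ->
  (forall v v', `|v| <= r -> `|v'| <= r -> `|G v - G v' - (v - v')| <= 2^-1 * `|v - v'|) ->
  forall w, `|w| <= r / 2 -> exists v, [/\ `|v| <= r, `|v| <= 2 * `|w| & G v = w].
Proof.
move=> r0 G0 hG w wr; pose B : set 'rV[R]_d := [set v | `|v| <= r].
have cB : compact B.
  apply: bounded_closed_compact.
    exists r; split=> [|x rx v /= vr]; first exact: num_real.
    by apply: (le_trans vr); exact: ltW.
  rewrite (_ : B = (fun v : 'rV[R]_d => `|v|) @^-1` [set x | x <= r])//.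
  by apply: closed_comp; [move=> v _; exact: norm_continuous|exact: closed_le].
have lip v v' : `|v| <= r -> `|v'| <= r -> `|G v - G v'| <= 2 * `|v - v'|.
  move=> vr v'r; have := hG _ _ vr v'r.
  have := ler_normD (G v - G v' - (v - v')) (v - v'); rewrite subrK.
  by have := normr_ge0 (v - v'); lra.
have [||v vB vmin] := @EVT_min_rV R d (fun v => `|w - G v|) B _ cB.
- by exists 0; rewrite /B /= normr0 ltW.
- apply/subspace_continuousP => v vB; apply/cvgrPdist_lt => e e0.
  have near_v : \forall v' \near v, `|v - v'| < e / 2.
    by apply/nbhs_normP; exists (e / 2); first by rewrite /= divr_gt0.
  have : \forall v' \near within B (nbhs v), B v' /\ `|v - v'| < e / 2.
    apply: filterI; first exact: withinT.
    exact: (@cvg_within _ (nbhs v) _ _ _ near_v).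
  apply: filterS => v' [v'B vv'].
  rewrite distrC; apply: le_lt_trans (ler_dist_dist _ _) _.
  rewrite opprB [X in `|X|]addrC addrA subrK.
  by apply: (le_lt_trans (lip _ _ vB v'B)); rewrite mulrC -ltr_pdivlMr.
have vr : `|v| <= r by move: vB; rewrite inE.
have d1 : `|v - G v| <= 2^-1 * `|v|.
  by have := hG v 0 vr; rewrite normr0 G0 !subr0 distrC; apply; exact: ltW.
pose v' := v + (w - G v).
have v'r : `|v'| <= r.
  have -> : v' = (v - G v) + w by rewrite /v' addrCA addrC.
  by have := ler_normD (v - G v) w; lra.
have Gv : G v = w.
  have := vmin v'; rewrite inE => /(_ v'r).
  have := hG _ _ v'r vr.
  have -> : v' - v = w - G v by rewrite /v' addrAC subrr add0r.
  have -> : G v' - G v - (w - G v) = - (w - G v').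
    by rewrite opprB opprB addrA subrK.
  rewrite normrN => h1 h2; apply/eqP; rewrite eq_sym -subr_eq0 -normr_eq0.
  by have := normr_ge0 (w - G v); rewrite eq_le; lra.
exists v; split=> //.
have := ler_normD (v - G v) (G v); rewrite subrK; have : `|G v| = `|w| by rewrite Gv.
lra.
Qed.

Lemma hom_bounded (R : realType) (m k : nat) (f : 'Hom('rV[R]_m, 'rV[R]_k)) :
  exists2 C : R, 0 < C & forall v, `|f v| <= C * `|v|.
Proof.
exists (\sum_(i < m) `|f (delta_mx 0 i)| + 1); first by rewrite ltr_wpDl// sumr_ge0.
move=> v; rewrite mulrDl mul1r -[leLHS]addr0 lerD// {1}(row_sum_delta v) linear_sum /=.
apply: (le_trans (ler_norm_sum _ _ _)); rewrite mulr_suml; apply: ler_sum => i _.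
by rewrite homZ normrZ mulrC ler_wpM2l ?coord_le_norm.
Qed.

(** * Stable discs absorb the orbits converging to the singularity *)

Section StableDisc.
Context {R : realType} {n : nat} {M : topologicalType} {A : smooth_atlas R n M}.
Variables (g : riemannian_metric A) (X : M -> 'rV[R]_n) (phi : R -> M -> M).
Hypothesis hphi : is_flow (A := A) X phi.
Variable sigma : M.
Hypothesis sing : X sigma = 0.
Local Notation N := (tnorm g sigma).
Local Notation c := (chart A sigma).

Lemma nbhs_chart (W : set M) : nbhs sigma W -> exists2 d : R, 0 < d &
  forall z, cdom A sigma z -> N (c z - c sigma) < d -> W z.
Proof.
move=> Wn; have /(nbhs_tnorm g sigma)[d d0 h] := cinv_nbhs (cdom_self A sigma) Wn.
by exists d => // z zc zd; have := h _ zd; rewrite chartK.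
Qed.

Lemma chart_ball_nbhs (d : R) : 0 < d ->
  \forall z \near sigma, cdom A sigma z /\ N (c z - c sigma) < d.
Proof.
move=> d0; have sdom := cdom_self A sigma; apply: filterI; first exact: cdom_nbhs.
exact: (chart_nbhs (U := [set y | N (y - c sigma) < d]) sdom (tnorm_nbhs _ _ _ d0)).
Qed.

Variables (Es Eu : {vspace 'rV[R]_n}).
Local Notation F := (sing_flow (A := A) phi sigma).
Hypotheses (iEs : stable_by F Es) (iEu : stable_by F Eu).
Hypothesis EE : complementary Es Eu.
Hypotheses (cEs : contracts N F Es) (cEu : contracts N (reversed F) Eu).

Section Disc.
Variables (D : set M) (i : 'rV[R]_(\dim Es) -> M).
Hypotheses (i0 : i 0 = sigma) (iC : continuous i).
Hypothesis iCk : Ck 1 (i @^-1` cdom A sigma) (c \o i).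
Hypothesis iemb : forall B, nbhs (0 : 'rV[R]_(\dim Es)) B ->
  exists2 C, nbhs sigma C & i @^-1` C `<=` B.
Hypothesis dinj : injective ('d (c \o i) (0 : 'rV[R]_(\dim Es))).
Hypothesis dimg : limg (linfun ('d (c \o i) (0 : 'rV[R]_(\dim Es)))) = Es.

Let hN := tnorm_is_norm g sigma.

(** The stable projection of the disc, followed by the inverse of [J], is a map of the parameters
    close to the identity, hence onto a neighborhood of [0]: the disc is parametrized by its stable
    coordinate. Tangency to [Es] keeps the unstable coordinate below the stable one. *)
Lemma disc_chart (ps pu : 'End('rV[R]_n)) :
  (forall v, ps v \in Es) -> {in Es, forall v, ps v = v} ->
  {in Es, forall v, pu v = 0} ->
  exists r d : R, [/\ 0 < r, 0 < d,
    forall v, `|v| < r -> cdom A sigma (i v) /\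
      N (pu (c (i v) - c sigma)) <= N (ps (c (i v) - c sigma)) &
    forall y, N (ps y) < d -> exists2 v, `|v| < r & ps (c (i v) - c sigma) = ps y].
Proof.
move=> psE psEs puEs.
pose J := linfun ('d (c \o i) (0 : 'rV[R]_(\dim Es))).
have JE v : J v = 'd (c \o i) (0 : 'rV[R]_(\dim Es)) v by rewrite lfunE.
have J0 : lker J == 0%VS by apply/lker0P => v w; rewrite !JE; exact: dinj.
have JEs v : J v \in Es by rewrite -[in X in _ \in X]dimg memv_img ?memvf.
pose K y := (J^-1)%VF (ps y).
have KJ v : K (J v) = v by rewrite /K (psEs _ (JEs v)) lker0_lfunK.
have JK y : J (K y) = ps y by rewrite /K limg_lfunVK// dimg psE.
have KB y z : K (y - z) = K y - K z by rewrite /K !homB.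
have Kps y : K (ps y) = K y by rewrite /K (psEs _ (psE y)).
have [C1 C10 hC1] := hom_bounded (J^-1)%VF.
have [C2 C20 hC2] := norm_le_tnorm g sigma.
have [C3 C30 hC3] := tnorm_le_norm g sigma.
have [Ks Ks0 hKs] := N_bounded hN ps; have [Ku Ku0 hKu] := N_bounded hN pu.
pose CK := C1 * C2; have CK0 : 0 < CK by rewrite mulr_gt0.
have hK y : `|K y| <= CK * N (ps y).
  by apply: (le_trans (hC1 _)); rewrite -mulrA ler_pM2l.
(* Chosen so that [CK * Ks * e <= 1/2], for the near-identity estimate, and [2 * CK * Ku * e <= 1],
   for the cone condition. *)
pose e := (2 * CK * (Ks + Ku))^-1.
have e0 : 0 < e by rewrite invr_gt0 !mulr_gt0 ?addr_gt0.
have Un : nbhs (0 : 'rV[R]_(\dim Es)) (i @^-1` cdom A sigma).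
  by apply: iC; rewrite i0; apply: cdom_nbhs; exact: cdom_self.
have [r1 r10 hr1] := Ck1_strict Un iCk (divr_gt0 e0 C30).
have [r2 r20 hr2] : exists2 r2 : R, 0 < r2 & forall v, `|v| < r2 -> cdom A sigma (i v).
  have /nbhs_normP[r2 r20 h] := Un; exists r2 => // v vr; apply: h.
  by rewrite /ball_ /= sub0r normrN.
have strict v v' : `|v| < r1 -> `|v'| < r1 ->
    N (c (i v) - c (i v') - J (v - v')) <= e * `|v - v'|.
  move=> vr v'r; apply: (le_trans (hC3 _)); rewrite JE.
  have := hr1 v v'; rewrite !subr0 => /(_ vr v'r) h.
  rewrite -ler_pdivlMl// mulrA mulrC mulrA; apply: (le_trans h).
  by rewrite mulrAC [leRHS]mulrC mulrA.
pose r := Num.min r1 r2.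
have r0 : 0 < r by rewrite lt_min r10.
have Kstrict v v' : `|v| < r -> `|v'| < r ->
    `|K (c (i v) - c (i v')) - (v - v')| <= 2^-1 * `|v - v'|.
  rewrite !lt_min => /andP[vr _] /andP[v'r _].
  rewrite -[X in _ - X](KJ (v - v')) -KB; apply: (le_trans (hK _)).
  apply: (@le_trans _ _ (CK * (Ks * (e * `|v - v'|)))).
    rewrite ler_pM2l//; apply: (le_trans (hKs _)).
    by rewrite ler_pM2l//; exact: strict.
  rewrite !mulrA ler_wpM2r// /e.
  rewrite -[leRHS]mul1r ler_pdivrMr ?mulr_gt0 ?addr_gt0//.
  have := mulr_gt0 CK0 Ku0; have := mulr_gt0 CK0 Ks0; lra.
exists r, (r / (4 * CK)); split=> //.
- by rewrite divr_gt0 ?mulr_gt0.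
- move=> v vr; have := vr; rewrite lt_min => /andP[vr1 vr2].
  split; first exact: hr2.
  have z0 : `|0 : 'rV[R]_(\dim Es)| < r1 by rewrite normr0.
  have zr : `|0 : 'rV[R]_(\dim Es)| < r by rewrite normr0.
  set xi := c (i v) - c sigma.
  have h1 : N (xi - J v) <= e * `|v|.
    by have := strict v 0 vr1 z0; rewrite subr0 i0.
  have h2 : `|v| <= 2 * (CK * N (ps xi)).
    have := Kstrict v 0 vr zr; rewrite subr0 i0 -/xi => h2.
    have := hK xi; have := ler_distD 0 (K xi) v; have := ler_normB (K xi) (K xi - v).
    by rewrite subKr; lra.
  have h3 : pu xi = pu (xi - J v) by rewrite [RHS]homB (puEs _ (JEs v)) subr0.
  rewrite h3; apply: (le_trans (hKu _)).
  apply: (@le_trans _ _ (Ku * (e * (2 * (CK * N (ps xi)))))).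
    rewrite ler_pM2l//; apply: (le_trans h1); by rewrite ler_pM2l.
  have -> : Ku * (e * (2 * (CK * N (ps xi)))) = Ku / (Ks + Ku) * N (ps xi).
    by rewrite /e; field; rewrite !gt_eqF ?addr_gt0.
  rewrite ler_piMl ?(N_ge0 hN)// ler_pdivrMr ?addr_gt0// mul1r; lra.
move=> y yd.
pose G v := K (c (i v) - c sigma).
have r4 : 0 < r / 2 by rewrite divr_gt0.
have rr v : `|v| <= r / 2 -> `|v| < r by move=> /le_lt_trans; apply; lra.
have [|||v [v1 _ v2]] := @near_identity_surj R (\dim Es) G (r / 2) r4 _ _ (K y).
- by rewrite /G i0 subrr /K linear0 linear0.
- move=> v v' /rr vr /rr v'r; rewrite /G -KB opprB addrA subrK.
  exact: Kstrict.
- apply: (le_trans (hK _)); rewrite ltr_pdivlMr ?mulr_gt0// in yd; lra.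
exists v; first exact: rr.
by rewrite -[LHS]JK -/(G v) v2 JK.
Qed.

Hypothesis Drange : D = range i.
Hypothesis Dinv : forall x, D x -> forall t, 0 <= t -> D (phi t x).

(* Once the orbit of x stays near sigma, compare it with the orbit of the point
   of D having the same stable coordinate. Their difference lies in the
   unstable cone, so that it would grow exponentially if it were nonzero. *)
Lemma disc_absorbs x : phi t x @[t --> +oo] --> sigma ->
  exists2 t, 0 <= t & D (phi t x).
Proof.
move=> xs; have fixed t : phi t sigma = sigma := sing_fixed hphi sing t.
have sdom := cdom_self A sigma.
have [tau [ps [pu [tau0 [p1 p2 p3 [p4 p5] [p6 p7]] [d d0 hd]]]]] :=
  local_cone hphi sing iEs iEu EE cEs cEu.
have [r [d' [r0 d'0 hr hd']]] := disc_chart p1 p4 p7.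
have [Ks Ks0 hKs] := N_bounded hN ps; have [Ku Ku0 hKu] := N_bounded hN pu.
have Ndec y : N y <= N (pu y) + N (ps y).
  by rewrite {1}(p3 y) [leRHS]addrC; apply: (ND hN).
have near0 : \forall v \near (0 : 'rV[R]_(\dim Es)), `|v| < r.
  by apply/nbhs_normP; exists r => // v; rewrite /ball_ /= sub0r normrN.
(* As [i] is an embedding, points of the disc close to [sigma] have parameters below [r], so the
   cone condition of [disc_chart] holds again after one step. *)
have [C Cn hC] := iemb near0.
have [d1 d10 hd1] : exists2 d1 : R, 0 < d1 & forall z, cdom A sigma z ->
    N (c z - c sigma) < d1 -> C (phi tau z).
  apply: (nbhs_chart (W := phi tau @^-1` C)).
  have Cn' : nbhs (phi tau sigma) C by rewrite fixed.
  exact: (flow_continuous hphi Cn').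
(* A point that is [good] in the sense below is within [2 * rho] of [sigma], hence within both
   thresholds [d] and [d1]. *)
pose rho := Num.min d d1 / 4.
have rho0 : 0 < rho by rewrite divr_gt0// lt_min d0.
have [rd rd1] : 4 * rho <= d /\ 4 * rho <= d1.
  have -> : 4 * rho = Num.min d d1 by rewrite /rho; field.
  by rewrite !ge_min !lexx orbT.
pose good z := [/\ D z, cdom A sigma z, N (pu (c z - c sigma)) <= N (ps (c z - c sigma)) &
  N (ps (c z - c sigma)) <= rho].
have goodN z : good z -> N (c z - c sigma) < d /\ N (c z - c sigma) < d1.
  by move=> [_ _ h1 h2]; have := Ndec (c z - c sigma); split; lra.
have sg : N (c sigma - c sigma) < d by rewrite subrr (N_0 hN).
have good_step z : good z -> good (phi tau z).
  move=> gz; have [Dz zc h1 h2] := gz; have [zd zd1] := goodN _ gz.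
  have Dz' : D (phi tau z) by apply: Dinv => //; exact: ltW.
  have [zc' _] := hd _ _ zc sdom zd sg; rewrite fixed => -[_ h4].
  have Cz := hd1 _ zc zd1; move: (Dz'); rewrite Drange => -[v _ vz].
  have [_ h5] := hr v (hC v (ltac:(by rewrite /= vz))).
  rewrite vz in h5; split=> //.
  have := N_ge0 hN (ps (c z - c sigma)); lra.
pose r3 := Num.min d (Num.min rho d' / Ks).
have r30 : 0 < r3 by rewrite lt_min d0 divr_gt0// lt_min rho0.
have [T hT] : exists T, forall t, T < t -> cdom A sigma (phi t x) /\
    N (c (phi t x) - c sigma) < r3.
  have [T [_ hT]] := xs _ (chart_ball_nbhs r30); exists T => t tT.
  exact: hT.
have [k0 hk0] : exists k0 : nat, forall k, T < tau *+ (k0 + k).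
  have [m hm] : exists m : nat, T / tau < m%:R.
    exists (Num.bound `|T / tau|); apply: le_lt_trans (ler_norm _) _.
    exact: archi_boundP.
  exists m => k; rewrite -mulr_natr -ltr_pdivrMl// mulrC.
  by apply: (lt_le_trans hm); rewrite ler_nat leq_addr.
pose xk k := phi (tau *+ (k0 + k)) x.
have xkP k : [/\ cdom A sigma (xk k), N (c (xk k) - c sigma) < d &
    N (ps (c (xk k) - c sigma)) < Num.min rho d'].
  have [h1 h2] := hT _ (hk0 k); split=> //.
    by apply: (lt_le_trans h2); rewrite ge_min lexx.
  apply: (le_lt_trans (hKs _)); rewrite mulrC -ltr_pdivlMr//.
  by apply: (lt_le_trans h2); rewrite ge_min lexx orbT.
have [_ _ x0] := xkP 0%N; move: x0; rewrite lt_min => /andP[x0r x0d].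
have [v vr vE] := hd' _ x0d; have [vc vcone] := hr v vr.
pose zk k := phi (tau *+ k) (i v).
have gz k : good (zk k).
  elim: k => [|k IH]; last by rewrite /zk mulrS (flowD hphi); exact: good_step.
  rewrite /zk mulr0n (flow0 hphi); split=> //; last by rewrite vE ltW.
  by rewrite Drange; exists v.
pose a k := N (pu (c (xk k) - c (zk k))); pose b k := N (ps (c (xk k) - c (zk k))).
have b0 : b 0%N = 0.
  rewrite /b /zk mulr0n (flow0 hphi).
  have -> : c (xk 0%N) - c (i v) = (c (xk 0%N) - c sigma) - (c (i v) - c sigma).
    by rewrite opprB addrA subrK.
  by rewrite homB vE subrr (N_0 hN).
have a0 : a 0%N = 0.
  apply: (@cone_growth R a b (Ku * (2 * d))).
  - by move=> k; exact: tnorm_ge0.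
  - by rewrite b0; exact: tnorm_ge0.
  - move=> k; have [xc xd _] := xkP k; have [zd _] := goodN _ (gz k).
    have [_ zc _ _] := gz k; have [_ _] := hd _ _ xc zc xd zd.
    by rewrite /a /b /xk /zk addnS !mulrS !(flowD hphi).
  - move=> k; apply: (le_trans (hKu _)); rewrite ler_pM2l//.
    have [_ xd _] := xkP k; have [zd _] := goodN _ (gz k).
    have -> : c (xk k) - c (zk k) = (c (xk k) - c sigma) - (c (zk k) - c sigma).
      by rewrite opprB addrA subrK.
    by have := NB hN (c (xk k) - c sigma) (c (zk k) - c sigma); lra.
exists (tau *+ k0); first by rewrite mulrn_wge0// ltW.
have <- : i v = phi (tau *+ k0) x.
  have [xc _ _] := xkP 0%N; rewrite -[k0]addn0 -/(xk 0%N).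
  apply: (chart_inj vc xc); apply/eqP; rewrite eq_sym -subr_eq0; apply/eqP.
  rewrite [LHS]p3; move: a0 b0; rewrite /a /b /zk mulr0n (flow0 hphi).
  by move=> /(N_eq0 hN)-> /(N_eq0 hN)->; rewrite addr0.
by rewrite Drange; exists v.
Qed.

End Disc.

Lemma stable_disc_absorbs D x : local_strong_manifold (A := A) phi sigma Es D ->
  phi t x @[t --> +oo] --> sigma -> exists2 t, 0 <= t & D (phi t x).
Proof.
move=> [i [[Dr i0] [iC iCk] [_ iemb] [dinj dimg] Dinv]].
apply: (@disc_absorbs D i i0 iC (iCk sigma)) => //.
- by move=> B /iemb; rewrite i0.
- by have := dinj 0; rewrite i0.
- by move=> y /Dinv[].
Qed.

End StableDisc.

Lemma sing_flow_linfun (R : realType) (n : nat) (M : topologicalType)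
    (A : smooth_atlas R n M) (phi : R -> M -> M) (sigma : M) (t : R) :
  linfun (Dphi phi (A := A) t sigma) = sing_flow (A := A) phi sigma t.
Proof. by []. Qed.

Lemma le_at_eq (T : Type) (R : realType) (N : T -> R) (x y : T) (c : R) :
  x = y -> N x <= c -> N y <= c.
Proof. by move->. Qed.

(** * Dominated splittings and the center space at a singularity *)

Section OpnormProduct.
Context {R : realType} {n : nat} {M : topologicalType} {A : smooth_atlas R n M}.
Variable g : riemannian_metric A.
Context {Z : topologicalType} (F : linear_flow R n M Z).

Lemma opnorm_prod_le t z E t' z' E' (c : R) : 0 <= c ->
  0 <= opnorm g F t z E -> 0 <= opnorm g F t' z' E' ->
  (forall a b, a \in E -> b \in E' ->
    tnorm g (lf_pt F (lf_act F t z)) (lf_map F t z a) *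
    tnorm g (lf_pt F (lf_act F t' z')) (lf_map F t' z' b) <=
    c * (tnorm g (lf_pt F z) a * tnorm g (lf_pt F z') b)) ->
  opnorm g F t z E * opnorm g F t' z' E' <= c.
Proof.
move=> c0 op0; rewrite le_eqVlt => /orP[/eqP<-|op'0] h; first by rewrite mulr0.
rewrite -ler_pdivlMr//; apply: opnorm_le; first by rewrite divr_ge0// ltW.
move=> a aE; set na := tnorm _ _ (lf_map F t z a).
have [na0|na0] := eqVneq na 0.
  by rewrite na0 mulr_ge0 ?tnorm_ge0// divr_ge0// ltW.
have nap : 0 < na by rewrite lt_neqAle eq_sym na0 tnorm_ge0.
rewrite mulrAC ler_pdivlMr// mulrC -ler_pdivlMr//.
apply: opnorm_le; first by rewrite divr_ge0 ?mulr_ge0 ?tnorm_ge0.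
move=> b bE; rewrite mulrAC ler_pdivlMr// mulrC -mulrA.
exact: h.
Qed.

End OpnormProduct.

Section SingularityBridge.
Context {R : realType} {n : nat} {M : topologicalType} {A : smooth_atlas R n M}.
Variables (g : riemannian_metric A) (X : M -> 'rV[R]_n) (phi : R -> M -> M).
Hypothesis hphi : is_flow (A := A) X phi.
Variable sigma : M.
Hypothesis sing : X sigma = 0.
Local Notation N := (tnorm g sigma).
Local Notation F := (sing_flow (A := A) phi sigma).
Implicit Types (E : {vspace 'rV[R]_n}) (Es : seq {vspace 'rV[R]_n}).

Let fixed t : phi t sigma = sigma := sing_fixed hphi sing t.
Let hN := tnorm_is_norm g sigma.
Let hF : is_group F := sing_flow_group hphi sing.

Lemma sing_opnorm_le t E c : 0 <= c -> (forall v, v \in E -> N (F t v) <= c * N v) ->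
  opnorm g (@tangent_flow _ _ _ A phi) t sigma E <= c.
Proof.
move=> c0 h; apply: opnorm_le => // v vE /=.
by rewrite -(sing_flowE phi sigma t v) fixed; apply: h.
Qed.

Lemma sing_lfb t : exists K, forall v,
  tnorm g (phi t sigma) (Dphi phi (A := A) t sigma v) <= K * N v.
Proof.
have [K _ hK] := N_bounded hN (F t); exists K => v.
by rewrite fixed -(sing_flowE phi sigma t v).
Qed.

Lemma sing_lfZ t c v :
  Dphi phi (A := A) t sigma (c *: v) = c *: Dphi phi (A := A) t sigma v.
Proof. by rewrite -!(sing_flowE phi sigma t) homZ. Qed.

Lemma sing_le_opnorm t E v : v \in E ->
  N (F t v) <= opnorm g (@tangent_flow _ _ _ A phi) t sigma E * N v.
Proof.
move=> vE; rewrite (sing_flowE phi sigma t v) -{1}(fixed t).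
by apply: (le_opnorm (F := @tangent_flow _ _ _ A phi)) => //;
  [exact: sing_lfZ|exact: sing_lfb].
Qed.

Lemma sing_opnorm_ge0 t E : 0 <= opnorm g (@tangent_flow _ _ _ A phi) t sigma E.
Proof.
by apply: (opnorm_ge0 (F := @tangent_flow _ _ _ A phi));
  [exact: sing_lfZ|exact: sing_lfb].
Qed.

Lemma contracted_atP E : contracted_at g phi sigma E -> contracts N F E.
Proof.
move=> [eta [T [eta0 T0 h]]]; exists eta, T; split=> // t v tT vE.
apply: (le_trans (sing_le_opnorm t vE)); rewrite ler_wpM2r ?(N_ge0 hN)// ltW//.
exact: h.
Qed.

Lemma expanded_atP E : expanded_at g phi sigma E -> contracts N (reversed F) E.
Proof.
move=> [eta [T [eta0 T0 h]]]; exists eta, T; split=> // t v tT vE.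
apply: (le_trans (sing_le_opnorm (- t) vE)); rewrite ler_wpM2r ?(N_ge0 hN)// ltW//.
exact: h.
Qed.

(** Half of the rate is given up to pass from the large inequalities on vectors to the strict ones
    on operator norms. *)
Let half (eta t : R) : 0 < eta -> 0 < t -> expR (- eta * t) < expR (- (eta / 2) * t).
Proof.
move=> eta0 t0; rewrite ltr_expR !mulNr ltrN2.
by have := mulr_gt0 eta0 t0; lra.
Qed.

Lemma contracts_contracted_at E : contracts N F E -> contracted_at g phi sigma E.
Proof.
move=> [eta [T [eta0 T0 h]]]; exists (eta / 2), T; split=> //.
  by rewrite divr_gt0.
move=> _ t -> tT; apply: le_lt_trans (half eta0 (lt_trans T0 tT)).
apply: sing_opnorm_le; first exact: expR_ge0.
by move=> v vE; apply: h.
Qed.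

Lemma contracts_expanded_at E : contracts N (reversed F) E -> expanded_at g phi sigma E.
Proof.
move=> [eta [T [eta0 T0 h]]]; exists (eta / 2), T; split=> //.
  by rewrite divr_gt0.
move=> _ t -> tT; apply: le_lt_trans (half eta0 (lt_trans T0 tT)).
apply: sing_opnorm_le; first exact: expR_ge0.
by move=> v vE; apply: h.
Qed.

Lemma bsum_const Es (z : M) :
  bsum [seq (fun=> E) | E <- Es] z = vsum Es.
Proof. by rewrite /bsum /vsum big_map. Qed.

Lemma invariant_bundleP E : invariant_bundle (@tangent_flow _ _ _ A phi) [set sigma] (fun=> E) <->
  stable_by F E.
Proof.
split=> [h t v vE|h t _ ->].
  by have := h t sigma erefl; rewrite /= sing_flow_linfun => <-; exact: memv_img.
rewrite /= sing_flow_linfun; apply/eqP; rewrite eqEsubv; apply/andP; split; apply/subvP => v.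
  by move=> /memv_imgP[w wE ->]; apply: h.
by move=> vE; rewrite -(AKV hF t v); apply: memv_img; apply: h.
Qed.

Lemma subbundle_const E : subbundle (A := A) (@tangent_flow _ _ _ A phi) [set sigma] (\dim E) (fun=> E).
Proof.
move=> _ ->; exists setT, (fun i _ => tnth (vbasis E) i); split=> //.
- exact: openT.
- move=> i; apply/subspace_continuousP => x [-> _] B /nbhs_singleton Bx.
  by apply: filterS (withinT _ _) => y [-> _].
- by move=> z _ _; rewrite map_tnth_enum; exact: vbasisP.
Qed.

Lemma dominated_pairP E E' : stable_by F E' ->
  dominated_pair g (@tangent_flow _ _ _ A phi) [set sigma] (fun=> E) (fun=> E') ->
  dominates N F E E'.
Proof.
move=> iE' [eta [T [eta0 T0 h]]]; exists eta, T; split=> // t a b tT aE bE.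
have := h sigma t erefl tT; rewrite /= fixed => /ltW h1.
have h2 := sing_le_opnorm t aE; have h3 := le_at_eq (AK hF t b) (sing_le_opnorm (- t) (iE' t b bE)).
apply: (le_trans (ler_pM (N_ge0 hN _) (N_ge0 hN _) h2 h3)).
by rewrite mulrACA ler_wpM2r// mulr_ge0 ?(N_ge0 hN).
Qed.

Lemma dominates_pair E E' : stable_by F E' ->
  dominates N F E E' ->
  dominated_pair g (@tangent_flow _ _ _ A phi) [set sigma] (fun=> E) (fun=> E').
Proof.
move=> iE' [eta [T [eta0 T0 h]]]; exists (eta / 2), T; split=> //.
  by rewrite divr_gt0.
move=> _ t -> tT; apply: le_lt_trans (half eta0 (lt_trans T0 tT)).
rewrite /= fixed; apply: opnorm_prod_le; rewrite ?expR_ge0 ?sing_opnorm_ge0//=.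
move=> a b aE bE; rewrite -!(sing_flowE phi sigma) !fixed.
have H := h t a (F (- t) b) tT aE (iE' _ _ bE).
exact: (eq_ind _ (fun w => N (F t a) * N (F (- t) b) <=
  expR (- eta * t) * (N a * N w)) H _ (AKV hF t b)).
Qed.

Lemma dominated_atP Es : dominated_at g phi sigma Es <-> dominated_list N F Es.
Proof.
have inv k : (forall E, E \in Es -> stable_by F E) -> stable_by F (vsum (drop k Es)).
  by move=> h; apply: invariant_vsum => E /mem_drop; apply: h.
have dirE : directv (\sum_(E <- [seq (fun=> E) | E <- Es]) (E : M -> _) sigma) =
    (\dim (vsum Es) == \sum_(E <- Es) \dim E)%N.
  by rewrite directvE /= !big_map.
split=> [[[sub /(_ sigma erefl)[]]]|[inv' full dimE dom]].
  rewrite bsum_const dirE => full /eqP dimE dom.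
  have invE E : E \in Es -> stable_by F E.
    move=> EEs; have iE : (index E Es < size Es)%N by rewrite index_mem.
    have := sub (index E Es); rewrite size_map => /(_ iE)[_].
    rewrite (nth_map 0%VS)//= nth_index//.
    by move/invariant_bundleP.
  split=> //; first by rewrite -dimE full dimV.
  move=> k kE; apply: dominated_pairP; first exact: inv.
  have := dom k; rewrite size_map => /(_ kE).
  congr (dominated_pair _ _ _ _ _); apply/funext => z.
    by rewrite -map_take bsum_const.
  by rewrite -map_drop bsum_const.
split; first split.
- move=> i; rewrite size_map => iE; rewrite (nth_map 0%VS)//=; split.
    by exists (\dim (nth 0%VS Es i)); exact: subbundle_const.
  by apply/invariant_bundleP; apply: inv'; rewrite mem_nth.
- by move=> _ ->; rewrite bsum_const full dirE full dimV dimE eqxx.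
move=> k; rewrite size_map => kE.
have := dominates_pair (inv k inv') (dom k kE).
congr (dominated_pair _ _ _ _ _); apply/funext => z.
  by rewrite -map_take bsum_const.
by rewrite -map_drop bsum_const.
Qed.

End SingularityBridge.

(** * Time reversal *)

Section ReversedFlow.
Context {R : realType} {n : nat} {M : topologicalType} {A : smooth_atlas R n M}.
Variables (X : M -> 'rV[R]_n) (phi : R -> M -> M).
Hypothesis hphi : is_flow (A := A) X phi.

(** [Wuu] is the strong manifold of this reversed flow, so facts on stable discs transfer to
    unstable ones. *)
Lemma reversed_is_flow : is_flow (A := A) (fun x => - X x) (fun t => phi (- t)).
Proof.
have [h0 hD hc hCk hX] := hphi; split.
- by move=> x; rewrite oppr0.
- by move=> s t x; rewrite opprD hD.
- move=> [t x]; apply: (@continuous_comp _ _ _ (fun tx : R * M => (- tx.1, tx.2))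
    (fun tx => phi tx.1 tx.2)); last exact: hc.
  apply: (@cvg_pair _ _ _ _ (nbhs (- t)) (nbhs x) _ _ _
    (fun tx : R * M => - tx.1) (fun tx : R * M => tx.2)); last exact: cvg_snd.
  by apply: cvgN; exact: cvg_fst.
- move=> p q; have [dG cG] := hCk p q.
  pose G (ty : R^o * 'rV[R]_n) := chart A q (phi ty.1 (cinv A p ty.2)).
  pose r (ty : R^o * 'rV[R]_n) : R^o * 'rV[R]_n := (- ty.1, ty.2).
  have rlin : linear r.
    move=> c [a b] [a' b']; apply/pair_equal_spec; split => //=.
    by rewrite opprD -scalerN.
  pose rL : {linear (R^o * 'rV[R]_n)%type -> (R^o * 'rV[R]_n)%type} :=
    HB.pack r (GRing.isLinear.Build _ _ _ _ _ rlin).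
  have rc : continuous r.
    move=> [t y]; apply: (@cvg_pair _ _ _ _ (nbhs (- t)) (nbhs y) _ _ _
      (fun tx : R^o * 'rV[R]_n => - tx.1) (fun tx : R^o * 'rV[R]_n => tx.2)); last exact: cvg_snd.
    by apply: cvgN; exact: cvg_fst.
  have dr ty : is_diff ty r r.
    apply: DiffDef; first exact: (@linear_differentiable _ _ _ rL).
    exact: (@diff_lin _ _ _ rL).
  have dF ty : cimg A p ty.2 /\ cdom A q (phi (- ty.1) (cinv A p ty.2)) ->
      is_diff ty (G \o r) ('d G (r ty) \o r).
    move=> U; have dGr : is_diff (r ty) G ('d G (r ty)) by apply/differentiableP/(dG (r ty)).
    exact: (is_diff_comp (dr ty) dGr).
  split=> [ty U|v ty U]; first by case: (dF ty U).
  have e : \forall z \near ty, 'D_(r v) G (r z) = 'D_v (G \o r) z.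
    have Un : \forall z \near ty, cimg A p z.2 /\ cdom A q (phi (- z.1) (cinv A p z.2)).
      case: ty U => t y /= [yp yq]; have Un : nbhs y (cimg A p) := cimg_nbhs yp.
      have cz : {for (t, y), continuous (fun z : R^o * 'rV[R]_n => phi (- z.1) (cinv A p z.2))}.
        apply: (@continuous_comp _ _ _ (fun z : R^o * 'rV[R]_n => (- z.1, cinv A p z.2))
          (fun tx : R * M => phi tx.1 tx.2)); last exact: hc.
        apply: (@cvg_pair _ _ _ _ (nbhs (- t)) (nbhs (cinv A p y)) _ _ _
          (fun tx : R^o * 'rV[R]_n => - tx.1) (fun tx : R^o * 'rV[R]_n => cinv A p tx.2)).
          by apply: cvgN; exact: cvg_fst.
        by apply: cvg_comp; [exact: cvg_snd|exact: cinv_continuous].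
      apply: filterI; last exact: (cz _ (cdom_nbhs yq)).
      exact: (@cvg_snd _ _ (nbhs t) (nbhs y) _ _ Un).
    apply: filterS Un => z Uz; rewrite !deriveE; last 2 first.
    - by case: (dF z Uz).
    - exact: (dG (r z)).
    have [_ e'] := dF z Uz; exact: (esym (congr1 (fun f => f v) e')).
  suff : 'D_v (G \o r) z @[z --> ty] --> 'D_v (G \o r) ty by [].
  have ety : 'D_(r v) G (r ty) = 'D_v (G \o r) ty := nbhs_singleton e.
  rewrite -ety; apply: cvg_trans (near_eq_cvg e) _.
  exact: (continuous_comp (rc ty) (cG (r v) (r ty) U)).
move=> x t; have H := hX x (- t).
have dN : is_derive t (1 : R) (-%R : R -> R) (-1).
  have di : is_derive t (1 : R) (id : R -> R) 1 := is_derive_id _ _.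
  exact: (is_deriveN di).
have [dH dHE] := H.
have dd : differentiable (fun s => chart A (phi (- t) x) (phi s x)) (- t : R).
  by apply/derivable1_diffP.
have := diff_curve dN dd.
have -> : 'd (fun s => chart A (phi (- t) x) (phi s x)) (- t : R) (-1) = - X (phi (- t) x).
  by rewrite -dHE deriveE// -[RHS]linearN.
exact.
Qed.

Lemma sing_flow_reversed sigma : sing_flow (A := A) (fun t => phi (- t)) sigma =
  reversed (sing_flow (A := A) phi sigma).
Proof. by []. Qed.

End ReversedFlow.

Section TrivialManifold.
Context {R : realType} {n : nat} {M : topologicalType} {A : smooth_atlas R n M}.
Variables (X : M -> 'rV[R]_n) (phi : R -> M -> M).
Hypothesis hphi : is_flow (A := A) X phi.
Variable sigma : M.
Hypothesis sing : X sigma = 0.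

(** A disc tangent to [0] is the single point [sigma], which only its own orbit reaches. The empty
    family is therefore escaping, and a longest escaping family exists. *)
Lemma Wss_trivial : Wss (A := A) phi sigma 0%VS = [set sigma].
Proof.
have dim0 (v w : 'rV[R]_(\dim (0%VS : {vspace 'rV[R]_n}))) : v = w.
  by apply/rowP => -[j hj]; exfalso; move: hj; rewrite dimv0.
have fixed := sing_fixed hphi sing.
apply/seteqP; split=> [x [D [t [[i [[-> i0] _ _ _ _]] t0 [v _ vE]]]]|_ ->].
  move: vE; rewrite (dim0 v 0) i0 => e.
  by rewrite /= -(flowK hphi t x) -e fixed.
exists [set sigma], 0; split; [|exact: lexx|by rewrite /= fixed].
exists (fun=> sigma); split.
- split=> //; apply/seteqP; split=> [_ ->|_ [v _ <-] //].
  by exists 0.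
- split; first exact: cst_continuous.
  move=> p; split=> [v _|v w _]; first exact: (@differentiable_cst _ _ _ (chart A p sigma) v).
  have -> : 'D_v (chart A p \o fun=> sigma) = cst 0.
    by apply/funext => u; exact: (@derive_cst _ _ _ (chart A p sigma)).
  exact: cst_continuous.
- split=> [v w _|y B yB]; first exact: dim0.
  exists setT; first exact: filterT.
  by move=> w _; rewrite (dim0 w y); exact: nbhs_singleton.
- split=> [y v w _|]; first exact: dim0.
  apply/eqP; rewrite -subv0; apply/subvP => w /memv_imgP[v _ ->].
  by rewrite (dim0 v 0) linear0 mem0v.
- move=> _ ->; split=> [t _|]; first by rewrite fixed.
  have -> : (fun t => phi t sigma) = cst sigma by apply/funext => t; rewrite fixed.
  exact: cvg_cst.
Qed.

End TrivialManifold.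

Lemma contracts_expands_dominates (R : realType) (V : vectType R) (N : V -> R)
    (hN : is_norm N) (F : R -> 'End(V)) (hF : is_group F) (E E' : {vspace V}) :
  stable_by F E' -> contracts N F E -> contracts N (reversed F) E' ->
  dominates N F E E'.
Proof.
move=> iE' [eta [T [eta0 T0 h]]] [eta' [T' [eta'0 T'0 h']]].
exists (eta + eta'), (Num.max T T'); split; rewrite ?addr_gt0 ?lt_max ?T0//.
move=> t a b; rewrite gt_max => /andP[tT tT'] aE bE'.
have h1 := h t a tT aE; have := h' t (F t b) tT' (iE' t b bE').
rewrite /reversed (AK hF) => h2.
rewrite opprD mulrDl expRD mulrACA.
by apply: ler_pM; rewrite ?(N_ge0 hN).
Qed.

(** * Existence and nontriviality of the center space *)

Section CenterExistence.
Context {R : realType} {n : nat} {M : topologicalType} {A : smooth_atlas R n M}.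
Variables (g : riemannian_metric A) (X : M -> 'rV[R]_n) (phi : R -> M -> M).
Hypothesis hphi : is_flow (A := A) X phi.
Variables (La : set M) (sigma : M).
Hypotheses (sing : X sigma = 0) (sLa : La sigma).
Local Notation N := (tnorm g sigma).
Local Notation F := (sing_flow (A := A) phi sigma).

Lemma hyperbolic_cut : hyperbolic g X phi sigma -> exists Es Eu,
  [/\ dominated_cut N F Es Eu, contracts N F Es & contracts N (reversed F) Eu].
Proof.
have hN := tnorm_is_norm g sigma; have hF := sing_flow_group hphi sing.
move=> [_ [Es [Eu [[sub /(_ sigma erefl)[full dir]] cE eE]]]]; exists Es, Eu.
have cEs := contracted_atP hphi sing cE; have cEu := expanded_atP hphi sing eE.
split=> //; have iEs : stable_by F Es.
  by apply/(invariant_bundleP hphi sing); have [] := sub 0%N isT.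
have iEu : stable_by F Eu.
  by apply/(invariant_bundleP hphi sing); have [] := sub 1%N isT.
split=> //; last exact: contracts_expands_dominates.
split; first by move: full; rewrite /bsum !big_cons big_nil addv0.
move: dir; rewrite directvE /= !big_cons !big_nil addv0 addn0 => /eqP d.
have := dimv_sum_cap Es Eu; rewrite d => /eqP; rewrite -[X in _ == X]addn0 eqn_add2l.
by rewrite dimv_eq0 => /eqP.
Qed.

Lemma max_prefix (P : nat -> Prop) (m : nat) : P 0%N ->
  exists k, [/\ (k <= m)%N, P k & forall j, (k < j <= m)%N -> ~ P j].
Proof.
move=> P0; elim: m => [|m [k [km Pk hk]]].
  by exists 0%N; split=> // -[|j] /andP[].
have [Pm|nPm] := pselect (P m.+1).
  by exists m.+1; split=> // j /andP[]; lia.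
exists k; split=> //; first exact: leqW.
move=> j /andP[kj]; rewrite leq_eqVlt => /orP[/eqP-> //|jm].
by apply: hk; rewrite kj.
Qed.

Lemma ninfty_reversed x : unstable_set phi sigma x ->
  phi (- t) x @[t --> +oo] --> sigma.
Proof.
move=> h W /h [T [Tr hT]]; exists (- T); split; first by rewrite rpredN.
by move=> t tT; apply: hT; rewrite ltrNl.
Qed.

Hypothesis hs : (stable_set phi sigma `&` La) `\ sigma !=set0.
Hypothesis hu : (unstable_set phi sigma `&` La) `\ sigma !=set0.

(** If the intersection were [{sigma}], then [sigma] would lie in [Wss], which provides a disc
    tangent to [Es]. This disc absorbs the orbit of the point given by [hs], which then lies in the
    intersection as well. *)
Lemma stable_not_escaping Es Eu : dominated_cut N F Es Eu ->
  contracts N F Es -> contracts N (reversed F) Eu ->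
  Wss (A := A) phi sigma Es `&` La <> [set sigma].
Proof.
move=> [iEs iEu EE _] cEs cEu W; have [x [[xs xL] xn]] := hs.
have : (Wss (A := A) phi sigma Es `&` La) sigma by rewrite W.
move=> [[D [_ [hD _ _]]] _].
have [t t0 Dx] := stable_disc_absorbs hphi sing iEs iEu EE cEs cEu hD xs.
apply: xn; have : (Wss (A := A) phi sigma Es `&` La) x by split=> //; exists D, t.
by rewrite W.
Qed.

Lemma unstable_not_escaping Es Eu : dominated_cut N F Es Eu ->
  contracts N F Es -> contracts N (reversed F) Eu ->
  Wuu (A := A) phi sigma Eu `&` La <> [set sigma].
Proof.
move=> [iEs iEu EE _] cEs cEu W; have [x [[/ninfty_reversed xs xL] xn]] := hu.
have : (Wuu (A := A) phi sigma Eu `&` La) sigma by rewrite W.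
move=> [[D [_ [hD _ _]]] _].
have hphi' := reversed_is_flow hphi; have sing' : - X sigma = 0 by rewrite sing oppr0.
have cEs' : contracts N (reversed (reversed F)) Es by rewrite reversedK.
have := @stable_disc_absorbs _ _ _ _ g _ _ hphi' sigma sing' Eu Es.
rewrite sing_flow_reversed => H.
have [t t0 Dx] := H (reversed_invariant iEu) (reversed_invariant iEs)
  (complementaryC EE) cEu cEs' D x hD xs.
apply: xn; have : (Wuu (A := A) phi sigma Eu `&` La) x by split=> //; exists D, t.
by rewrite W.
Qed.

(** The escaping families are the longest admissible prefix of [Ls] and suffix of [Lu]. Neither is
    the whole list, so [cs] and [cu] are nonempty; their bundles being nonzero, they span nonzero
    spaces. *)
Lemma exists_center : hyperbolic g X phi sigma -> exists ss cs cu uu,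
  [/\ center_space g phi La sigma (vsum (cs ++ cu)),
     [/\ dominated_list N F (ss ++ cs ++ cu ++ uu),
        contracts N F (vsum (ss ++ cs)) & contracts N (reversed F) (vsum (cu ++ uu))],
     Wss (A := A) phi sigma (vsum ss) `&` La = [set sigma],
     Wuu (A := A) phi sigma (vsum uu) `&` La = [set sigma] &
     vsum cs <> 0%VS /\ vsum cu <> 0%VS].
Proof.
have hN := tnorm_is_norm g sigma; have hF := sing_flow_group hphi sing.
move=> /hyperbolic_cut[Es [Eu [cut cEs cEu]]].
have [Ls [Lu [dom LsE LuE nz fin]]] := exists_finest hN hF cut.
have triv (psi : R -> M -> M) Y : is_flow (A := A) Y psi -> Y sigma = 0 ->
    Wss (A := A) psi sigma 0%VS `&` La = [set sigma].
  move=> hpsi Y0; rewrite (Wss_trivial hpsi Y0).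
  by apply/seteqP; split=> [x []|x ->].
have W0 : Wss (A := A) phi sigma (vsum (take 0 Ls)) `&` La = [set sigma].
  by rewrite take0 vsum_nil; exact: triv hphi sing.
have U0 : Wuu (A := A) phi sigma (vsum (drop (size Lu - 0) Lu)) `&` La = [set sigma].
  rewrite subn0 drop_size vsum_nil; apply: (triv _ _ (reversed_is_flow hphi)).
  by rewrite sing oppr0.
have [k [kS Wk hk]] := @max_prefix
  (fun k => Wss (A := A) phi sigma (vsum (take k Ls)) `&` La = [set sigma]) (size Ls) W0.
have [j [jS Wj hj]] := @max_prefix (fun j => Wuu (A := A) phi sigma
    (vsum (drop (size Lu - j) Lu)) `&` La = [set sigma]) (size Lu) U0.
have kL : (k < size Ls)%N.
  rewrite ltn_neqAle kS andbT; apply/eqP => ke.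
  by move: Wk; rewrite ke take_size LsE; exact: (stable_not_escaping cut cEs cEu).
have jL : (j < size Lu)%N.
  rewrite ltn_neqAle jS andbT; apply/eqP => je.
  by move: Wj; rewrite je subnn drop0 LuE; exact: (unstable_not_escaping cut cEs cEu).
pose l := (size Lu - j)%N.
have catL : take k Ls ++ drop k Ls ++ take l Lu ++ drop l Lu = Ls ++ Lu.
  by rewrite catA !cat_take_drop.
exists (take k Ls), (drop k Ls), (take l Lu), (drop l Lu).
have nz0 (L : seq {vspace 'rV[R]_n}) : L != [::] -> {subset L <= Ls ++ Lu} -> vsum L <> 0%VS.
  case: L => // E L _ sub L0; move/negP: nz; apply.
  have EL : E \in E :: L by rewrite inE eqxx.
  by have := vsum_sup EL; rewrite L0 subv0 => /eqP <-; apply: sub.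
split=> //; last first.
- split; apply: nz0.
  + by rewrite -size_eq0 size_drop subn_eq0 -ltnNge.
  + by move=> E /mem_drop EL; rewrite mem_cat EL.
  + by rewrite -size_eq0 size_takel ?leq_subr// subn_eq0 -ltnNge.
  + by move=> E /mem_take EL; rewrite mem_cat EL orbT.
- by rewrite catL !cat_take_drop LsE LuE.
exists (take k Ls), (drop k Ls), (take l Lu), (drop l Lu); split=> //.
- split.
  + rewrite catL; split=> [|//|Fs h]; first by apply/(dominated_atP g hphi sing).
    by apply: fin; apply/(dominated_atP g hphi sing).
  + by rewrite cat_take_drop LsE; exact: (contracts_contracted_at hphi sing).
  + by rewrite cat_take_drop LuE; exact: (contracts_expanded_at hphi sing).
- split=> // i; rewrite cat_take_drop size_take kL; exact: hk.
- split=> // i; rewrite cat_take_drop => il.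
  have il' : (i < l)%N by move: il; rewrite size_takel ?leq_subr.
  have -> : i = (size Lu - (size Lu - i))%N by move: il'; rewrite /l; lia.
  by apply: hj; move: il'; rewrite /l; lia.
Qed.

End CenterExistence.

(** * The one-dimensional center and its eigenvalue *)

Section CenterLine.
Context {R : realType} {V : vectType R} (N : V -> R) (hN : is_norm N).
Variables (q : V -> V -> R) (hq : is_line_dist N q).
Implicit Types (A : R -> 'End(V)) (E F C S U SS Cs Cu UU : {vspace V}).

(** At a singularity the product cocycle is bounded below, or, when the singularity contributes a
    factor, at least a multiple of the growth along the line of [u]. This gives the two
    alternatives, the choice being the same for all [u]. *)
Definition rescaled_rate_bound A C (S : V -> {vspace V}) : Prop :=
  exists2 eta : R, 0 < eta &
  (forall u a, u \in C -> u != 0 -> a \in S u ->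
    bigo (fun t => q (A t u) (A t a)) (fun t => expR (- eta * t))) \/
  (forall u a, u \in C -> u != 0 -> a \in S u ->
    bigo (fun t => N (A t u) * q (A t u) (A t a)) (fun t => expR (- eta * t))).

Lemma dominates_sub A E F E' F' : (E' <= E)%VS -> (F' <= F)%VS ->
  dominates N A E F -> dominates N A E' F'.
Proof.
move=> EE FF [eta [T [eta0 T0 h]]]; exists eta, T; split=> // t a b tT aE bF.
by apply: h => //; [exact: (subvP EE)|exact: (subvP FF)].
Qed.

(** For an expanded [w] the factor [N (A t w)] is bounded below, so both alternatives give decay
    modulo [w]. *)
Lemma rescaled_contracted A C (S : V -> {vspace V}) E (w a : V) : is_group A -> stable_by A E ->
  contracts N (reversed A) E -> rescaled_rate_bound A C S ->
  w \in E -> w \in C -> w != 0 -> a \in S w ->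
  negl (fun t => q (A t w) (A t a)) (fun=> 1).
Proof.
move=> hA iE cE [eta eta0 [h|h]] wE wC w0 aS.
  by apply: bigo_negl (h _ _ wC w0 aS) _; exact: expR_negl.
have [K [T [K0 hK]]] := expands_bigo hN hA iE cE wE w0.
have d := bigo_negl (h _ _ wC w0 aS) (expR_negl eta0).
apply: bigo_negl d; exists K, T; split=> // t tT; rewrite mulrA.
by rewrite ler_peMl ?(q_ge0 hN hq)// hK.
Qed.

Lemma iter_group A k (x : V) : is_group A -> iter k (A 1) x = A k%:R x.
Proof.
move=> hA; elim: k => [|k IH]; first by rewrite /= (A0 hA).
by rewrite iterS IH -(AD hA) -natr1 addrC.
Qed.

Lemma iter_group_opp A k (x : V) : is_group A -> iter k (A (-1)) x = A (- k%:R) x.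
Proof.
move=> hA; have := iter_group k x (reversed_group hA).
by [].
Qed.

(** [A 1] is the square of the map at time [1/2], so its eigenvalue along [z] is a square, hence
    positive. *)
Lemma group_eigenvalue A (z : V) : is_group A -> z != 0 -> stable_by A <[z]>%VS ->
  exists2 r : R, 0 < r & forall k, A k%:R z = r ^+ k *: z /\ A (- k%:R) z = r ^- k *: z.
Proof.
move=> hA z0 iz; have /vlineP[s hs] := iz 2^-1 z (memv_line z).
have one : A 1 z = s ^+ 2 *: z.
  have -> : 1 = 2^-1 + 2^-1 :> R by lra.
  by rewrite (AD hA) hs homZ hs scalerA.
have s0 : s != 0.
  apply: contra z0 => /eqP s0; apply/eqP; apply: (A_eq0 hA (t := 2^-1)).
  by rewrite hs s0 scale0r.
exists (s ^+ 2); first by rewrite exprn_even_gt0.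
have pos k : A k%:R z = (s ^+ 2) ^+ k *: z.
  elim: k => [|k IH]; first by rewrite (A0 hA) expr0 scale1r.
  by rewrite -natr1 addrC (AD hA) IH homZ one scalerA -exprSr.
move=> k; split; first exact: pos.
have : A (- k%:R) (A k%:R z) = z by rewrite (AK hA).
rewrite pos homZ => e; rewrite -[in RHS]e scalerA mulVf ?scale1r//.
by rewrite !expf_neq0.
Qed.

Section OneDimensionalCenter.
Variables (A : R -> 'End(V)) (hA : is_group A).
Variables (Es Eu SS Cs Cu UU : {vspace V}) (S U : V -> {vspace V}) (ds du : nat).
Hypotheses (iEs : stable_by A Es) (iEu : stable_by A Eu) (EE : complementary Es Eu).
Hypotheses (cEs : contracts N A Es) (cEu : contracts N (reversed A) Eu).
Hypotheses (EsE : Es = (SS + Cs)%VS) (EuE : Eu = (Cu + UU)%VS).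
Hypotheses (SC : (SS :&: Cs)%VS = 0%VS) (Cs0 : Cs != 0%VS) (Cu0 : Cu != 0%VS).
Hypotheses (iSS : stable_by A SS) (iCs : stable_by A Cs) (iCu : stable_by A Cu) (iUU : stable_by A UU).
Hypotheses (domS : dominates N A SS Cs) (domU : dominates N A Cu UU).
Hypotheses (ls : forall u, u \in (Cs + Cu)%VS -> u != 0 ->
  [/\ line_splitting q A u (S u) (U u), \dim (S u) = ds & \dim (U u) = du]).
Hypotheses (rS : rescaled_rate_bound A (Cs + Cu) S).
Hypotheses (rU : rescaled_rate_bound (reversed A) (Cs + Cu) U).

Lemma dim_stable_ge : (ds <= \dim Es)%N.
Proof.
pose w := vpick Cu; have wC : w \in Cu := memv_pick Cu.
have w0 : w != 0 by rewrite vpick0.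
have wE : w \in Eu by rewrite EuE; apply: (subvP (addvSl _ _)).
have wCC : w \in (Cs + Cu)%VS by apply: (subvP (addvSr _ _)).
have [lsw <- _] := ls wCC w0.
apply: (dim_contracted_le hN hq hA iEs iEu EE cEu wE w0 lsw) => a aS.
exact: (rescaled_contracted hA iEu cEu rS wE wCC w0 aS).
Qed.

Hypothesis dimEs : \dim Es = ds.+1.

(** [dim_center_le1] makes [Cs] a line. The unrescaled alternative for [U] being excluded,
    [rescaled_rate] bounds [Eu] in backward time by [e^(- eta t) / |A_(-t) z|], that is by
    [(e^(- eta) r)^k] at integer times up to a constant; the domination of [SS] by [Cs] gives
    [(e^(- eta') r)^k] on [SS]. The smaller rate yields [kap]. *)
Lemma center_line : exists z (r kap : R),
  [/\ [/\ z != 0, Cs = <[z]>%VS & \dim SS = ds], 0 < kap < r, r < 1,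
    A 1 z = r *: z &
    (forall x, x \in SS -> exists (c : R) (k0 : nat), forall k, (k0 <= k)%N ->
       N (iter k (A 1) x) <= c * kap ^+ k) /\
    (forall x, x \in Eu -> exists (c : R) (k0 : nat), forall k, (k0 <= k)%N ->
       N (iter k (A (-1)) x) <= c * kap ^+ k)].
Proof.
pose w := vpick Cu; have wC : w \in Cu := memv_pick Cu.
have w0 : w != 0 by rewrite vpick0.
have CuEu : (Cu <= Eu)%VS by rewrite EuE addvSl.
have CsEs : (Cs <= Es)%VS by rewrite EsE addvSr.
have wE : w \in Eu by apply: (subvP CuEu).
have wCC v : v \in Cu -> v \in (Cs + Cu)%VS by apply: (subvP (addvSr _ _)).
have [lsw dSw dUw] := ls (wCC _ wC) w0.
have dCs : \dim Cs = 1%N.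
  apply/eqP; rewrite eqn_leq lt0n dimv_eq0 Cs0 andbT.
  apply: (dim_center_le1 hN hq hA iEs iEu EE cEs cEu wE w0 lsw _ _ CsEs).
  - by rewrite dSw.
  - by move=> a aS; exact: (rescaled_contracted hA iEu cEu rS wE (wCC _ wC) w0 aS).
  move=> v vC; exists (S (v + w)), (U (v + w)).
  have u0 : v + w != 0.
    apply: contra w0 => /eqP vw; apply/eqP.
    apply: (complementary_eq0 (complementaryC EE) wE).
    by rewrite -[w](addKr v) vw addr0 rpredN (subvP CsEs).
  have [h1 h2 _] := ls (memv_add vC wC) u0.
  by split=> //; rewrite h2 dSw.
pose z := vpick Cs; have zC : z \in Cs := memv_pick Cs.
have z0 : z != 0 by rewrite vpick0.
have CsE : Cs = <[z]>%VS.
  apply/eqP; rewrite eq_sym eqEdim dCs dim_vline z0 leqnn andbT.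
  by apply/subvP => _ /vlineP[c ->]; rewrite memvZ.
have dSS : \dim SS = ds.
  have := dimv_disjoint_sum SC; rewrite -EsE dimEs dCs addn1 => -[] //.
have [r r0 hr] := group_eigenvalue hA z0 (ltac:(by rewrite -CsE)).
have Nz := N_gt0 hN z0.
have r1 : r < 1.
  rewrite ltNge; apply/negP => r1.
  have [|T hT] := contracts_negl hN cEs (subvP CsEs _ zC) (e := N z / 2).
    by rewrite divr_gt0.
  have [k hk] : exists k : nat, T < k%:R.
    exists (Num.bound `|T|); apply: le_lt_trans (ler_norm _) _; exact: archi_boundP.
  have := hT _ hk; rewrite (hr k).1 (NZ hN) ger0_norm ?exprn_ge0 ?(ltW r0)// mulr1.
  have : 1 <= r ^+ k by apply: exprn_ege1.
  by nra.
have one : A 1 z = r *: z by have := (hr 1%N).1; rewrite expr1.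
have domz : dominates N (reversed A) <[z]>%VS SS.
  by rewrite -CsE; apply: reversed_dominates.
have dec x : x \in Es -> exists s c, s \in SS /\ x = s + c *: z.
  rewrite EsE CsE => /memv_addP[s sS [_ /vlineP[c ->] ->]].
  by exists s, c.
case: rU => eta eta0 [rUa|rUb].
  exfalso; apply: (unrescaled_not_expanded hN hq hA iEs iEu EE cEs wE w0 lsw).
    by rewrite dimEs dSw.
  move=> b bU; apply: bigo_negl (expR_negl eta0).
  by apply: (rUa w) => //; apply: wCC.
pose f (t : R) := expR (- eta * t) / N (A (- t) z).
have Cuf v : v \in Cu -> v != 0 -> bigo (fun t => N (A (- t) v)) f.
  move=> vC v0; have [lsv dSv dUv] := ls (wCC _ vC) v0.
  apply: (rescaled_rate hN hq hA iEs iEu EE (subvP CuEu _ vC) v0 lsv _ z0 dec domz).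
    by rewrite dimEs dSv.
  by move=> b bU; apply: (rUb v) => //; apply: wCC.
have domu : dominates N (reversed A) UU Cu by exact: reversed_dominates.
have Euf e : e \in Eu -> bigo (fun t => N (A (- t) e)) f.
  by move=> eE; apply: (bigo_dominated_sum hN EuE domu wC w0 Cuf eE).
case: domS => eta' [T' [eta'0 T'0 hS]].
pose mu := Num.min eta eta'; pose kap := expR (- mu) * r.
have mu0 : 0 < mu by rewrite lt_min eta0.
exists z, r, kap; split=> //.
- rewrite mulr_gt0 ?expR_gt0//= -[ltRHS]mul1r ltr_pM2r// -expR0 ltr_expR.
  by rewrite oppr_lt0.
have expk (h : R) (k : nat) : mu <= h -> expR (- h * k%:R) <= expR (- mu) ^+ k.
  by move=> muh; rewrite -expRM_natr ler_expR ler_wpM2r// lerN2.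
have rk k : 0 <= r ^+ k by rewrite exprn_ge0 ?ltW.
split=> x xE.
  exists (N x), (Num.bound `|T'|) => k kT.
  rewrite (iter_group k x hA) exprMn.
  have tk : T' < k%:R.
    apply: (le_lt_trans (ler_norm _)); apply: (lt_le_trans (archi_boundP (normr_ge0 _))).
    by rewrite ler_nat.
  have := hS _ _ _ tk xE zC; rewrite (hr k).1 (NZ hN) ger0_norm// => h1.
  rewrite -(ler_pM2r Nz); apply: (le_trans h1).
  rewrite [leLHS](_ : _ = N x * (expR (- eta' * k%:R) * r ^+ k) * N z); last by ring.
  rewrite (ler_wpM2r (ltW Nz))// (ler_wpM2l (N_ge0 hN x))// (ler_wpM2r (rk k))// expk//.
  by rewrite ge_min lexx orbT.
have [K [T [K0 hK]]] := Euf x xE.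
exists (K / N z), (Num.bound `|T|) => k kT.
rewrite (iter_group_opp k x hA) exprMn.
have tk : T < k%:R.
  apply: (le_lt_trans (ler_norm _)); apply: (lt_le_trans (archi_boundP (normr_ge0 _))).
  by rewrite ler_nat.
apply: (le_trans (hK _ tk)); rewrite /f (hr k).2 (NZ hN).
rewrite ger0_norm ?invr_ge0// invfM invrK.
rewrite [leLHS](_ : _ = K / N z * (expR (- eta * k%:R) * r ^+ k)); last by ring.
rewrite (ler_wpM2l (divr_ge0 (ltW K0) (ltW Nz)))// (ler_wpM2r (rk k))// expk//.
by rewrite ge_min lexx.
Qed.

End OneDimensionalCenter.
End CenterLine.

Section LineBundles.
Context {R : realType} {V : vectType R} (N : V -> R) (hN : is_norm N).
Variables (q : V -> V -> R) (hq : is_line_dist N q).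
Variables (A : R -> 'End(V)) (hA : is_group A) (C : {vspace V}) (S U : V -> {vspace V}).
Hypothesis iC : stable_by A C.
Hypothesis full : forall u, u \in C -> u != 0 ->
  (<[u]> + S u + U u)%VS = fullv /\ (1 + \dim (S u) + \dim (U u) = \dim {:V})%N.
Hypothesis qS : forall u a, u \in C -> u != 0 -> a \in S u -> q u a = N a.
Hypothesis qU : forall u a, u \in C -> u != 0 -> a \in U u -> q u a = N a.
Hypothesis iS : forall t u a, u \in C -> u != 0 -> a \in S u ->
  exists c, A t a - c *: A t u \in S (A t u).
Hypothesis iU : forall t u a, u \in C -> u != 0 -> a \in U u ->
  exists c, A t a - c *: A t u \in U (A t u).
Hypothesis dom : exists eta T, [/\ 0 < eta, 0 < T & forall u a b t, u \in C -> u != 0 ->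
  a \in S u -> b \in U u -> T < t ->
  q (A t u) (A t a) * q u b <= expR (- eta * t) * (q u a * q (A t u) (A t b))].

Lemma bounded_negl (f h : R -> R) (c d eta T : R) : 0 < eta -> 0 < c -> 0 <= d ->
  (forall t, 0 <= h t) ->
  (forall t, T < t -> f t * c <= expR (- eta * t) * (d * h t)) -> negl f h.
Proof.
move=> eta0 c0 d0 h0 fh e e0; have d1 : 0 < d + 1 by lra.
have [T' h'] := expR_negl eta0 (divr_gt0 (mulr_gt0 e0 c0) d1).
exists (Num.max T T') => t; rewrite gt_max => /andP[tT tT'].
have h2 := fh _ tT; have := h' _ tT'; rewrite mulr1.
rewrite ler_pdivlMr// => h1; rewrite -(ler_pM2r c0); apply: (le_trans h2).
rewrite mulrA [leRHS]mulrAC ler_wpM2r ?h0//; apply: le_trans h1.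
by rewrite ler_wpM2l ?expR_ge0//; lra.
Qed.

Lemma line_splitting_of_domination u : u \in C -> u != 0 -> line_splitting q A u (S u) (U u).
Proof.
move=> uC u0; have [f d] := full uC u0.
have [eta [T [eta0 T0 h]]] := dom.
split=> // a b aS bU nz.
  apply: (@bounded_negl _ _ (q u b) (q u a) eta T) => //.
  - by rewrite qU// (N_gt0 hN).
  - exact: (q_ge0 hN hq).
  - by move=> t; exact: (q_ge0 hN hq).
  - by move=> t tT; apply: h.
apply: (@bounded_negl _ _ (q u a) (q u b) eta T) => //.
- by rewrite qS// (N_gt0 hN).
- exact: (q_ge0 hN hq).
- by move=> t; exact: (q_ge0 hN hq).
(* In backward time the domination is used along the line of [A (- t) u], on the images of [a] and
   [b] corrected by multiples of this line so as to lie in the bundles; [q] ignores the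
   correction. *)
move=> t tT; have [c cS] := iS (- t) uC u0 aS; have [e eU] := iU (- t) uC u0 bU.
have := h _ _ _ t (iC (- t) uC) (A_neq0 hA (- t) u0) cS eU tT.
rewrite !homB !homZ !(AKV hA) -!scaleNr !(q_addline hq).
by rewrite mulrC [q u b * _]mulrC.
Qed.

Lemma rescaled_bound_of_contraction (h : R -> V -> R) (K : R) : 0 < K ->
  (exists eta T, [/\ 0 < eta, 0 < T & forall u a t, u \in C -> u != 0 -> a \in S u ->
     T < t -> h t u * q (A t u) (A t a) <= expR (- eta * t) * N a]) ->
  (forall t u, u \in C -> u != 0 -> K <= h t u) \/
  (forall t u, u \in C -> u != 0 -> K * (N (A t u) / N u) <= h t u) ->
  rescaled_rate_bound N q A C S.
Proof.
move=> K0 [eta [T [eta0 T0 hr]]] [hK|hK]; exists eta => //; [left|right] => u a uC u0 aS.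
  exists ((N a + 1) / K), T; split.
    by rewrite divr_gt0//; have := N_ge0 hN a; lra.
  move=> t tT; have h1 := hr u a t uC u0 aS tT; have h2 := hK t u uC u0.
  have q0 := q_ge0 hN hq (A t u) (A t a).
  have h3 := ler_wpM2r q0 h2.
  rewrite mulrAC ler_pdivlMr// mulrC; apply: (le_trans h3); apply: (le_trans h1).
  by rewrite mulrC ler_wpM2r ?expR_ge0//; lra.
have Nu := N_gt0 hN u0.
exists ((N a + 1) * N u / K), T; split.
  by rewrite divr_gt0// mulr_gt0//; have := N_ge0 hN a; lra.
move=> t tT; have h1 := hr u a t uC u0 aS tT; have h2 := hK t u uC u0.
have q0 := q_ge0 hN hq (A t u) (A t a).
have h3 := le_trans (ler_wpM2r q0 h2) h1.
rewrite mulrAC ler_pdivlMr//.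
have -> : N (A t u) * q (A t u) (A t a) * K =
   K * (N (A t u) / N u) * q (A t u) (A t a) * N u by field; rewrite gt_eqF.
apply: (le_trans (ler_wpM2r (ltW Nu) h3)).
have -> : (N a + 1) * N u * expR (- eta * t) = expR (- eta * t) * (N a + 1) * N u by ring.
rewrite ler_wpM2r ?(ltW Nu)// ler_wpM2l ?expR_ge0//; lra.
Qed.

End LineBundles.

Lemma prod_lower_bound (R : realType) (T : eqType) (P : Type) (s : seq T)
    (h : T -> P -> R) (dom : T -> set P) :
  (forall x, x \in s -> exists2 K : R, 0 < K & forall p, dom x p -> K <= h x p) ->
  exists2 K : R, 0 < K & forall p, (forall x, x \in s -> dom x p) ->
    K <= \prod_(x <- s) h x p.
Proof.
elim: s => [_|x s IH hs]; first by exists 1 => // p _; rewrite big_nil.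
have [|K K0 hK] := IH; first by move=> y ys; apply: hs; rewrite inE ys orbT.
have [K' K'0 hK'] := hs x (mem_head x s).
exists (K' * K); first exact: mulr_gt0.
move=> p hp; rewrite big_cons; apply: (ler_pM (ltW K'0) (ltW K0)).
  by apply: hK'; apply: hp; exact: mem_head.
by apply: hK => y ys; apply: hp; rewrite inE ys orbT.
Qed.

(** * The extended linear Poincare flow at a singularity *)

Section ExtendedFlow.
Context {R : realType} {n : nat} {M : topologicalType} {A : smooth_atlas R n M}.
Variables (g : riemannian_metric A) (phi : R -> M -> M).
Implicit Types (x : M) (u v : 'rV[R]_n).

Definition line x u : pbundle A := (x, <[u]>%VS).

Lemma vpick_line u : u != 0 -> exists2 c, c != 0 & vpick <[u]>%VS = c *: u.
Proof.
move=> u0; have /vlineP[c e] := memv_pick <[u]>%VS.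
exists c => //; apply/eqP => c0; have : vpick <[u]>%VS != 0.
  by rewrite vpick0 -dimv_eq0 dim_vline u0.
by rewrite e c0 scale0r eqxx.
Qed.

Lemma G1_line x u : u != 0 -> G1 A (line x u).
Proof. by move=> u0; rewrite /G1 /= dim_vline u0. Qed.

Lemma orth_line x u : u != 0 -> orth g x (vpick <[u]>%VS) = orth g x u.
Proof.
move=> /vpick_line[c c0 ->]; apply/vspaceP => v.
by rewrite !mem_orth ipZr mulf_eq0 (negPf c0).
Qed.

Lemma EPsi_line t x u v : u != 0 -> EPsi g phi t (line x u) v =
  proj_orth g (phi t x) (Dphi phi (A := A) t x u) (Dphi phi (A := A) t x v).
Proof.
move=> /vpick_line[c c0 e]; rewrite /EPsi /= e /Dphi linearZ.
exact: proj_orth_line.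
Qed.

Lemma pphi_line t x u : pphi phi t (line x u) =
  line (phi t x) (Dphi phi (A := A) t x u).
Proof. by rewrite /pphi /line /= limg_line lfunE. Qed.

End ExtendedFlow.

Section SingularLines.
Context {R : realType} {n : nat} {M : topologicalType} {A : smooth_atlas R n M}.
Variables (g : riemannian_metric A) (X : M -> 'rV[R]_n) (phi : R -> M -> M).
Hypothesis hphi : is_flow (A := A) X phi.
Variables (La : set M) (sigma : M).
Hypotheses (sing : X sigma = 0) (sLa : La sigma).
Local Notation N := (tnorm g sigma).
Local Notation F := (sing_flow (A := A) phi sigma).
Local Notation q := (line_dist g sigma).
Implicit Types (u v a b : 'rV[R]_n).

Let fixed t : phi t sigma = sigma := sing_fixed hphi sing t.
Let hN := tnorm_is_norm g sigma.
Let hF : is_group F := sing_flow_group hphi sing.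

Lemma EPsi_sing t u v : u != 0 ->
  EPsi g phi t (line sigma u) v = proj_orth g sigma (F t u) (F t v).
Proof.
by move=> u0; rewrite EPsi_line// fixed -!(sing_flowE phi sigma t).
Qed.

Lemma pphi_sing t u : pphi phi t (line sigma u) = line sigma (F t u) :> pbundle A.
Proof. by rewrite pphi_line fixed -(sing_flowE phi sigma t). Qed.

Lemma tnorm_EPsi_sing t u v : u != 0 ->
  tnorm g (phi t sigma) (EPsi g phi t (line sigma u) v) = q (F t u) (F t v).
Proof. by move=> u0; rewrite EPsi_sing// fixed. Qed.

Lemma EPsi_singZ t u c v : u != 0 ->
  EPsi g phi t (line sigma u) (c *: v) = c *: EPsi g phi t (line sigma u) v.
Proof. by move=> u0; rewrite !EPsi_sing// homZ proj_orthZ. Qed.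

Lemma EPsi_sing_bounded t u : u != 0 -> exists K, forall v,
  tnorm g (phi t sigma) (EPsi g phi t (line sigma u) v) <= K * N v.
Proof.
move=> u0; have [K _ hK] := N_bounded hN (F t); exists K => v.
rewrite tnorm_EPsi_sing//; apply: le_trans (hK v).
exact: (q_leN (line_distP g sigma)).
Qed.

Variable C : {vspace 'rV[R]_n}.
Hypotheses (iC : stable_by F C) (cC : center_space g phi La sigma C).

Lemma center_line_ext u : u \in C -> u != 0 -> extended_invariant_set g X phi La (line sigma u).
Proof.
move=> uC u0; right; split; [exact: G1_line|by []|].
by exists C => //; apply/subvP => _ /vlineP[c ->]; rewrite memvZ.
Qed.

Lemma sing_line_total u : u != 0 -> extended_total_space X (line sigma u : pbundle A).
Proof. by move=> u0; right; split; [exact: G1_line|]. Qed.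

Variables (Ns Nu : pbundle A -> {vspace 'rV[R]_n}).
Hypothesis dom : dominated_splitting g (extended_poincare_flow g phi)
  (extended_invariant_set g X phi La) [:: Ns; Nu].

Let S u := Ns (line sigma u).
Let U u := Nu (line sigma u).

Lemma sing_lines_full u : u \in C -> u != 0 ->
  (<[u]> + S u + U u)%VS = fullv /\ (1 + \dim (S u) + \dim (U u) = \dim {:'rV[R]_n})%N.
Proof.
move=> uC u0; have [[_ /(_ _ (center_line_ext uC u0))[f d]] _] := dom.
move: f; rewrite /bsum !big_cons big_nil addv0 /= orth_line// => f.
move: d; rewrite directvE /= !big_cons !big_nil addv0 addn0 => /eqP d.
have oc := orth_complementary g sigma u0; rewrite -addvA.
have [h1 _] := oc; have h2 := dim_complementary oc.
split; first by rewrite -h1 -f.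
by rewrite -h2 -f d dim_vline u0 addnA.
Qed.

Lemma line_bundles_orth u : u \in C -> u != 0 ->
  (S u <= orth g sigma u)%VS /\ (U u <= orth g sigma u)%VS.
Proof.
move=> uC u0; have [[_ /(_ _ (center_line_ext uC u0))[f _]] _] := dom.
move: f; rewrite /bsum !big_cons big_nil addv0 /= orth_line// => <-.
by split; [exact: addvSl|exact: addvSr].
Qed.

Lemma q_orth u a : a \in orth g sigma u -> q u a = N a.
Proof. by move=> aO; rewrite /line_dist proj_orth_id. Qed.

Lemma EPsi_sing_mem (E : pbundle A -> {vspace 'rV[R]_n}) t u a :
  invariant_bundle (extended_poincare_flow g phi) (extended_invariant_set g X phi La) E ->
  u \in C -> u != 0 -> a \in E (line sigma u) ->
  EPsi g phi t (line sigma u) a \in E (line sigma (F t u)).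
Proof.
move=> inv uC u0 aE; have := inv t _ (center_line_ext uC u0); rewrite /= pphi_sing => <-.
have lin : linear (EPsi g phi t (line sigma u)).
  by move=> c v w; rewrite !EPsi_sing// homD homZ proj_orthD proj_orthZ.
pose f : {linear 'rV[R]_n -> 'rV[R]_n} := HB.pack (EPsi g phi t (line sigma u))
  (GRing.isLinear.Build _ _ _ _ _ lin).
have e : linfun (EPsi g phi t (line sigma u)) a = EPsi g phi t (line sigma u) a := lfunE f a.
exact: (eq_ind _ (fun w => w \in (linfun (EPsi g phi t (line sigma u)) @: E (line sigma u))%VS)
  (memv_img _ aE) _ e).
Qed.

Lemma sing_invariant (E : pbundle A -> {vspace 'rV[R]_n}) t u a :
  invariant_bundle (extended_poincare_flow g phi) (extended_invariant_set g X phi La) E ->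
  u \in C -> u != 0 -> a \in E (line sigma u) ->
  exists c, F t a - c *: F t u \in E (line sigma (F t u)).
Proof.
move=> inv uC u0 aE; have := EPsi_sing_mem t inv uC u0 aE; rewrite EPsi_sing//.
by move=> h; eexists; exact: h.
Qed.

Lemma invNs : invariant_bundle (extended_poincare_flow g phi)
  (extended_invariant_set g X phi La) Ns.
Proof. by have [[sub _] _] := dom; have [] := sub 0%N isT. Qed.

Lemma invNu : invariant_bundle (extended_poincare_flow g phi)
  (extended_invariant_set g X phi La) Nu.
Proof. by have [[sub _] _] := dom; have [] := sub 1%N isT. Qed.

Lemma sing_EPsiK t u b : u \in C -> u != 0 -> b \in U u ->
  EPsi g phi (- t) (line sigma (F t u)) (EPsi g phi t (line sigma u) b) = b.
Proof.
move=> uC u0 bU; have Fu0 : F t u != 0 := A_neq0 hF t u0.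
rewrite EPsi_sing// EPsi_sing//.
have e1 : F (- t) (F t u) = u := AK hF t u.
have [c ec] : exists c, proj_orth g sigma (F t u) (F t b) = F t b - c *: F t u by eexists.
have e2 : F (- t) (proj_orth g sigma (F t u) (F t b)) = b - c *: u.
  apply: (etrans (congr1 (F (- t)) ec)); apply: (etrans (homB _ _ _)).
  congr (_ - _); first exact: (AK hF t b).
  by apply: (etrans (homZ _ _ _)); congr (_ *: _).
apply: (etrans (f_equal2 (proj_orth g sigma) e1 e2)).
rewrite -scaleNr proj_orthD proj_orthZ (proj_orth_id (subvP (line_bundles_orth uC u0).2 _ bU)).
by rewrite proj_orth_self scaler0 addr0.
Qed.

Lemma sing_lines_dominated : exists eta T, [/\ 0 < eta, 0 < T & forall u a b t,
  u \in C -> u != 0 -> a \in S u -> b \in U u -> T < t ->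
  q (F t u) (F t a) * q u b <= expR (- eta * t) * (q u a * q (F t u) (F t b))].
Proof.
have [_ /(_ 1%N isT)[eta [T [eta0 T0 h]]]] := dom.
exists eta, T; split=> // u a b t uC u0 aS bU tT.
have := h _ t (center_line_ext uC u0) tT; rewrite /= /bsum !big_seq1 pphi_sing.
have Fu0 : F t u != 0 := A_neq0 hF t u0.
set o1 := opnorm _ _ _ _ _; set o2 := opnorm _ _ _ _ _ => /ltW o12.
have h1 : q (F t u) (F t a) <= o1 * N a.
  have := le_opnorm (F := extended_poincare_flow g phi) (z := line sigma u)
    (fun c v => EPsi_singZ t c v u0) (EPsi_sing_bounded t u0) aS.
  by rewrite /= tnorm_EPsi_sing.
(* [b] is recovered from its image by the map at time [- t], so the backward operator norm bounds
   [N b] by the norm of that image. *)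
have h2 : N b <= o2 * q (F t u) (F t b).
  have bU' := EPsi_sing_mem t invNu uC u0 bU.
  have := le_opnorm (F := extended_poincare_flow g phi) (z := line sigma (F t u))
    (fun c v => EPsi_singZ (- t) c v Fu0) (EPsi_sing_bounded (- t) Fu0) bU'.
  rewrite /= fixed sing_EPsiK//.
  have -> : N (EPsi g phi t (line sigma u) b) = q (F t u) (F t b) by rewrite EPsi_sing.
  by [].
rewrite (q_orth (subvP (line_bundles_orth uC u0).1 _ aS)) (q_orth (subvP (line_bundles_orth uC u0).2 _ bU)).
have := ler_pM (q_ge0 hN (line_distP g sigma) _ _) (N_ge0 hN b) h1 h2.
move/le_trans; apply; rewrite mulrACA ler_wpM2r// mulr_ge0 ?(N_ge0 hN)//.
Qed.

Lemma sing_line_splitting u : u \in C -> u != 0 -> line_splitting q F u (S u) (U u).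
Proof.
apply: (line_splitting_of_domination hN (line_distP g sigma) hF iC sing_lines_full).
- by move=> v a vC v0 /(subvP (line_bundles_orth vC v0).1)/q_orth.
- by move=> v a vC v0 /(subvP (line_bundles_orth vC v0).2)/q_orth.
- by move=> t v a vC v0; apply: sing_invariant => //; exact: invNs.
- by move=> t v a vC v0; apply: sing_invariant => //; exact: invNu.
- exact: sing_lines_dominated.
Qed.

End SingularLines.

(** * Lower bounds on the renormalization cocycles *)

Section CocycleBounds.
Context {R : realType} {n : nat} {M : topologicalType} {A : smooth_atlas R n M}.
Variables (g : riemannian_metric A) (X : M -> 'rV[R]_n) (phi : R -> M -> M).
Hypothesis hphi : is_flow (A := A) X phi.
Variables (h : M -> R -> pbundle A -> R) (S : set M).
Hypothesis fS : finite_set S.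
Hypothesis hS : forall sigma, S sigma -> renormalization_cocycle g X phi sigma (h sigma).

Let FS : seq M := finmap.enum_fset (fset_set S).

Lemma prod_cocycleE t L : prod_cocycle h S t L = \prod_(x <- FS) h x t L.
Proof. by rewrite /prod_cocycle fsbig_finite. Qed.

Lemma mem_fset_S x : x \in FS -> S x.
Proof. by move=> xS; apply: set_mem; rewrite -(in_fset_set fS). Qed.

Lemma prod_cocycle_off (V : set M) : (forall sigma, S sigma -> nbhs sigma V) ->
  exists2 K : R, 0 < K & forall t (L : pbundle A), extended_total_space X L ->
    ~ V L.1 -> ~ V (phi t L.1) -> K <= prod_cocycle h S t L.
Proof.
move=> hV.
have [x xS|K K0 hK] := @prod_lower_bound R M (R * pbundle A)%type FS
    (fun x p => h x p.1 p.2)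
    (fun _ => [set p | [/\ extended_total_space X p.2, ~ V p.2.1 & ~ V (phi p.1 p.2.1)]]).
  have Sx := mem_fset_S xS; have [_ _ hW] := hS Sx.
  have [C C1 hC] := hW V (hV x Sx).
  exists C^-1; first by rewrite invr_gt0 (lt_trans ltr01).
  by move=> [t L] [/= tL v1 v2]; have /andP[/ltW] := hC L t tL v1 v2.
exists K => // t L tL v1 v2; rewrite prod_cocycleE.
by apply: (hK (t, L)) => x _; split.
Qed.

Hypothesis hM : hausdorff_space M.
Variable sigma : M.
Hypothesis sing : X sigma = 0.
Local Notation N := (tnorm g sigma).
Local Notation F := (sing_flow (A := A) phi sigma).

Let fixed t : phi t sigma = sigma := sing_fixed hphi sing t.

Lemma sing_tangent_opnorm t u : u != 0 ->
  N (F t u) / N u <= opnorm g (@tangent_flow _ _ _ A phi) t sigma <[u]>%VS.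
Proof.
move=> u0; rewrite ler_pdivrMr ?(N_gt0 (tnorm_is_norm g sigma))//.
by apply: (sing_le_opnorm g hphi sing); exact: memv_line.
Qed.

(* At sigma, the cocycle of sigma is comparable to the norm of the tangent flow
   and the cocycles of the other singularities are bounded. *)
Lemma prod_cocycle_sing : exists2 K : R, 0 < K &
  (forall t u, u != 0 -> K <= prod_cocycle h S t (line sigma u)) \/
  (forall t u, u != 0 -> K * (N (F t u) / N u) <= prod_cocycle h S t (line sigma u)).
Proof.
pose dom := [set p : R * 'rV[R]_n | p.2 != 0].
pose rest : seq M := [seq x <- FS | x != sigma].
have [x|K K0 hK] := @prod_lower_bound R M (R * 'rV[R]_n)%type rest
    (fun x p => h x p.1 (line sigma p.2)) (fun _ => dom).
  rewrite mem_filter => /andP[xs xS]; have Sx := mem_fset_S xS.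
  have [_ _ hW] := hS Sx.
  (* [sigma] is fixed and lies outside a neighborhood of [x], so the second property of the cocycle
     of [x] bounds it at [sigma] for all times. *)
  have [W [Wo Wx Ws]] := hausdorff_accessible hM xs.
  rewrite inE in Wx; rewrite inE in Ws.
  have [C C1 hC] := hW W (open_nbhs_nbhs (conj Wo Wx)).
  exists C^-1; first by rewrite invr_gt0 (lt_trans ltr01).
  move=> [t u] /= u0.
  have := hC (line sigma u) t (sing_line_total sing u0) Ws.
  by rewrite /= fixed => /(_ Ws)/andP[/ltW].
have E t u : prod_cocycle h S t (line sigma u) =
    \prod_(x <- rest) h x t (line sigma u) *
    \prod_(x <- FS | x == sigma) h x t (line sigma u).
  by rewrite prod_cocycleE (bigID (fun x => x != sigma)) /= big_filter;
    congr (_ * _); apply: eq_bigl => x; rewrite negbK.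
have Krest t u : u != 0 -> K <= \prod_(x <- rest) h x t (line sigma u).
  by move=> u0; apply: (hK (t, u)).
have [sS|nS] := boolP (sigma \in FS).
  have [_ [W [C [Wn C1 hC]]] _] := hS (mem_fset_S sS).
  have C0 : 0 < C by exact: lt_trans C1.
  exists (K * C^-1); first by rewrite mulr_gt0 ?invr_gt0.
  right=> t u u0; rewrite E -mulrA; apply: ler_pM; rewrite ?(ltW K0) ?Krest//.
    by rewrite mulr_ge0 ?invr_ge0 ?divr_ge0 ?tnorm_ge0 ?ltW.
  have -> : \prod_(x <- FS | x == sigma) h x t (line sigma u) = h sigma t (line sigma u).
    by rewrite -big_filter (filter_pred1_uniq (finmap.fset_uniq _) sS) big_seq1.
  have := hC (line sigma u) t (sing_line_total sing u0) (nbhs_singleton Wn).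
  rewrite /= fixed => /(_ (nbhs_singleton Wn))/andP[h1 _].
  have hN := tnorm_is_norm g sigma.
  have op1 := sing_tangent_opnorm t u0.
  have op0 : 0 < opnorm g (@tangent_flow _ _ _ A phi) t sigma <[u]>%VS.
    apply: lt_le_trans op1; rewrite divr_gt0 ?(N_gt0 hN)//.
    exact: (A_neq0 (sing_flow_group hphi sing) t u0).
  move: h1; rewrite ltr_pdivlMr// => /ltW; apply: le_trans.
  by rewrite ler_wpM2l ?invr_ge0 ?(ltW C0).
exists K => //; left=> t u u0; rewrite E [X in _ * X]big1_seq ?mulr1 ?Krest//.
by move=> x /andP[/eqP -> sS]; rewrite sS in nS.
Qed.

End CocycleBounds.

Section ShortLists.
Context {R : realType} {n : nat}.
Variables (N : 'rV[R]_n -> R) (A : R -> 'End('rV[R]_n)).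
Implicit Types E : {vspace 'rV[R]_n}.

Lemma dominated_list2 E1 E2 : dominated_cut N A E1 E2 -> dominated_list N A [:: E1; E2].
Proof.
move=> [i1 i2 E12 dom]; split.
- by move=> E; rewrite !inE => /orP[] /eqP->.
- by rewrite !vsum_cons vsum_nil addv0; case: E12.
- by rewrite !big_cons big_nil addn0 (dim_complementary E12) dimV.
- by case=> [|[|k]] // _; rewrite /= !vsum_cons !vsum_nil !addv0.
Qed.

Lemma dominated_list3 E1 E2 E3 : stable_by A E2 ->
  dominated_cut N A E1 (E2 + E3)%VS -> dominated_cut N A (E1 + E2)%VS E3 ->
  dominated_list N A [:: E1; E2; E3].
Proof.
move=> i2 [i1 _ [full c1] d1] [_ i3 [_ c2] d2]; split.
- by move=> E; rewrite !inE => /or3P[] /eqP->.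
- by rewrite !vsum_cons vsum_nil addv0.
- have c23 : (E2 :&: E3)%VS = 0%VS.
    by apply/eqP; rewrite -subv0 -c2; apply: capvS; [exact: addvSr|].
  rewrite !big_cons big_nil addn0 -(dimv_disjoint_sum c23) -(dimv_disjoint_sum c1) full.
  exact: dimV.
- by case=> [|[|[|k]]] // _; rewrite /= !vsum_cons !vsum_nil !addv0.
Qed.

Lemma contracts_sub E E' : (E' <= E)%VS -> contracts N A E -> contracts N A E'.
Proof.
move=> EE [eta [T [eta0 T0 h]]]; exists eta, T; split=> // t x tT xE.
by apply: h => //; exact: (subvP EE).
Qed.

Lemma expR_bound_spectral (hN : is_norm N) (f : 'End('rV[R]_n)) g E (kap r : R) :
  (forall x, g x = f x) -> 0 < kap < r ->
  (forall x, x \in E -> exists (c : R) (k0 : nat), forall k, (k0 <= k)%N ->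
     N (iter k f x) <= c * kap ^+ k) -> spectral_radius g E < r.
Proof.
move=> gf /andP[kap0 kapr] h; apply: le_lt_trans kapr.
exact: (spectral_radius_le hN gf kap0 h).
Qed.

End ShortLists.

(** * The required splittings at a singularity *)

Section SingularConclusion.
Context {R : realType} {n : nat} {M : topologicalType} {A : smooth_atlas R n M}.
Variables (g : riemannian_metric A) (X : M -> 'rV[R]_n) (phi : R -> M -> M).
Hypothesis hphi : is_flow (A := A) X phi.
Hypothesis hM : hausdorff_space M.
Variables (La : set M).
Hypothesis fK : finite_set (La `&` Sing X).
Variable h : M -> R -> pbundle A -> R.
Hypothesis hren : forall sigma, (La `&` Sing X) sigma ->
  renormalization_cocycle g X phi sigma (h sigma).
Variables (Ns Nu : pbundle A -> {vspace 'rV[R]_n}) (ds du : nat).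
Hypothesis hdim : forall L, extended_invariant_set g X phi La L ->
  \dim (Ns L) = ds /\ \dim (Nu L) = du.
Hypothesis dom : dominated_splitting g (extended_poincare_flow g phi)
  (extended_invariant_set g X phi La) [:: Ns; Nu].
Variables (Sp Sm : set M).
Hypotheses (hSp : Sp `<=` La `&` Sing X) (hSm : Sm `<=` La `&` Sing X).
Hypothesis cNs : unif_contracted g (rescaled_poincare_flow g phi (prod_cocycle h Sp))
  (extended_invariant_set g X phi La) Ns.
Hypothesis eNu : unif_expanded g (rescaled_poincare_flow g phi (prod_cocycle h Sm))
  (extended_invariant_set g X phi La) Nu.

Variable sigma : M.
Hypothesis hsig : (La `&` Sing X) sigma.
Local Notation N := (tnorm g sigma).
Local Notation F := (sing_flow (A := A) phi sigma).
Local Notation q := (line_dist g sigma).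

Let sLa : La sigma. Proof. by case: hsig. Qed.
Let sing : X sigma = 0. Proof. by case: hsig. Qed.
Let hN := tnorm_is_norm g sigma.
Let hF : is_group F := sing_flow_group hphi sing.

Section Center.
Variable C : {vspace 'rV[R]_n}.
Hypotheses (iC : stable_by F C) (cC : center_space g phi La sigma C).

Lemma rescaled_le_opnorm (hh : R -> pbundle A -> R) t u a (E : {vspace 'rV[R]_n}) :
  u != 0 -> a \in E ->
  hh t (line sigma u) * q (F t u) (F t a) <=
  opnorm g (rescaled_poincare_flow g phi hh) t (line sigma u) E * N a.
Proof.
move=> u0 aE; set f := rescaled_poincare_flow g phi hh.
have fZ c v : lf_map f t (line sigma u) (c *: v) = c *: lf_map f t (line sigma u) v.
  by rewrite /= (EPsi_singZ g hphi sing t c v u0) !scalerA mulrC.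
have fb : exists K, forall v, tnorm g (lf_pt f (lf_act f t (line sigma u)))
    (lf_map f t (line sigma u) v) <= K * tnorm g (lf_pt f (line sigma u)) v.
  have [K hK] := EPsi_sing_bounded g hphi sing t u0.
  exists (`|hh t (line sigma u)| * K) => v; rewrite /= tnormZ -mulrA ler_wpM2l//.
have := le_opnorm fZ fb aE; rewrite /= tnormZ; apply: le_trans.
rewrite (tnorm_EPsi_sing g hphi sing t a u0) ler_wpM2r ?ler_norm//.
exact: (q_ge0 hN (line_distP g sigma)).
Qed.

Lemma rate_Ns : rescaled_rate_bound N q F C (fun u => Ns (line sigma u)).
Proof.
have fSp : finite_set Sp := sub_finite_set hSp fK.
have [K K0 hK] := prod_cocycle_sing hphi fSp (fun s Ss => hren (hSp Ss)) hM sing.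
apply: (@rescaled_bound_of_contraction _ _ N hN q (line_distP g sigma) F C
  (fun u => Ns (line sigma u)) (fun t u => prod_cocycle h Sp t (line sigma u)) K K0).
  have [eta [T [eta0 T0 hc]]] := cNs; exists eta, T; split=> // u a t uC u0 aS tT.
  apply: (le_trans (rescaled_le_opnorm _ t u0 aS)).
  rewrite ler_wpM2r ?(N_ge0 hN)//; apply/ltW/hc => //.
  exact: (center_line_ext sing sLa cC uC u0).
by case: hK => hK; [left|right] => t u _; apply: hK.
Qed.

Lemma rate_Nu : rescaled_rate_bound N q (reversed F) C (fun u => Nu (line sigma u)).
Proof.
have fSm : finite_set Sm := sub_finite_set hSm fK.
have [K K0 hK] := prod_cocycle_sing hphi fSm (fun s Ss => hren (hSm Ss)) hM sing.
apply: (@rescaled_bound_of_contraction _ _ N hN q (line_distP g sigma) (reversed F) C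
  (fun u => Nu (line sigma u)) (fun t u => prod_cocycle h Sm (- t) (line sigma u)) K K0).
  have [eta [T [eta0 T0 hc]]] := eNu; exists eta, T; split=> // u a t uC u0 aS tT.
  apply: (le_trans (rescaled_le_opnorm _ (- t) u0 aS)).
  rewrite ler_wpM2r ?(N_ge0 hN)//; apply/ltW/hc => //.
  exact: (center_line_ext sing sLa cC uC u0).
by case: hK => hK; [left|right] => t u _; apply: hK.
Qed.

Lemma line_data u : u \in C -> u != 0 ->
  [/\ line_splitting q F u (Ns (line sigma u)) (Nu (line sigma u)),
    \dim (Ns (line sigma u)) = ds & \dim (Nu (line sigma u)) = du].
Proof.
move=> uC u0; have [d1 d2] := hdim (center_line_ext sing sLa cC uC u0).
by split=> //; apply: (sing_line_splitting hphi sing sLa iC cC dom).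
Qed.

End Center.

Hypothesis hyp : hyperbolic g X phi sigma.
Hypothesis hs : (stable_set phi sigma `&` La) `\ sigma !=set0.
Hypothesis hu : (unstable_set phi sigma `&` La) `\ sigma !=set0.

Lemma sing_conclusion :
  ((exists E F, [/\ dominated_at g phi sigma [:: E; F], contracted_at g phi sigma E,
      \dim E = ds & Wss (A := A) phi sigma E `&` La = [set sigma]]) \/
   (exists E F, [/\ dominated_at g phi sigma [:: E; F], expanded_at g phi sigma F,
      \dim F = du & Wuu (A := A) phi sigma F `&` La = [set sigma]])) /\
  exists Ess Ec Euu : {vspace 'rV[R]_n},
    [/\ dominated_at g phi sigma [:: Ess; Ec; Euu],
      [/\ \dim Ess = ds, \dim Ec = 1%N & \dim Euu = du] &
      exists rc : R,
      [/\ forall v, v \in Ec -> Dphi phi (A := A) 1 sigma v = rc *: v,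
        Num.max (spectral_radius (Dphi phi (A := A) 1 sigma) Ess)
                (spectral_radius (Dphi phi (A := A) (- 1) sigma) Euu)
          < Num.min rc rc^-1 &
        Num.min rc rc^-1 < 1]].
Proof.
have [ss [cs [cu [uu [cC [domL cEs cEu] Wss0 Wuu0 [cs0 cu0]]]]]] :=
  exists_center hphi sing sLa hs hu hyp.
pose SS := vsum ss; pose Cs := vsum cs; pose Cu := vsum cu; pose UU := vsum uu.
have [invL _ _ _] := domL.
have inv L : {subset L <= ss ++ cs ++ cu ++ uu} -> stable_by F (vsum L).
  by move=> sub; apply: invariant_vsum => E /sub; apply: invL.
have iSS : stable_by F SS by apply: inv => E EL; rewrite mem_cat EL.
have iCs : stable_by F Cs by apply: inv => E EL; rewrite !mem_cat EL orbT.
have iCu : stable_by F Cu by apply: inv => E EL; rewrite !mem_cat EL !orbT.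
have iUU : stable_by F UU by apply: inv => E EL; rewrite !mem_cat EL !orbT.
have addinv P Q : stable_by F P -> stable_by F Q -> stable_by F (P + Q)%VS.
  by move=> iP iQ t x /memv_addP[y yP [z zQ ->]]; rewrite homD memv_add ?iP ?iQ.
have cut1 : dominated_cut N F SS (Cs + (Cu + UU))%VS.
  have := dominated_list_cut hN (size ss) domL.
  by rewrite take_size_cat// drop_size_cat// !vsum_cat.
have cut2 : dominated_cut N F (SS + Cs)%VS (Cu + UU)%VS.
  have := dominated_list_cut hN (size (ss ++ cs)) domL.
  by rewrite catA take_size_cat// drop_size_cat// !vsum_cat.
have cut3 : dominated_cut N F (SS + (Cs + Cu))%VS UU.
  have := dominated_list_cut hN (size (ss ++ cs ++ cu)) domL.
  rewrite (_ : ss ++ cs ++ cu ++ uu = (ss ++ cs ++ cu) ++ uu); last by rewrite -!catA.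
  by rewrite take_size_cat// drop_size_cat// !vsum_cat.
have [_ _ comp1 dom1] := cut1; have [iEs iEu EE dom2] := cut2; have [_ _ comp3 dom3] := cut3.
rewrite vsum_cat in cEs; rewrite vsum_cat in cEu.
have {}cC : center_space g phi La sigma (Cs + Cu)%VS by rewrite -vsum_cat.
have iC : stable_by F (Cs + Cu)%VS by exact: addinv.
have data := line_data iC cC.
have rS := rate_Ns cC; have rU := rate_Nu cC.
have hF' := reversed_group hF.
have Cs0 : Cs != 0%VS by apply/eqP.
have Cu0 : Cu != 0%VS by apply/eqP.
have cEs' : contracts N (reversed (reversed F)) (SS + Cs)%VS by rewrite reversedK.
have domS : dominates N F SS Cs by apply: dominates_sub dom1; rewrite ?addvSl.
have domU : dominates N F Cu UU.
  by apply: dominates_sub dom3 => //; exact: subv_trans (addvSr _ _) (addvSr _ _).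
have SC : (SS :&: Cs = 0)%VS.
  by apply/eqP; rewrite -subv0 -comp1.2; apply: capvS => //; exact: addvSl.
have UC : (UU :&: Cu = 0)%VS.
  apply/eqP; rewrite -subv0 -comp3.2 capvC; apply: capvS => //.
  exact: subv_trans (addvSr _ _) (addvSr _ _).
(* Reversing time exchanges the stable and unstable data: the second dimension case below is the
   first one for the reversed flow. *)
have data' u : u \in (Cu + Cs)%VS -> u != 0 ->
  [/\ line_splitting q (reversed F) u (Nu (line sigma u)) (Ns (line sigma u)),
    \dim (Nu (line sigma u)) = du & \dim (Ns (line sigma u)) = ds].
  rewrite addvC => uC u0; have [l1 l2 l3] := data u uC u0.
  by split=> //; apply: reversed_line_splitting.
have rS' : rescaled_rate_bound N q (reversed (reversed F)) (Cu + Cs)%VS (fun u => Ns (line sigma u)).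
  by rewrite reversedK addvC.
have rU' : rescaled_rate_bound N q (reversed F) (Cu + Cs)%VS (fun u => Nu (line sigma u)).
  by rewrite addvC.
have domS' : dominates N (reversed F) Cs SS by exact: reversed_dominates.
have domU' : dominates N (reversed F) UU Cu by exact: reversed_dominates.
have EuE : (Cu + UU = UU + Cu)%VS := addvC _ _.
have EsE : (SS + Cs = Cs + SS)%VS := addvC _ _.
have hq := line_distP g sigma.
have ds_le := dim_stable_ge hN hq hF iEs iEu EE cEu erefl Cu0 data rS.
have du_le := dim_stable_ge hN hq hF' (reversed_invariant iEu)
  (reversed_invariant iEs) (complementaryC EE) cEs' EsE Cs0 data' rU'.
have dsum : (ds + du).+1 = \dim {:'rV[R]_n}.
  pose u := vpick Cs; have u0 : u != 0 by rewrite vpick0.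
  have uC : u \in (Cs + Cu)%VS by apply: (subvP (addvSl _ _)); exact: memv_pick.
  have [l <- <-] := data u uC u0; by rewrite -(ls_dim l) add1n addSn.
have dEE := dim_complementary EE.
(* Exactly one of [Es] and [Eu] has one dimension more than the corresponding bundle. *)
have key (a b : nat) : (ds <= a)%N -> (du <= b)%N -> (a + b = (ds + du).+1)%N ->
    a = ds.+1 /\ b = du \/ b = du.+1 /\ a = ds by lia.
have [[dEs dEu]|[dEu dEs]] := key _ _ ds_le du_le (etrans dEE (esym dsum)).
  have [z [r [kap [[z0 CsE dSS] kr r1 Az [hSS hEu]]]]] :=
    center_line hN hq hF iEs iEu EE cEs cEu erefl erefl SC Cs0 Cu0 iSS iCs iCu iUU
      domS domU data rS rU dEs.
  have r0 : 0 < r by case/andP: kr => k0 /(lt_trans k0).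
  have minr : Num.min r r^-1 = r.
    by apply/min_idPl/ltW; apply: (lt_trans r1); rewrite invf_gt1.
  split.
    (* The escaping stable space has dimension [ds]: it serves both for the singular dominated
       splitting and as [Ess], while the whole unstable space serves as [Euu]. *)
    left; exists SS, (Cs + (Cu + UU))%VS; split=> //.
      by apply/(dominated_atP g hphi sing); apply: dominated_list2.
    apply: (contracts_contracted_at hphi sing).
    by apply: contracts_sub cEs; exact: addvSl.
  exists SS, Cs, (Cu + UU)%VS; split.
  - by apply/(dominated_atP g hphi sing); apply: dominated_list3.
  - by split=> //; rewrite CsE dim_vline z0.
  exists r; rewrite minr; split=> //.
    move=> v; rewrite CsE => /vlineP[c ->]; rewrite -(sing_flowE phi sigma 1).
    by rewrite homZ Az !scalerA mulrC.
  rewrite gt_max; apply/andP; split.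
    by apply: (expR_bound_spectral hN _ kr hSS) => v; rewrite sing_flowE.
  by apply: (expR_bound_spectral hN _ kr hEu) => v; rewrite sing_flowE.
have [z [r [kap [[z0 CuE dUU] kr r1 Az [hUU hEs]]]]] :=
  center_line hN hq hF' (reversed_invariant iEu) (reversed_invariant iEs)
    (complementaryC EE) cEu cEs' EuE EsE UC Cu0 Cs0 (reversed_invariant iUU)
    (reversed_invariant iCu) (reversed_invariant iCs) (reversed_invariant iSS) domU' domS' data' rU' rS' dEu.
have r0 : 0 < r by case/andP: kr => k0 /(lt_trans k0).
(* Here [r < 1] is the center eigenvalue of the reversed flow, so the forward one is [r^-1 > 1]. *)
have minr : Num.min r^-1 r^-1^-1 = r.
  by rewrite invrK; apply/min_idPr/ltW; apply: (lt_trans r1); rewrite invf_gt1.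
split.
  right; exists (SS + (Cs + Cu))%VS, UU; split=> //.
    by apply/(dominated_atP g hphi sing); apply: dominated_list2.
  apply: (contracts_expanded_at hphi sing).
  by apply: contracts_sub cEu; exact: addvSr.
exists (SS + Cs)%VS, Cu, UU; split.
- apply/(dominated_atP g hphi sing); apply: dominated_list3 => //.
  by rewrite -addvA.
- by split=> //; rewrite CuE dim_vline z0.
exists r^-1; rewrite minr; split=> //.
  move=> v; rewrite CuE => /vlineP[c ->]; rewrite -(sing_flowE phi sigma 1).
  have e : F 1 z = r^-1 *: z.
    have e1 : F 1 (reversed F 1 z) = z := AKV hF 1 z.
    have e2 : F 1 (r *: z) = z := etrans (congr1 (F 1) (esym Az)) e1.
    rewrite homZ in e2; rewrite -[in RHS]e2 scalerA mulVf ?scale1r// gt_eqF//.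
  by rewrite homZ e !scalerA mulrC.
rewrite gt_max; apply/andP; split.
  apply: (expR_bound_spectral hN _ kr (f := F 1)) => [v|x xE]; first by rewrite sing_flowE.
  have [c [k0 hk]] := hEs x xE; exists c, k0 => k kk.
  by have := hk k kk; rewrite /reversed opprK.
by apply: (expR_bound_spectral hN _ kr hUU) => v; rewrite /reversed sing_flowE.
Qed.

End SingularConclusion.

(** * Regular orbits *)

Lemma cvg_pbundle {R : realType} {n : nat} {M : topologicalType} (A : smooth_atlas R n M)
  (F : set_system M) (FF : Filter F) (f : M -> pbundle A) (l : pbundle A) :
  (forall B, pbundle_subbase B -> B l -> F (f @^-1` B)) -> f @ F --> l.
Proof.
move=> h O; rewrite nbhsE => -[U [Uo Ul] UO].
rewrite /open /= in Uo; case: Uo => D hD e.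
rewrite -e in Ul; case: Ul => i Di il.
have [E hE ei] := hD i Di.
have : F (f @^-1` i).
  rewrite -ei preimage_bigcap; apply: filter_bigI => k kE.
  apply: h; first by have := hE k kE; rewrite inE.
  by move: il; rewrite -ei; apply.
by apply: filterS => x xi; apply: UO; rewrite -e; exists i.
Qed.

Section RegularLines.
Context {R : realType} {n : nat} {M : topologicalType} {A : smooth_atlas R n M}.
Variables (g : riemannian_metric A) (X : M -> 'rV[R]_n) (phi : R -> M -> M).
Hypothesis hphi : is_flow (A := A) X phi.
Hypothesis hM : hausdorff_space M.
Hypothesis hX : C1_vector_field A X.
Variable La : set M.
Implicit Types x : M.

Definition xline x : pbundle A := line x (X x).

Lemma field_continuous p x : cdom A p x ->
  {for x, continuous (fun y => tcoord A p y (X y))}.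
Proof.
move=> px; pose G y := tcoord A p (cinv A p y) (X (cinv A p y)).
have cG : {for chart A p x, continuous G}.
  by apply: differentiable_continuous; have [h _] := hX p; apply/h/cimg_chart.
have e : \forall y \near x, G (chart A p y) = tcoord A p y (X y).
  by apply: filterS (cdom_nbhs px) => y py; rewrite /G chartK.
suff : tcoord A p y (X y) @[y --> x] --> tcoord A p x (X x) by [].
rewrite -(nbhs_singleton e); apply: cvg_trans (near_eq_cvg e) _.
exact: (continuous_comp (chart_continuous px) cG).
Qed.

Lemma tcoordZ p x c v : tcoord A p x (c *: v) = c *: tcoord A p x v.
Proof. exact: linearZ. Qed.

Lemma near_regular x : X x != 0 -> \forall y \near x, X y != 0.
Proof.
move=> x0; have : nbhs x (~` Sing X).
  apply: open_nbhs_nbhs; split; last exact/eqP.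
  exact: closed_openC (closed_sing hphi hM).
by apply: filterS => y /eqP.
Qed.

(** An open condition met by some generator [c *: X x] of the line is met by [c *: X y] for [y]
    close to [x], and this vector is still nonzero. *)
Lemma xline_continuous x : X x != 0 -> {for x, continuous xline}.
Proof.
move=> x0; apply: cvg_pbundle => _ [p [U [V [oU oV ->]]]] [/= px Ux [w [wL w0 Vw]]].
have /vlineP[c wE] := wL.
have c0 : c != 0 by apply: contra_neq w0 => c0; rewrite wE c0 scale0r.
have H : \forall y \near x, V (c *: tcoord A p y (X y)).
  apply: (@continuous_comp _ _ _ (fun y => tcoord A p y (X y)) ( *:%R c)).
  - exact: field_continuous.
  - exact: scaler_continuous.
  - apply: open_nbhs_nbhs; split=> //; have := Vw; rewrite wE tcoordZ; exact.
have HU : nbhs x U by apply: open_nbhs_nbhs.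
apply: filterS (filterI (filterI (cdom_nbhs px) HU) (filterI H (near_regular x0))).
move=> y [[py Uy] [Vy y0]]; split=> //=.
exists (c *: X y); split; first by rewrite memvZ ?memv_line.
  by rewrite scaler_eq0 negb_or c0.
by rewrite tcoordZ.
Qed.

Lemma xline_ext x : (La `\` Sing X) x -> extended_invariant_set g X phi La (xline x).
Proof.
move=> [xLa /eqP x0]; left; split; last exact: G1_line.
by apply: subset_closure; exists x => //; split=> //; apply/eqP.
Qed.

Lemma pphi_xline t x : pphi phi t (xline x) = xline (phi t x).
Proof. by rewrite /xline pphi_line (Dphi_velocity hphi). Qed.

Lemma EPsi_xline t x v : X x != 0 -> EPsi g phi t (xline x) v = Psi g X phi t x v.
Proof. by move=> x0; rewrite /xline EPsi_line// (Dphi_velocity hphi). Qed.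

Lemma opnorm_xline t x V : X x != 0 ->
  opnorm g (poincare_flow g X phi) t x V =
  opnorm g (extended_poincare_flow g phi) t (xline x) V.
Proof.
move=> x0; rewrite /opnorm /=; congr sup; apply: eq_imagel => v _.
by rewrite EPsi_xline.
Qed.

Lemma regular_flow t x : X x != 0 -> X (phi t x) != 0.
Proof.
move=> x0; apply: contra_neq x0 => h; rewrite -(flowK hphi t x).
by rewrite -(Dphi_velocity hphi) h /Dphi linear0.
Qed.

Variables Ns Nu : pbundle A -> {vspace 'rV[R]_n}.

Lemma subbundle_xline d (E : pbundle A -> {vspace 'rV[R]_n}) :
  subbundle (extended_poincare_flow g phi) (A := A) (extended_invariant_set g X phi La) d E ->
  subbundle (poincare_flow g X phi) (A := A) (La `\` Sing X) d (E \o xline).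
Proof.
move=> h z0 z0L; have [W [e [oO Oz0 ce be]]] := h _ (xline_ext z0L).
exists [set z | X z != 0 /\ W (xline z)], (fun i z => e i (xline z)); split.
- rewrite openE => z [z1 zO]; apply: filterI; first exact: near_regular.
  by apply: (xline_continuous z1); apply: open_nbhs_nbhs.
- by split=> //; case: z0L => _ /eqP.
- move=> i; apply/subspace_continuousP => z [zL [z1 zO]].
  move: (ce i) => /subspace_continuousP/(_ (xline z) (conj (xline_ext zL) zO)); apply: cvg_trans.
  move=> B hB; pose T := extended_invariant_set g X phi La.
  have hB' : nbhs (xline z) [set L : pbundle A | (T `&` W) L -> B (L.1, e i L)] := hB.
  suff : nbhs z [set y | ((La `\` Sing X) `&` [set z | X z != 0 /\ W (xline z)]) y ->
    B (y, e i (xline y))] by [].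
  have hz : nbhs z (xline @^-1` [set L : pbundle A | (T `&` W) L -> B (L.1, e i L)]) := xline_continuous z1 hB'.
  apply: filterS hz => y hy [yL [y1 yO]].
  by apply: hy; split=> //; exact: xline_ext.
- by move=> z zL [z1 zO]; apply: be => //; exact: xline_ext.
Qed.

Lemma invariant_xline (E : pbundle A -> {vspace 'rV[R]_n}) :
  invariant_bundle (extended_poincare_flow g phi) (extended_invariant_set g X phi La) E ->
  invariant_bundle (poincare_flow g X phi) (La `\` Sing X) (E \o xline).
Proof.
move=> h t z zL; have := h t _ (xline_ext zL); rewrite /= pphi_xline => <-.
have z0 : X z != 0 by apply/eqP; case: zL.
congr (linfun _ @: _)%VS.
by apply/funext => v; rewrite EPsi_xline.
Qed.

Lemma dominated_xline :
  dominated_splitting g (extended_poincare_flow g phi) (extended_invariant_set g X phi La)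
    [:: Ns; Nu] ->
  dominated_splitting g (poincare_flow g X phi) (La `\` Sing X)
    [:: Ns \o xline; Nu \o xline].
Proof.
move=> [[sub fd] dom]; split; first split.
- case=> [|[|i]]// _ /=.
    have [[d /subbundle_xline sd] /invariant_xline inv] := sub 0%N isT.
    by split=> //; exists d.
  have [[d /subbundle_xline sd] /invariant_xline inv] := sub 1%N isT.
  by split=> //; exists d.
- move=> z zL; have [f d] := fd _ (xline_ext zL).
  have z0 : X z != 0 by apply/eqP; case: zL.
  split; first by move: f; rewrite /bsum !big_cons !big_nil /= orth_line.
  by move: d; rewrite !directvE /= !big_cons !big_nil.
- case=> [|[|k]]// _; have [eta [T [eta0 T0 h]]] := dom 1%N isT.
  exists eta, T; split=> // z t zL tT; have := h _ t (xline_ext zL) tT.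
  have z0 : X z != 0 by apply/eqP; case: zL.
  rewrite /bsum !big_seq1 /= pphi_xline.
  by rewrite !opnorm_xline//; exact: regular_flow.
Qed.

End RegularLines.

(** * Finiteness of the singularities and isolating neighborhoods *)

Lemma compact_discrete_finite (T : topologicalType) (K : set T) : compact K ->
  (forall x, K x -> \forall y \near x, K y -> y = x) -> finite_set K.
Proof.
move=> cK iso; apply: contrapT => infK.
pose F : set_system T := [set S | finite_set (K `\` S)].
have FF : ProperFilter F.
  split; first by rewrite /F /= setD0.
  split; first by rewrite /F /= setDT; exact: finite_set0.
    by move=> P Q fP fQ; rewrite /F /= setDIr finite_setU.
  by move=> P Q PQ; apply: sub_finite_set => x [Kx nQ]; split=> // /PQ.
have FK : F K by rewrite /F /= setDv; exact: finite_set0.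
have [x [Kx cx]] := cK F FF FK.
have [|y [[Ky yx] /(_ Ky)//]] := cx (K `\ x) _ _ (iso x Kx).
apply: (sub_finite_set _ (finite_set1 x)) => y [Ky h].
by apply: contrapT => yx; apply: h.
Qed.

(** Separating neighborhoods are intersected over the finitely many points of [K]. *)
Lemma disjoint_nbhs (T : topologicalType) (K : set T) : hausdorff_space T -> finite_set K ->
  exists W : T -> set T, (forall x, nbhs x (W x)) /\
    forall x y z, K x -> K y -> W x z -> W y z -> x = y.
Proof.
rewrite open_hausdorff => hT fK.
have /choice[Q hQ] : forall p : T * T, exists AB : set T * set T, p.1 != p.2 ->
    [/\ nbhs p.1 AB.1, nbhs p.2 AB.2 & AB.1 `&` AB.2 = set0].
  move=> [x y]; have [<-|xy] := eqVneq x y; first by exists (set0, set0) => /eqP[].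
  have [AB [/set_mem xA /set_mem yB] [oA oB /eqP AB0]] := hT x y xy.
  by exists AB => _; split=> //; apply: open_nbhs_nbhs.
exists (fun x => \bigcap_(y in [set` fset_set K])
   (if x == y then setT else (Q (x, y)).1 `&` (Q (y, x)).2)); split.
  move=> x; apply: filter_bigI => y _; case: eqVneq => [_|xy]; first exact: filterT.
  apply: filterI; first by have [] := hQ (x, y) xy.
  by rewrite eq_sym in xy; have [] := hQ (y, x) xy.
move=> x y z Kx Ky Wx Wy; apply: contrapT => /eqP xy.
have := Wx y; rewrite /= in_fset_set// inE (negPf xy) => /(_ Ky)[h1 _].
have := Wy x; rewrite /= in_fset_set// inE eq_sym (negPf xy) => /(_ Kx)[_ h2].
have [_ _ e] := hQ (x, y) xy.
have : ((Q (x, y)).1 `&` (Q (x, y)).2) z by [].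
by rewrite e.
Qed.

Section Isolating.
Context {R : realType} {n : nat} {M : topologicalType} {A : smooth_atlas R n M}.
Variables (X : M -> 'rV[R]_n) (phi : R -> M -> M).
Hypothesis hphi : is_flow (A := A) X phi.
Hypotheses (hM : hausdorff_space M) (cM : compact [set: M]).

Definition locally_isolating (sigma : M) (U : set M) (tau : R) :=
  forall x, (forall k : nat, U (phi (tau *+ k) x) /\ U (phi (- (tau *+ k)) x)) -> x = sigma.

(* The neighborhoods of the points of K are so small that the maps phi (+- tau)
   send none of them into another one; an orbit contained in their union
   then visits only one of them at the multiples of tau. *)
Lemma exists_isolating_neighborhood (K : set M) : finite_set K -> K `<=` Sing X ->
  (forall sigma, K sigma -> exists2 U, nbhs sigma U &
     exists2 tau : R, 0 < tau & locally_isolating sigma U tau) ->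
  exists2 V, compact V & isolating_neighborhood phi V K.
Proof.
move=> fK KS iso; have [W [Wn Wd]] := disjoint_nbhs hM fK.
have fix_ s t : K s -> phi t s = s by move=> /KS ss; apply: (sing_fixed hphi ss).
have /choice[P hP] : forall s, exists p : R * set M, K s ->
    [/\ closed p.2, nbhs s p.2, p.2 `<=` W s & locally_isolating s p.2 p.1 /\
      forall x, p.2 x -> W s (phi p.1 x) /\ W s (phi (- p.1) x)].
  move=> s; have [Ks|nK] := pselect (K s); last by exists (0, set0).
  have [U Un [tau tau0 hU]] := iso s Ks.
  have pre t : nbhs s (phi t @^-1` W s).
    by apply: (flow_continuous hphi); rewrite fix_.
  have nb : nbhs s ((U `&` W s) `&` (phi tau @^-1` W s `&` phi (- tau) @^-1` W s)).
    by apply: filterI; apply: filterI.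
  (* Regularity allows closed pieces, so that their finite union is closed in a compact space, hence
     compact. *)
  have [B Bn Bs] := compact_regular hM cM (filterT : nbhs s setT) nb.
  exists (tau, closure B) => _ /=; split.
  - exact: closed_closure.
  - by apply: filterS Bn; exact: subset_closure.
  - by move=> x /Bs[[]].
  - split; last by move=> x /Bs[_ []].
    by move=> x hx; apply: hU => k; have [/Bs[[]] ? _ _ /Bs[[]]] := hx k.
exists (\bigcup_(s in K) (P s).2).
  apply: (subclosed_compact _ cM) => //; apply: closed_bigcup => // s /hP[].
  by [].
split.
  move=> s Ks; have [_ nP _ _] := hP s Ks.
  by apply: filterS nP => x Px; exists s.
apply/seteqP; split=> [x hx|s Ks t]; last first.
  by exists s; rewrite ?fix_//; have [_ /nbhs_singleton] := hP s Ks.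
have [s Ks sx] := hx 0; rewrite (flow0 hphi) in sx.
have [_ _ PW [loc st]] := hP s Ks.
(* The sets [W s] being disjoint, a point of the union lying in [W s] belongs to the piece of
   [s]. *)
have back y : W s y -> (forall t, exists2 s', K s' & (P s').2 (phi t y)) -> (P s).2 y.
  move=> Wy /(_ 0)[s' Ks']; rewrite (flow0 hphi) => Py.
  have [_ _ PW' _] := hP s' Ks'.
  by rewrite (Wd s s' y Ks Ks' Wy (PW' y Py)).
have orb t u : exists2 s', K s' & (P s').2 (phi t (phi u x)).
  by rewrite -(flowD hphi); apply: hx.
suff H k : (P s).2 (phi ((P s).1 *+ k) x) /\ (P s).2 (phi (- ((P s).1 *+ k)) x).
  by rewrite (loc x H).
elim: k => [|k [h1 h2]]; first by rewrite mulr0n oppr0 (flow0 hphi).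
rewrite mulrS opprD !(flowD hphi); have [w1 _] := st _ h1; have [_ w2] := st _ h2.
by split; apply: back => // t; rewrite -(flowD hphi).
Qed.

End Isolating.

(** * Exponential rates away from the singularities *)

Section RegularRates.
Context {R : realType} {n : nat} {M : topologicalType} {A : smooth_atlas R n M}.
Variables (g : riemannian_metric A) (X : M -> 'rV[R]_n) (phi : R -> M -> M).
Hypothesis hphi : is_flow (A := A) X phi.
Variables (La V : set M).
Hypothesis KV : La `&` Sing X `<=` V°.
Variable h : M -> R -> pbundle A -> R.
Hypothesis hren : forall sigma, (La `&` Sing X) sigma ->
  renormalization_cocycle g X phi sigma (h sigma).
Hypothesis fK : finite_set (La `&` Sing X).

Lemma Psi_le_rescaled (H : R -> pbundle A -> R) (K e : R) t x (E : {vspace 'rV[R]_n}) :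
  X x != 0 -> 0 < K -> K <= H t (xline X x) ->
  opnorm g (rescaled_poincare_flow g phi H) t (xline X x) E <= e -> 0 <= e ->
  opnorm g (poincare_flow g X phi) t x E <= K^-1 * e.
Proof.
move=> x0 K0 KH he e0; apply: opnorm_le => [|v vE].
  by rewrite mulr_ge0 ?invr_ge0 ?(ltW K0).
set f := rescaled_poincare_flow g phi H.
have fE w : lf_map f t (xline X x) w = H t (xline X x) *: Psi g X phi t x w.
  by rewrite /= (EPsi_xline g hphi).
have fZ c w : lf_map f t (xline X x) (c *: w) = c *: lf_map f t (xline X x) w.
  by rewrite !fE /Psi /Dphi linearZ proj_orthZ !scalerA mulrC.
have fb : exists C, forall w, tnorm g (lf_pt f (lf_act f t (xline X x)))
    (lf_map f t (xline X x) w) <= C * tnorm g (lf_pt f (xline X x)) w.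
  have [C C0 hC] := tnorm_bounded g x (phi t x) (linfun (Dphi phi (A := A) t x)).
  exists (`|H t (xline X x)| * C) => w; rewrite fE tnormZ -mulrA ler_wpM2l//.
  have -> : lf_pt f (xline X x) = x by [].
  apply: le_trans (hC w); rewrite lfunE.
  exact: (q_leN (line_distP g (phi t x))).
rewrite -mulrA ler_pdivlMl//.
apply: le_trans (le_trans (le_opnorm fZ fb vE) (ler_wpM2r (tnorm_ge0 _ _ _) he)).
rewrite fE tnormZ ler_wpM2r ?tnorm_ge0//.
exact: le_trans KH (ler_norm _).
Qed.

(** Off [V] the product cocycle is at least some [K > 0], and half of the exponential rate absorbs
    the factor [K^-1]. The map [s] covers both time directions. *)
Lemma off_rate (S : set M) (E : pbundle A -> {vspace 'rV[R]_n}) (s : R -> R) :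
  S `<=` La `&` Sing X ->
  (exists eta T : R, [/\ 0 < eta, 0 < T & forall L t,
     extended_invariant_set g X phi La L -> T < t ->
     opnorm g (rescaled_poincare_flow g phi (prod_cocycle h S)) (s t) L (E L)
       < expR (- eta * t)]) ->
  exists eta T : R, [/\ 0 < eta, 0 < T & forall x t,
     (La `\` V) x -> (La `\` V) (phi (s t) x) -> T < t ->
     opnorm g (poincare_flow g X phi) (s t) x (E (xline X x)) < expR (- eta * t)].
Proof.
move=> SK [eta [T [eta0 T0 hE]]].
have [K K0 hK] := prod_cocycle_off (sub_finite_set SK fK)
  (fun sigma Ss => hren (SK _ Ss)) (fun sigma Ss => KV (SK _ Ss)).
have eta2 : 0 < eta / 2 by rewrite divr_gt0.
have K2 : 0 < K / 2 by rewrite divr_gt0.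
have [T' hT'] := expR_negl eta2 K2.
exists (eta / 2), (Num.max T T'); split=> //; first by rewrite lt_max T0.
move=> x t [xLa xV] [_ yV]; rewrite gt_max => /andP[tT tT'].
have xR : (La `\` Sing X) x.
  by split=> // xs; apply: xV; exact: (interior_subset (KV (conj xLa xs))).
have x0 : X x != 0 by apply/eqP; case: xR.
have tot : extended_total_space (A := A) X (xline X x).
  left; split; last exact: G1_line.
  by apply: subset_closure; exists x => //; split=> //; apply/eqP.
have hh := hE _ _ (xline_ext g phi xR) tT.
have kh := hK (s t) _ tot xV yV.
have le1 := Psi_le_rescaled x0 K0 kh (ltW hh) (expR_ge0 _).
apply: (le_lt_trans le1).
have -> : expR (- eta * t) = expR (- (eta / 2) * t) * expR (- (eta / 2) * t).
  by rewrite -expRD; congr expR; field.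
rewrite mulrA -[ltRHS]mul1r ltr_pM2r ?expR_gt0// ltr_pdivrMl// mulr1.
have := hT' _ tT'; rewrite mulr1 => /le_lt_trans; apply.
by rewrite ltr_pdivrMr// mulr_natr mulr2n ltrDr.
Qed.

End RegularRates.

Theorem theoremE (R : realType) (n : nat) (M : topologicalType)
    (A : smooth_atlas R n M) (g : riemannian_metric A)
    (X : M -> 'rV[R]_n) (phi : R -> M -> M) (La : set M)
    (hM : hausdorff_space M) (cM : compact [set: M])
    (hX : C1_vector_field A X) (hphi : is_flow (A := A) X phi)
    (cLa : compact La) (iLa : invariant_set phi La)
    (hs : forall sigma, (La `&` Sing X) sigma ->
       (stable_set phi sigma `&` La) `\ sigma !=set0)
    (hu : forall sigma, (La `&` Sing X) sigma ->
       (unstable_set phi sigma `&` La) `\ sigma !=set0) :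
  bonatti_da_luz g X phi La -> multi_singular_hyperbolic g X phi La.
Proof.
move=> [hyp [h [hren [Ns [Nu [[ds [du hdim]] dom [Sp hSp cNs] [Sm hSm eNu]]]]]]].
have iso sigma : (La `&` Sing X) sigma -> exists2 U, nbhs sigma U &
    exists2 tau : R, 0 < tau & locally_isolating phi sigma U tau.
  move=> Ks; have ss : X sigma = 0 by case: Ks.
  have [Es [Eu [[iEs iEu EE _] cEs cEu]]] := hyperbolic_cut hphi ss (hyp _ Ks).
  exact: (sing_isolating hphi ss iEs iEu EE cEs cEu).
have cK : compact (La `&` Sing X).
  by apply: compact_closedI => //; exact: (closed_sing hphi hM).
have fK : finite_set (La `&` Sing X).
  apply: compact_discrete_finite => // x Kx; have [U Un [tau tau0 loc]] := iso x Kx.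
  (* A singularity in [U] has a constant orbit, which stays in [U]: it must be [x]. *)
  apply: filterS Un => y Uy [_ ys]; apply: loc => k.
  by rewrite !(sing_fixed hphi ys).
have sc sigma (Ks : (La `&` Sing X) sigma) :=
  sing_conclusion hphi hM fK hren hdim dom hSp hSm cNs eNu Ks (hyp _ Ks) (hs _ Ks) (hu _ Ks).
have [V cV iV] := exists_isolating_neighborhood hphi hM cM fK (@subIsetr _ _ _) iso.
have [KV _] := iV.
have [e1 [T1 [e10 T10 h1]]] := off_rate hphi KV hren fK (s := id) hSp cNs.
have [e2 [T2 [e20 T20 h2]]] := off_rate hphi KV hren fK (s := -%R) hSm eNu.
exists (Ns \o xline X), (Nu \o xline X), ds, du; split.
- split; first exact: (dominated_xline hphi hM hX dom).
    by move=> x xR; apply: hdim; apply: xline_ext.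
  by move=> sigma Ks; have [] := sc sigma Ks.
- exists (Num.min e1 e2), (Num.max T1 T2), V; split=> //.
  + by rewrite lt_min e10.
  + by rewrite lt_max T10.
  move=> x t xV yV; rewrite gt_max => /andP[t1 t2]; split.
    apply: lt_le_trans (h1 x t xV yV t1) _.
    by rewrite ler_expR !mulNr lerN2 ler_wpM2r ?ge_min ?lexx// ltW// (lt_trans T10).
  (* The backward bound is taken at the endpoint [phi t x], which time [- t] brings back to [x]. *)
  have := h2 (phi t x) t yV; rewrite (flowK hphi) => /(_ xV t2) /lt_le_trans; apply.
  by rewrite ler_expR !mulNr lerN2 ler_wpM2r ?ge_min ?lexx ?orbT// ltW// (lt_trans T10).
- by move=> sigma Ks; have [] := sc sigma Ks.
Qed.
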